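(* Assume that $(u_0,v_0,m_0)$ satisfy hypotheses (i)–(iv) listed in the context, and let $(u^\varepsilon,v^\varepsilon,m^\varepsilon)$ denote the solution of Problem $(P^\varepsilon)$. Let $0<\eta<1/4$ and define $\mu=f'(1/2)=1/4$. Then there exist $\varepsilon_0>0$ and $M_0>0$ such that, for all $\varepsilon\in(0,\varepsilon_0]$, with $t^*=\mu^{-1}\varepsilon^2|\ln\varepsilon|$: (a) for all $x\in\Omega$, $-\eta\le u^\varepsilon(x,t^* )\le1+\eta$; (b) for all $x\in\Omega$ such that $|u_0(x)-\frac12|\ge M_0\varepsilon$: if $u_0(x)\ge\frac12+M_0\varepsilon$, then $u^\varepsilon(x,t^* )\ge1-\eta$; and if $u_0(x)\le\frac12-M_0\varepsilon$, then $u^\varepsilon(x,t^* )\le\eta$.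
   Context: $\Omega\subset\mathbb{R}^N$ ($N\ge2$) is a smooth bounded domain with exterior normal $\nu$ on $\partial\Omega$; $T>0$; $\lambda>0$, $\alpha>0$ are constants; $\chi$ is a smooth function with $\chi(v)>0$, $\chi'(v)>0$ for all $v>0$; $f(u)=u(1-u)(u-\frac12)$. Problem $(P^\varepsilon)$: find $(u,v,m)$ with $u_t=\Delta u-\nabla\cdot(u\nabla\chi(v))+\varepsilon^{-2}f(u)$, $v_t=-\lambda mv$, $m_t=\alpha\Delta m+u-m$ in $\Omega\times(0,T]$; $u(x,0)=u_0(x)$, $v(x,0)=v_0(x)$, $m(x,0)=m_0(x)$ for $x\in\Omega$; $\frac{\partial u}{\partial\nu}=\frac{\partial m}{\partial\nu}=0$ on $\partial\Omega\times(0,T]$. For $\varepsilon>0$ small enough it has a unique nonnegative solution $(u^\varepsilon,v^\varepsilon,m^\varepsilon)$. Hypotheses on the initial data: (i) $u_0,v_0,m_0$ are nonnegative $C^2$ functions on $\overline\Omega$, and $C_0>1$ is a fixed constant with $\|u_0\|_{C^2(\overline\Omega)}+\|v_0\|_{C^2(\overline\Omega)}+\|m_0\|_{C^2(\overline\Omega)}\le C_0$; (ii) $\frac{\partial v_0}{\partial\nu}=0$ on $\partial\Omega$; (iii) the open set $\Omega_0=\{x\in\Omega: u_0(x)>1/2\}$ is connected and $\Omega_0\subset\subset\Omega$; (iv) $\Gamma_0=\partial\Omega_0$ is a smooth hypersurface without boundary. Under these assumptions it is understood that $u_0>1/2$ in $\Omega_0$ and $0\le u_0<1/2$ in $\Omega\setminus\overline{\Omega_0}$.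 *)

(* Defs.v *)
From HB Require Import structures.
From mathcomp Require Import all_boot all_order all_algebra.
From mathcomp Require Import all_classical all_reals all_analysis.
From mathcomp Require Import ring lra.
Set Implicit Arguments.
Unset Strict Implicit.
Unset Printing Implicit Defensive.
Import Order.TTheory GRing.Theory Num.Theory.
Import numFieldNormedType.Exports.
Local Open Scope classical_set_scope.
Local Open Scope ring_scope.

(* Points of R^N are row vectors 'rV[R]_N.  Functions on subsets of R^N (or of
   R^N x R) are total functions; only their values on the set matter. *)

Section Calculus.
Context {R : realType} {N : nat}.
Implicit Types (f g phi : 'rV[R]_N -> R) (U A Omega : set 'rV[R]_N).
Implicit Types (x nu : 'rV[R]_N) (s : seq 'I_N).

Definition basis_vec (i : 'I_N) : 'rV[R]_N := delta_mx 0 i.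

Definition partial (i : 'I_N) f : 'rV[R]_N -> R := fun x => 'D_(basis_vec i) f x.

(* pderiv [:: i; j] f = d_i (d_j f) *)
Definition pderiv s f : 'rV[R]_N -> R := foldr partial f s.

Definition gradient f x : 'rV[R]_N := \row_i partial i f x.

Definition divergence (F : 'rV[R]_N -> 'rV[R]_N) x : R :=
  \sum_(i < N) partial i (fun y => F y 0 i) x.

Definition laplacian f x : R := \sum_(i < N) pderiv [:: i; i] f x.

(* The library norm on 'rV[R]_N is the sup norm. *)
Definition enorm x : R := Num.sqrt (\sum_(i < N) x 0 i ^+ 2).

Definition boundary A : set 'rV[R]_N := closure A `\` interior A.

(* f is of class C^k on the open set U.  Existence of the derivatives is
   required explicitly, since 'D_v f x is total. *)
Definition Ck_on (k : nat) U f : Prop :=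
  forall s, (size s <= k)%N ->
    (forall x, U x -> {for x, continuous (pderiv s f)}) /\
    ((size s < k)%N ->
       forall i x, U x -> derivable (pderiv s f) x (basis_vec i)).

Definition smooth_on U f : Prop := forall k, Ck_on k U f.

(* f is of class C^k on the closure of the open set Omega: all derivatives of
   order at most k extend continuously from Omega to its closure. *)
Definition Ck_closure (k : nat) Omega f : Prop :=
  [/\ Ck_on k Omega f,
      {within closure Omega, continuous f} &
      forall s, (size s <= k)%N ->
        exists g, {within closure Omega, continuous g} /\
                  forall x, Omega x -> g x = pderiv s f x].

Definition sup_norm Omega f : \bar R := ereal_sup [set `|f x|%:E | x in Omega].

(* Sum over the multi-indices of order at most 2 (so over i <= j for the second
   derivatives) of the sup norms.  It is extended-real valued because the real
   sup of an unbounded set is a default value. *)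
Definition C2_norm Omega f : \bar R :=
  (sup_norm Omega f
   + \sum_(i < N) sup_norm Omega (partial i f)
   + \sum_(i < N) \sum_(j < N | (i <= j)%N) sup_norm Omega (pderiv [:: i; j] f))%E.

(* Near x, Omega is the side {phi < 0} of the zero set of a smooth function phi
   without critical point at x; grad phi then points out of Omega. *)
Definition local_defining_function Omega x U phi : Prop :=
  [/\ open U, U x, smooth_on U phi, gradient phi x != 0 &
      forall y, U y -> (Omega y <-> phi y < 0)].

Definition smooth_bounded_domain Omega : Prop :=
  [/\ open Omega, connected Omega, Omega !=set0, bounded_set Omega &
      forall x, boundary Omega x ->
        exists U phi, local_defining_function Omega x U phi].

Definition exterior_normal Omega x nu : Prop :=
  exists U phi, local_defining_function Omega x U phi /\
    nu = (enorm (gradient phi x))^-1 *: gradient phi x.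

(* The normal derivative at a boundary point is the one-sided derivative of f
   along nu, taken from inside Omega. *)
Definition zero_normal_derivative Omega f : Prop :=
  forall x nu, boundary Omega x -> exterior_normal Omega x nu ->
    h^-1 * (f x - f (x - h *: nu)) @[h --> 0^'+] --> (0 : R).

(* Smooth embedded hypersurface; since the condition holds at every point of
   Gamma, it has no boundary points. *)
Definition smooth_hypersurface (Gamma : set 'rV[R]_N) : Prop :=
  forall x, Gamma x -> exists U phi,
    [/\ open U, U x, smooth_on U phi, gradient phi x != 0 &
        forall y, U y -> (Gamma y <-> phi y = 0)].

End Calculus.

Section Problem.
Context {R : realType} {N : nat}.
Implicit Types (Omega : set 'rV[R]_N) (w : 'rV[R]_N -> R -> R).
Implicit Types (T t l : R) (chi : R -> R).

(* l is the derivative at t of y restricted to (0, T]; at t = T it is the left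
   derivative. *)
Definition is_time_derivative T (y : R -> R) t l : Prop :=
  (y r - y t) / (r - t) @[r --> within [set r | 0 < r <= T] t^'] --> l.

Definition jointly (w : 'rV[R]_N -> R -> R) (p : 'rV[R]_N * R) : R := w p.1 p.2.

(* Regularity of classical solutions: C(clos Omega x [0,T]), C^{2,1} in
   Omega x (0,T], and space derivatives of first order continuous up to the
   lateral boundary. *)
Record classical Omega T w : Prop := {
  classical_cont :
    {within closure Omega `*` [set t | 0 <= t <= T], continuous (jointly w)};
  classical_space_derivable : forall t, 0 < t <= T -> Ck_on 2 Omega (w ^~ t);
  classical_space_cont : forall s : seq 'I_N, (size s <= 2)%N ->
    {within Omega `*` [set t | 0 < t <= T],
      continuous (jointly (fun x t => pderiv s (w ^~ t) x))};
  classical_time : exists wt : 'rV[R]_N -> R -> R,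
    (forall x t, Omega x -> 0 < t <= T -> is_time_derivative T (w x) t (wt x t))
    /\ {within Omega `*` [set t | 0 < t <= T], continuous (jointly wt)};
  classical_gradient_bdry : forall i : 'I_N, exists g : 'rV[R]_N -> R -> R,
    {within closure Omega `*` [set t | 0 < t <= T], continuous (jointly g)}
    /\ forall x t, Omega x -> 0 < t <= T -> g x t = partial i (w ^~ t) x }.

Definition bistable (z : R) : R := z * (1 - z) * (z - 2^-1).

Definition mu : R := (bistable^`())%classic 2^-1.

Lemma muE : mu = 4^-1.
Proof.
rewrite /mu.
pose p : {poly R} := 'X * (1 - 'X) * ('X - (2^-1)%:P).
have -> : bistable = horner p.
  by apply/funext => z; rewrite /bistable /p !hornerE.
have -> : (horner p)^`()%classic = horner p^`() by rewrite derive.derivE.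
rewrite /p !poly.derivE !hornerE /=.
lra.
Qed.

Record solution Omega T (lambda alpha : R) chi (u0 v0 m0 : 'rV[R]_N -> R)
    (eps : R) (u v m : 'rV[R]_N -> R -> R) : Prop := {
  sol_u_classical : classical Omega T u;
  sol_v_classical : classical Omega T v;
  sol_m_classical : classical Omega T m;
  sol_u_eq : forall x t, Omega x -> 0 < t <= T ->
    is_time_derivative T (u x) t
      (laplacian (u ^~ t) x
       - divergence
           (fun y => u y t *: gradient (fun z => chi (v z t)) y) x
       + eps ^- 2 * bistable (u x t));
  sol_v_eq : forall x t, Omega x -> 0 < t <= T ->
    is_time_derivative T (v x) t (- lambda * m x t * v x t);
  sol_m_eq : forall x t, Omega x -> 0 < t <= T ->
    is_time_derivative T (m x) t
      (alpha * laplacian (m ^~ t) x + u x t - m x t);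
  sol_init : forall x, Omega x ->
    [/\ u x 0 = u0 x, v x 0 = v0 x & m x 0 = m0 x];
  sol_u_neumann : forall t, 0 < t <= T -> zero_normal_derivative Omega (u ^~ t);
  sol_m_neumann : forall t, 0 < t <= T -> zero_normal_derivative Omega (m ^~ t) }.

Definition nonnegative_on Omega T w : Prop :=
  forall x t, Omega x -> 0 <= t <= T -> 0 <= w x t.

Definition nonnegative_solution Omega T lambda alpha chi
    (u0 v0 m0 : 'rV[R]_N -> R) eps u v m : Prop :=
  [/\ solution Omega T lambda alpha chi u0 v0 m0 eps u v m,
      nonnegative_on Omega T u, nonnegative_on Omega T v &
      nonnegative_on Omega T m].

(* chi is smooth on all of R (equivalently, by extension, on [0, +oo)): v may
   vanish, so smoothness on (0, +oo) alone would not give a meaning to the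
   haptotaxis term. *)
Definition admissible_sensitivity chi : Prop :=
  (forall n z, derivable ((chi^`(n))%classic) z 1) /\
  (forall z, 0 < z -> 0 < chi z /\ 0 < (chi^`())%classic z).

Definition Omega0 Omega (u0 : 'rV[R]_N -> R) : set 'rV[R]_N :=
  [set x | Omega x /\ 2^-1 < u0 x].

Record admissible_data Omega (C0 : R) (u0 v0 m0 : 'rV[R]_N -> R) : Prop := {
  data_nonneg : forall x, closure Omega x -> [/\ 0 <= u0 x, 0 <= v0 x & 0 <= m0 x];
  data_C2 : [/\ Ck_closure 2 Omega u0, Ck_closure 2 Omega v0
              & Ck_closure 2 Omega m0];
  data_bound :
    (C2_norm Omega u0 + C2_norm Omega v0 + C2_norm Omega m0 <= C0%:E)%E;
  data_v0_neumann : zero_normal_derivative Omega v0;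
  data_Omega0_connected : connected (Omega0 Omega u0);
  data_Omega0_compact : compact (closure (Omega0 Omega u0));
  data_Omega0_sub : closure (Omega0 Omega u0) `<=` Omega;
  data_Gamma0 : smooth_hypersurface (boundary (Omega0 Omega u0));
  data_outside : forall x, Omega x -> ~ closure (Omega0 Omega u0) x ->
    u0 x < 2^-1 }.

End Problem.

(* Main.v *)
(* Write w = u exp(chi(v0) - chi(v)).  Since v solves an ordinary differential
   equation in time, chi(v) - chi(v0) = O(t), and w satisfies an Allen-Cahn
   equation with bounded drift and a reaction eps^-2 (f(w) + O(t) w), in which no
   second derivative of v occurs.  The drift is bounded because m, hence v, is
   Lipschitz in x uniformly in eps; this follows from doubling the variables in
   the heat equation, with a weight that repels maxima from the boundary.  The
   same weight and a nested touching argument bound u and m.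

   Up to t* = 4 eps^2 |ln eps|, the solution is compared with explicit functions.
   The upper bound uses 1 + eta / 2 plus a term that decays on the scale eps^2.
   For the generation of the interface, u is compared with 1/2 +- Psi(Z), where
   Z = E (zeta + D eps^2 (E - 1)), E = e^(t / (4 eps^2)), which is 1 / eps at the
   final time, Psi is an explicit increasing function, and zeta is a C^2 majorant of
   +- (u0 - 1/2) which is comparable to it at a given point and has positive
   outward normal derivative. *)
Require Import Defs.
From HB Require Import structures.
From mathcomp Require Import all_boot all_order all_algebra.
From mathcomp Require Import all_classical all_reals all_analysis.
From mathcomp Require Import ring lra.
Set Implicit Arguments.
Unset Strict Implicit.
Unset Printing Implicit Defensive.
Import Order.TTheory GRing.Theory Num.Theory.
Import numFieldNormedType.Exports.
Local Open Scope classical_set_scope.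
Local Open Scope ring_scope.

(** * One-variable calculus *)

(* [lra] translates the whole context, so irrelevant hypotheses are dropped first. *)
Ltac arith := first [repeat match goal with
  | H : ?P |- _ => lazymatch P with
    | is_true (Order.le _ _) => fail | is_true (Order.lt _ _) => fail | @eq _ _ _ => fail
    | _ => match type of P with Prop => clear H end end
  end; lra | lra].

(** Nothing smooths the attractant: its equation is ordinary in time, so no uniform bound on second
    derivatives of [v] is at hand, and a normal derivative condition for [v] is not part of the
    problem but has to be propagated from [v0]. No such condition is assumed on [u0], so [u0 - 1/2]
    itself cannot start a barrier; this is why zeta is needed. Every maximum principle is obtained
    from one device: at the first time when a continuous function on a compact set reaches 0, only
    pointwise tests are made, namely the sign of a left time derivative, second derivatives along
    lines, and a one-sided slope at the boundary. The boundary is excluded by giving each comparison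
    function a strictly positive outward slope, so no Hopf lemma is used. The stopping time reflects
    the linearisation at 1/2: deviations are amplified by e^(t / (4 eps^2)), so one of size M0 eps
    becomes of order one. Since t* <= 4 eps, all O(t) errors, in the reaction and in passing between
    u and w, are O(eps). Uniformity in [eps] rests on the order of quantifiers: constants are fixed
    before [eps] and the solution. *)

Lemma half_lt3 (R : realFieldType) (r a b c : R) : 0 < r -> r <= a -> r <= b -> r <= c ->
  [/\ 0 < r / 2, r / 2 < a, r / 2 < b & r / 2 < c].
Proof. by move=> *; split; lra. Qed.

Section Calculus.
Context {R : realType} {V : normedModType R}.
Implicit Types (f g : V -> R) (x p : V).

Lemma is_derive_addf f g x p (a b : R) : is_derive x p f a -> is_derive x p g b ->
  is_derive x p (fun y => f y + g y) (a + b).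
Proof. by move=> fa gb; exact: is_deriveD. Qed.

Lemma is_derive_oppf f x p (a : R) : is_derive x p f a ->
  is_derive x p (fun y => - f y) (- a).
Proof. by move=> fa; exact: is_deriveN. Qed.

Lemma is_derive_subf f g x p (a b : R) : is_derive x p f a -> is_derive x p g b ->
  is_derive x p (fun y => f y - g y) (a - b).
Proof. by move=> fa gb; exact: is_deriveB. Qed.

Lemma is_derive_const (c : R) x p : is_derive x p (fun=> c) 0.
Proof. exact: is_derive_cst. Qed.

Lemma is_derive_mulf f g x p (a b : R) : is_derive x p f a -> is_derive x p g b ->
  is_derive x p (fun y => f y * g y) (a * g x + f x * b).
Proof.
move=> fa gb; have h : is_derive x p (f * g) _ := is_deriveM fa gb.
by apply: (is_derive_eq h); rewrite /GRing.scale /= addrC (mulrC a).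
Qed.

Lemma is_derive_scalef (c : R) f x p (a : R) : is_derive x p f a ->
  is_derive x p (fun y => c * f y) (c * a).
Proof.
move=> fa; have h := is_derive_mulf (is_derive_const c x p) fa.
by apply: (is_derive_eq h); rewrite mul0r add0r.
Qed.

Lemma is_derive_sumf n (f : 'I_n -> V -> R) x p (a : 'I_n -> R) :
  (forall i, is_derive x p (f i) (a i)) ->
  is_derive x p (fun y => \sum_(i < n) f i y) (\sum_(i < n) a i).
Proof.
move=> fa; have -> : (fun y => \sum_(i < n) f i y) = \sum_(i < n) f i.
  by apply/funext => y; rewrite fct_sumE.
exact: is_derive_sum.
Qed.

(** The difference quotient along [p] is, term by term, that of the restriction to the line through
    [x]. Through this equivalence one-variable results reach functions on R^N. *)
Lemma is_derive_line f x p a :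
  is_derive x p f a <-> is_derive (0 : R) 1 (fun s => f (s *: p + x)) a.
Proof.
have e : (fun h => h^-1 *: (((fun s => f (s *: p + x)) \o shift 0) (h *: 1) -
      (fun s : R => f (s *: p + x)) 0)) =
    (fun h : R => h^-1 *: ((f \o shift x) (h *: p) - f x)).
  by apply/funext => h /=; rewrite addr0 scale0r add0r [_%:A]mulr1.
split=> -[d v]; split.
- by rewrite /derivable e.
- by rewrite /derive e.
- by move: d; rewrite /derivable e.
- by move: v; rewrite /derive e.
Qed.

Lemma is_derive_epsP f x p (a : R) :
  (forall e, 0 < e -> exists2 d, 0 < d & forall h, h != 0 -> `|h| < d ->
    `|h^-1 * (f (h *: p + x) - f x) - a| < e) <-> is_derive x p f a.
Proof.
split=> [hf|[fd fa] e e0].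
  have c : h^-1 *: ((f \o shift x) (h *: p) - f x) @[h --> 0^'] --> a.
    move=> A /nbhs_ballP[e /= e0 eA]; have [d d0 hd] := hf _ e0.
    apply/nbhs_ballP; exists d => // h; rewrite /ball /= sub0r normrN => hh h0.
    by apply: eA; rewrite /ball /= distrC; exact: hd.
  by split; [apply/cvg_ex; exists a | exact: cvg_lim c].
have c : h^-1 *: ((f \o shift x) (h *: p) - f x) @[h --> 0^'] --> a by rewrite -fa.
have := c _ (nbhsx_ballx a e e0); rewrite /nbhs /= /dnbhs /within /= => /nbhs_ballP[d /= d0 hd].
exists d => // h h0 hh; have := hd h; rewrite /ball /= sub0r normrN distrC.
by move=> /(_ hh h0).
Qed.

End Calculus.

Section Lines.
Context {R : realType} {V : normedModType R}.
Implicit Types (f g : V -> R) (x p : V).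

Lemma is_derive_line_at f x p s a : is_derive (s *: p + x) p f a ->
  is_derive s (1 : R) (fun s => f (s *: p + x)) a.
Proof.
move=> /is_derive_line h; apply/(@is_derive_line _ R^o).
by apply: (@eq_ind _ _ (is_derive (0:R) 1 ^~ a) h); apply/funext => r;
  rewrite [_%:A]mulr1 scalerDl addrA.
Qed.

Lemma is_derive_comp_real (phi : R -> R) f x p a b :
  is_derive (f x) (1 : R) phi a -> is_derive x p f b ->
  is_derive x p (fun y => phi (f y)) (a * b).
Proof.
move=> ha /is_derive_line hb; apply/is_derive_line.
have := @is_derive1_comp _ phi (fun s => f (s *: p + x)) 0 a b.
by rewrite scale0r add0r; apply.
Qed.

End Lines.

Section RealCalculus.
Context {R : realType}.
Implicit Types (f g : R -> R).

Lemma is_derive_continuous f (x a : R) : is_derive x 1 f a -> {for x, continuous f}.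
Proof.
by move=> [+ _] => /derivable1_diffP /differentiable_continuous.
Qed.

Lemma mean_value f f' (a b : R) : a < b ->
  (forall x, a <= x <= b -> is_derive x 1 f (f' x)) ->
  exists2 c, a < c < b & f b - f a = f' c * (b - a).
Proof.
move=> ab d.
have [||c] := @MVT _ f f' a b ab.
- by move=> x; rewrite in_itv /= => /andP[h1 h2]; apply: d; rewrite !ltW.
- apply/continuous_in_subspaceT => c; rewrite inE /= in_itv /= => h.
  exact: is_derive_continuous (d c h).
- by rewrite in_itv /=; exists c.
Qed.

Lemma nbhs_realP (P : R -> Prop) (x : R) :
  (\forall y \near x, P y) <-> exists2 d, 0 < d & forall y, `|y - x| < d -> P y.
Proof.
split=> [/nbhs_ballP[d /= d0 h]|[d d0 h]].
  by exists d => // y hy; apply: h; rewrite /ball /= distrC.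
by apply/nbhs_ballP; exists d => // y; rewrite /ball /= distrC => hy; exact: h.
Qed.

Lemma is_derive_sign_near f (x a : R) : is_derive x 1 f a -> 0 < a ->
  exists2 d, 0 < d & forall y, `|y - x| < d -> y != x -> 0 < (f y - f x) / (y - x).
Proof.
move=> [fd fa] a0; move: fd; rewrite /derivable => h.
have {}h : h^-1 *: ((f \o shift x) (h *: 1) - f x) @[h --> 0^'] --> a.
  by rewrite -fa.
have /= := h _ (nbhsx_ballx a a a0).
rewrite /nbhs /= /dnbhs /within /= => /nbhs_ballP[d /= d0 hd].
exists d => // y yd yx.
have := hd (y - x); rewrite /ball /= sub0r normrN => /(_ yd); rewrite subr_eq0 => /(_ yx).
rewrite [_%:A]mulr1 subrK /GRing.scale /= mulrC => hh.
have := ler_norm (a - (f y - f x) / (y - x)); lra.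
Qed.

Lemma is_derive_local_max f (x a : R) : is_derive x 1 f a ->
  (\forall y \near x, f y <= f x) -> a = 0.
Proof.
move=> d /nbhs_realP[e e0 he].
have [a0|a0|//] := ltrgt0P a.
- have [r r0 hr] := is_derive_sign_near d a0.
  pose y := x + Num.min e r / 2.
  have m0 : 0 < Num.min e r by rewrite lt_min e0 r0.
  have [m1 m2] : Num.min e r <= e /\ Num.min e r <= r by rewrite !ge_min !lexx orbT.
  have yx : y - x = Num.min e r / 2 by rewrite /y; lra.
  have := hr y; rewrite yx ger0_norm; last lra.
  have -> : Num.min e r / 2 < r by lra.
  have -> : y != x by rewrite -subr_eq0 yx; apply/lt0r_neq0; lra.
  move=> /(_ isT isT); rewrite pmulr_lgt0 ?invr_gt0 ?divr_gt0 //.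
  have := he y; rewrite yx ger0_norm; last lra.
  have -> : Num.min e r / 2 < e by lra.
  by move=> /(_ isT); lra.
- have a0' : 0 < - a by lra.
  have [r r0 hr] := is_derive_sign_near (is_derive_oppf d) a0'.
  pose y := x - Num.min e r / 2.
  have m0 : 0 < Num.min e r by rewrite lt_min e0 r0.
  have [m1 m2] : Num.min e r <= e /\ Num.min e r <= r by rewrite !ge_min !lexx orbT.
  have yx : y - x = - (Num.min e r / 2) by rewrite /y; lra.
  have := hr y; rewrite yx normrN ger0_norm; last lra.
  have -> : Num.min e r / 2 < r by lra.
  have -> : y != x by rewrite -subr_eq0 yx oppr_eq0; apply/lt0r_neq0; lra.
  move=> /(_ isT isT); rewrite nmulr_lgt0 ?invr_lt0 ?oppr_lt0 ?divr_gt0 //.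
  have := he y; rewrite yx normrN ger0_norm; last lra.
  have -> : Num.min e r / 2 < e by lra.
  by move=> /(_ isT); lra.
Qed.

(** At a first touching time only earlier times can be compared, so of the vanishing derivative only
    a sign survives. *)
Lemma is_derive_left_max f (x a : R) : is_derive x 1 f a ->
  (exists2 d, 0 < d & forall y, x - d < y < x -> f y <= f x) -> 0 <= a.
Proof.
move=> d [e e0 he]; rewrite leNgt; apply/negP => a0.
have a0' : 0 < - a by lra.
have [r r0 hr] := is_derive_sign_near (is_derive_oppf d) a0'.
pose y := x - Num.min e r / 2.
have m0 : 0 < Num.min e r by rewrite lt_min e0 r0.
have [m1 m2] : Num.min e r <= e /\ Num.min e r <= r by rewrite !ge_min !lexx orbT.
have yx : y - x = - (Num.min e r / 2) by rewrite /y; lra.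
have := hr y; rewrite yx normrN ger0_norm; last lra.
have -> : Num.min e r / 2 < r by lra.
have -> : y != x by rewrite -subr_eq0 yx oppr_eq0; apply/lt0r_neq0; lra.
move=> /(_ isT isT); rewrite nmulr_lgt0 ?invr_lt0 ?oppr_lt0 ?divr_gt0 //.
have := he y; have -> : x - e < y < x by rewrite /y; lra.
by move=> /(_ isT); lra.
Qed.

(** A positive [f''] would make [f'] positive just to the right of 0, and the mean value theorem
    would give a value above [f 0]. Differentiability of [f'] at the single point 0 suffices. *)
Lemma second_derivative_test f f' (f'' : R) (d : R) : 0 < d ->
  (forall s : R, `|s| < d -> is_derive s 1 f (f' s)) -> is_derive (0 : R) 1 f' f'' ->
  (forall s, `|s| < d -> f s <= f 0) -> f' 0 = 0 /\ f'' <= 0.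
Proof.
move=> d0 df df' fmax.
have f'0 : f' 0 = 0.
  apply: (is_derive_local_max (df 0 _)); first by rewrite normr0.
  by apply/nbhs_realP; exists d => // y; rewrite subr0; exact: fmax.
split=> //; rewrite leNgt; apply/negP => f''0.
have [r r0 hr] := is_derive_sign_near df' f''0.
pose e := Num.min d r / 2.
have m0 : 0 < Num.min d r by rewrite lt_min d0 r0.
have [m1 m2] : Num.min d r <= d /\ Num.min d r <= r by rewrite !ge_min !lexx orbT.
have e0 : 0 < e by rewrite /e; lra.
have [er ed] : e < r /\ e < d by rewrite /e; lra.
have [|c /andP[c0 ce]] := @mean_value f f' 0 e e0.
  by move=> x /andP[x0 xe]; apply: df; rewrite ger0_norm //; lra.
rewrite subr0 => h.
have fc : 0 < f' c.
  have := hr c; rewrite subr0 f'0 subr0 ger0_norm ?ltW // (lt_trans ce er) gt_eqF //.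
  by move=> /(_ isT isT); rewrite pmulr_lgt0 // invr_gt0.
have /fmax : `|e| < d by rewrite ger0_norm // ltW.
have : 0 < f' c * e by rewrite mulr_gt0.
by move: h; lra.
Qed.

End RealCalculus.

Section Bump.
Context {R : realType}.

(** For [k = 1] and [k = 0] these are the two derivatives of the cubed positive part. The cube is
    the least integer power that is C^2, and it is the cut-off for local defining functions. *)
Lemma is_derive_posX (k : nat) (y : R) :
  is_derive y 1 (fun s : R => Num.max 0 s ^+ k.+2) (k.+2%:R * Num.max 0 y ^+ k.+1).
Proof.
have [->|/lt_total/orP[y0|y0]] := eqVneq y 0.
- rewrite maxxx expr0n /= mulr0; apply/is_derive_epsP => e e0.
  exists (Num.min 1 e) => [|h h0]; first by rewrite lt_min ltr01.
  rewrite [_%:A]mulr1 addr0 maxxx (_ : (0 : R) ^+ k.+2 = 0) ?expr0n // subr0 subr0 lt_min => /andP[h1 he].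
  have [hp|hn] := leP 0 h; last by rewrite expr0n mulr0 normr0.
  rewrite exprS mulrA mulVf // mul1r ger0_norm ?exprn_ge0 //.
  rewrite ger0_norm // in h1 he.
  by apply: le_lt_trans he; rewrite exprS ler_piMr // exprn_ile1 // ltW.
- rewrite max_l ?ltW // expr0n mulr0.
  apply: (near_eq_is_derive (f := fun s : R => 0)).
    near=> s; have s0 : s < 0 by near: s; exact: lt_nbhsl.
    by rewrite max_l ?expr0n // ltW.
- rewrite max_r ?ltW //; apply: (near_eq_is_derive (f := fun s : R => s ^+ k.+2)).
    near=> s; have s0 : 0 < s by near: s; exact: lt_nbhsr.
    by rewrite max_r // ltW.
  split; first exact: exprn_derivable.
  by rewrite exp_derive /= /GRing.scale /= mulr1.
Unshelve. all: by end_near. Qed.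

End Bump.

(** * The Euclidean norm and C^2 functions *)

Section Euclid.
Context {R : realType} {N : nat}.
Notation V := 'rV[R]_N.
Implicit Types (x y z p : V) (a b : R).

(** The sup norm of row vectors does not come from an inner product, which reflections and squared
    distances require. [norm_le_enorm] and [enorm_le_norm] transfer the topology. *)
Definition dot x y : R := \sum_(i < N) x 0 i * y 0 i.

Lemma dotC x y : dot x y = dot y x.
Proof. by apply: eq_bigr => i _; rewrite mulrC. Qed.

Lemma dotDl x y z : dot (x + y) z = dot x z + dot y z.
Proof. by rewrite -big_split; apply: eq_bigr => i _; rewrite /= !mxE mulrDl. Qed.

Lemma dotZl a x y : dot (a *: x) y = a * dot x y.
Proof. by rewrite mulr_sumr; apply: eq_bigr => i _; rewrite !mxE mulrA. Qed.

Lemma dotDr x y z : dot z (x + y) = dot z x + dot z y.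
Proof. by rewrite dotC dotDl !(dotC z). Qed.

Lemma dotZr a x y : dot x (a *: y) = a * dot x y.
Proof. by rewrite dotC dotZl dotC. Qed.

Lemma dotNl x y : dot (- x) y = - dot x y.
Proof. by rewrite -scaleN1r dotZl mulN1r. Qed.

Lemma dotNr x y : dot x (- y) = - dot x y.
Proof. by rewrite dotC dotNl dotC. Qed.

Lemma dot0l x : dot 0 x = 0.
Proof. by rewrite -(scale0r x) dotZl mul0r. Qed.

Lemma dot0r x : dot x 0 = 0.
Proof. by rewrite dotC dot0l. Qed.

Definition dotE := (dotDl, dotDr, dotNl, dotNr, dotZl, dotZr, dot0l, dot0r).

Lemma dot_ge0 x : 0 <= dot x x.
Proof. by apply: sumr_ge0 => i _; rewrite -expr2 sqr_ge0. Qed.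

Lemma dot_eq0 x : (dot x x == 0) = (x == 0).
Proof.
apply/eqP/eqP => [h|->]; last by rewrite dot0l.
apply/rowP => i; rewrite mxE.
have h0 (j : 'I_N) : true -> 0 <= x 0 j * x 0 j by rewrite -expr2 sqr_ge0.
have := psumr_eq0P h0 h; move=> /(_ i isT) /eqP.
by rewrite mulf_eq0 orbb => /eqP.
Qed.

Lemma enorm_sqr x : enorm x ^+ 2 = dot x x.
Proof.
rewrite /enorm sqr_sqrtr; first by apply: eq_bigr => i _; rewrite expr2.
by apply: sumr_ge0 => i _; rewrite sqr_ge0.
Qed.

Lemma enorm_ge0 x : 0 <= enorm x.
Proof. exact: sqrtr_ge0. Qed.
Hint Resolve enorm_ge0 : core.

Lemma enorm_eq0 x : (enorm x == 0) = (x == 0).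
Proof. by rewrite -dot_eq0 -enorm_sqr sqrf_eq0. Qed.

Lemma enorm_gt0 x : (0 < enorm x) = (x != 0).
Proof. by rewrite lt_def enorm_eq0 enorm_ge0 andbT. Qed.

Lemma enorm0 : enorm (0 : V) = 0.
Proof. by apply/eqP; rewrite enorm_eq0. Qed.

Lemma enormZ a x : enorm (a *: x) = `|a| * enorm x.
Proof.
apply/eqP; rewrite -(@eqrXn2 _ 2) ?mulr_ge0 //.
by rewrite exprMn !enorm_sqr !dotE mulrA -expr2 real_normK // num_real.
Qed.

Lemma enormN x : enorm (- x) = enorm x.
Proof. by rewrite -scaleN1r enormZ normrN1 mul1r. Qed.

Lemma enormB x y : enorm (x - y) = enorm (y - x).
Proof. by rewrite -enormN opprB. Qed.

Lemma cauchy_schwarz x y : `|dot x y| <= enorm x * enorm y.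
Proof.
rewrite -(@ler_pXn2r _ 2) ?nnegrE ?mulr_ge0 //.
rewrite real_normK ?num_real // exprMn !enorm_sqr.
have [/eqP|y0] := eqVneq (dot y y) 0.
  by rewrite dot_eq0 => /eqP ->; rewrite !dot0r expr0n mulr0.
have y1 : 0 < dot y y by rewrite lt_def y0 dot_ge0.
have := dot_ge0 (dot y y *: x - dot x y *: y); rewrite !dotE (dotC y x) => h.
rewrite -(@ler_pM2l _ (dot y y)) // -subr_ge0.
by apply: le_trans h _; rewrite le_eqVlt; apply/orP; left; apply/eqP; ring.
Qed.

Lemma dot_le x y : dot x y <= enorm x * enorm y.
Proof. exact: le_trans (ler_norm _) (cauchy_schwarz x y). Qed.

Lemma enormD x y : enorm (x + y) <= enorm x + enorm y.
Proof.
rewrite -(@ler_pXn2r _ 2) ?nnegrE ?addr_ge0 // sqrrD !enorm_sqr !dotE (dotC y x).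
by have := dot_le x y; lra.
Qed.

Lemma enorm_sub_le x y z : enorm (x - z) <= enorm (x - y) + enorm (y - z).
Proof. by have := enormD (x - y) (y - z); rewrite addrA subrK. Qed.

Lemma coord_le_enorm x i : `|x 0 i| <= enorm x.
Proof.
rewrite -(@ler_pXn2r _ 2) ?nnegrE // enorm_sqr real_normK ?num_real //.
rewrite /dot (bigD1 i) //= -expr2 lerDl.
by apply: sumr_ge0 => j _; rewrite -expr2 sqr_ge0.
Qed.

Lemma coord_le_norm x i : `|x 0 i| <= `|x|.
Proof.
rewrite [leRHS]/Num.Def.normr /= mx_normrE.
by apply: (le_bigmax_seq _ (0, i)) => //; rewrite mem_index_enum.
Qed.

Lemma norm_le_enorm x : `|x| <= enorm x.
Proof.
rewrite [leLHS]/Num.Def.normr /= mx_normrE; apply/bigmax_leP; split => //.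
by case=> i j _ /=; rewrite (ord1 i); exact: coord_le_enorm.
Qed.

Lemma enorm_le_norm x : enorm x <= N%:R * `|x|.
Proof.
rewrite -(@ler_pXn2r _ 2) ?nnegrE ?mulr_ge0 // enorm_sqr exprMn.
apply: (@le_trans _ _ (\sum_(i < N) `|x| ^+ 2)).
  apply: ler_sum => i _; rewrite -expr2 -real_normK ?num_real //.
  by rewrite ler_pXn2r ?nnegrE // coord_le_norm.
rewrite sumr_const card_ord -[X in X <= _]mulr_natl; apply: ler_wpM2r; first exact: sqr_ge0.
by rewrite -natrX ler_nat; case: (N) => // n; rewrite expnS expn1 leq_pmull.
Qed.

Lemma nbhs_enormP (P : V -> Prop) x :
  (\forall y \near x, P y) <-> exists2 d, 0 < d & forall y, enorm (y - x) < d -> P y.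
Proof.
split=> [/nbhs_ballP[d /= d0 h]|[d d0 h]].
  exists d => // y hy; apply: h; rewrite -ball_normE /= distrC.
  exact: le_lt_trans (norm_le_enorm _) hy.
(* [N.+1] rather than [N] keeps the radius positive when [N = 0]. *)
apply/nbhs_ballP; exists (d / N.+1%:R) => /=; first by rewrite divr_gt0.
move=> y; rewrite -ball_normE /= distrC => hy; apply: h.
apply: le_lt_trans (enorm_le_norm _) _.
apply: (@le_lt_trans _ _ (`|y - x| * N.+1%:R)); last by rewrite -ltr_pdivlMr.
by rewrite mulrC; apply: ler_wpM2l => //; rewrite ler_nat.
Qed.

Lemma open_enormP (U : set V) : open U <->
  forall x, U x -> exists2 d, 0 < d & forall y, enorm (y - x) < d -> U y.
Proof.
split=> [oU x Ux|h].
  by apply/nbhs_enormP; exact: open_nbhs_nbhs.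
by rewrite openE => x Ux; apply/nbhs_enormP; exact: h.
Qed.

Lemma continuous_enormP (f : V -> R) x : {for x, continuous f} <->
  forall e, 0 < e -> exists2 d, 0 < d & forall y, enorm (y - x) < d -> `|f y - f x| < e.
Proof.
split=> [cf e e0|h].
  have := cf _ (nbhsx_ballx (f x) e e0).
  rewrite /nbhs /= => /nbhs_enormP[d d0 hd]; exists d => // y /hd.
  by rewrite /= /ball /= distrC.
move=> A /nbhs_ballP[e /= e0 hA]; have [d d0 hd] := h _ e0.
apply/nbhs_enormP; exists d => // y /hd; rewrite distrC => hy; exact: hA.
Qed.

Lemma basis_vecE (i j : 'I_N) : basis_vec (R:=R) i 0 j = (j == i)%:R.
Proof. by rewrite /basis_vec mxE eqxx. Qed.

Lemma dot_basis x i : dot x (basis_vec i) = x 0 i.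
Proof.
rewrite /dot (bigD1 i) //= basis_vecE eqxx mulr1 big1 ?addr0 // => j ji.
by rewrite basis_vecE (negbTE ji) mulr0.
Qed.

Lemma enorm_basis i : enorm (basis_vec (R:=R) i : V) = 1.
Proof.
apply/eqP; rewrite -(@eqrXn2 _ 2) // enorm_sqr dot_basis basis_vecE eqxx.
by rewrite expr1n.
Qed.

End Euclid.
#[global] Hint Extern 0 (is_true (Order.le _ (enorm _))) => exact: enorm_ge0 : core.

#[local] Hint Extern 0 (is_true (Order.le _ (enorm _))) => exact: enorm_ge0 : core.

Section DirectionalDerivatives.
Context {R : realType} {N : nat}.
Notation V := 'rV[R]_N.
Implicit Types (f g : V -> R) (x y p : V) (U : set V).

Lemma mean_value0 (k k' : R -> R) (b : R) :
  (forall s : R, `|s| <= `|b| -> is_derive s 1 k (k' s)) ->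
  exists2 c, `|c| <= `|b| & k b - k 0 = k' c * b.
Proof.
move=> d; have [b0|b0|->] := ltrgt0P b; last by exists 0; rewrite ?subrr ?mulr0 ?normr0 ?lexx.
  have [|c /andP[c0 cb]] := @mean_value _ k k' 0 b b0.
    by move=> s /andP[s0 sb]; apply: d; rewrite !ger0_norm // ltW.
  by rewrite subr0 => h; exists c => //; rewrite !ger0_norm // ltW.
have [|c /andP[c0 cb] h] := @mean_value _ k k' b 0 b0.
  by move=> s /andP[s0 sb]; apply: d; rewrite !ler0_norm ?lerN2 // ltW.
exists c; first by rewrite !ler0_norm ?lerN2 // ltW.
by move: h; rewrite sub0r mulrN => h; rewrite -[k b - k 0]opprB h opprK.
Qed.

(** The directional derivative predicted by the partial derivatives; [is_derive_gr] proves that it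
    is one. *)
Definition gr f x p : R := \sum_(k < N) p 0 k * partial k f x.

(** Coordinates are changed one at a time; each change is a mean value along one basis vector, and
    continuity of the partial derivatives at [x] moves the intermediate points to [x]. *)
Lemma is_derive_gr U f x p : open U -> U x ->
  (forall i y, U y -> derivable f y (basis_vec i)) ->
  (forall i, {for x, continuous (partial i f)}) ->
  is_derive x p f (gr f x p).
Proof.
move=> oU Ux fd fc; apply/is_derive_epsP => e e0.
pose M := \sum_(k < N) `|p 0 k| + 1.
have M0 : 0 < M by rewrite ltr_pwDr // sumr_ge0.
pose e' := e / M; have e'0 : 0 < e' by rewrite divr_gt0.
have [d d0 hd] : exists2 d, 0 < d & forall y, enorm (y - x) < d ->
    U y /\ forall i, `|partial i f y - partial i f x| < e'.
  apply/nbhs_enormP; apply: filterI; first exact: open_nbhs_nbhs.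
  have := @filter_forall _ _ (fun i y => `|partial i f y - partial i f x| < e') (nbhs x) _.
  by apply=> i; apply/nbhs_enormP; move/continuous_enormP: (fc i); exact.
exists (d / (2 * enorm p + 1)); first by apply: divr_gt0 => //; apply: ltr_wpDl => //; apply: mulr_ge0 => //; exact: enorm_ge0.
move=> h h0 hh.
have hd2 : `|h| * (2 * enorm p) < d.
  rewrite ltr_pdivlMr in hh; last by rewrite ltr_wpDl // mulr_ge0.
  apply: le_lt_trans hh; apply: ler_wpM2l => //; lra.
(* [q k] keeps the first [k] coordinates of [p], so that [q k] and [q k.+1] differ along a single
   basis vector. Its Euclidean norm does not exceed that of [p], hence all intermediate points stay
   in the ball of radius [d]. *)
pose q k : V := \row_j (if (j < k)%N then p 0 j else 0).
have qp k : enorm (q k) <= enorm p.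
  rewrite -(@ler_pXn2r _ 2) ?nnegrE // !enorm_sqr; apply: ler_sum => i _.
  by rewrite mxE; case: ifP => _; rewrite ?mul0r -expr2 ?sqr_ge0.
have H k : (k <= N)%N ->
    `|f (h *: q k + x) - f x - h * \sum_(j < N | (j < k)%N) p 0 j * partial j f x|
    <= `|h| * (e' * \sum_(j < N | (j < k)%N) `|p 0 j|).
  elim: k => [_|k IH kN].
    have -> : q 0%N = 0 by apply/rowP => j; rewrite !mxE.
    rewrite scaler0 add0r !big_pred0 // ?mulr0 ?subr0 ?subrr ?normr0 //.
  have {}IH := IH (ltnW kN).
  pose k0 : 'I_N := Ordinal kN.
  have E (F : 'I_N -> R) : \sum_(j < N | (j < k.+1)%N) F j =
      F k0 + \sum_(j < N | (j < k)%N) F j.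
    rewrite (bigD1 k0) //=; congr (_ + _); apply: eq_bigl => j.
    by rewrite ltnS [RHS]ltn_neqAle andbC; congr (_ && _).
  have qE : h *: q k.+1 = (h * p 0 k0) *: basis_vec k0 + h *: q k.
    apply/rowP => j; rewrite !mxE eqxx /=.
    have [->|jk] := eqVneq j k0; first by rewrite /= ltnSn ltnn; lra.
    have -> : (j < k.+1)%N = (j < k)%N.
      by rewrite ltnS leq_eqVlt; have -> : (j == k :> nat) = false by apply/negbTE.
    by rewrite mulr0 add0r.
  have near_s s : `|s| <= `|h * p 0 k0| -> enorm (s *: basis_vec k0 + (h *: q k + x) - x) < d.
    move=> hs; rewrite addrA addrK; apply: le_lt_trans (enormD _ _) _.
    rewrite !enormZ enorm_basis mulr1; apply: le_lt_trans hd2.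
    have : `|h| * `|p 0 k0| <= `|h| * enorm p by rewrite ler_wpM2l // coord_le_enorm.
    have : `|h| * enorm (q k) <= `|h| * enorm p by rewrite ler_wpM2l.
    rewrite normrM in hs; lra.
  have [|c cb cE] := @mean_value0 (fun s => f (s *: basis_vec k0 + (h *: q k + x)))
     (fun s => partial k0 f (s *: basis_vec k0 + (h *: q k + x))) (h * p 0 k0).
    move=> s hs; apply: is_derive_line_at; apply: derivableP; apply: fd.
    exact: (hd _ (near_s s hs)).1.
  rewrite scale0r add0r in cE.
  have cd := (hd _ (near_s c cb)).2 k0.
  rewrite !E qE -(addrA _ (h *: q k) x).
  set A := partial k0 f _ in cE cd; set B := partial k0 f x in cd *.
  set S := \sum_(j < N | _) p 0 j * _ in IH *; set S' := \sum_(j < N | _) `|_| in IH *.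
  have -> : f ((h * p 0 k0) *: basis_vec k0 + (h *: q k + x)) - f x - h * (p 0 k0 * B + S) =
     (f (h *: q k + x) - f x - h * S) + (A - B) * (h * p 0 k0) by lra.
  apply: le_trans (ler_normD _ _) _; rewrite !normrM.
  have : `|A - B| * (`|h| * `|p 0 k0|) <= e' * (`|h| * `|p 0 k0|).
    by rewrite ler_wpM2r ?mulr_ge0 // ltW.
  lra.
have := H N (leqnn _).
have -> : q N = p by apply/rowP => j; rewrite mxE ltn_ord.
have EN (F : 'I_N -> R) : \sum_(j < N | (j < N)%N) F j = \sum_(j < N) F j.
  by apply: eq_bigl => j; rewrite ltn_ord.
rewrite !EN -/(gr f x p) => HH.
have -> : h^-1 * (f (h *: p + x) - f x) - gr f x p =
    h^-1 * (f (h *: p + x) - f x - h * gr f x p).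
  by rewrite [RHS]mulrBr mulrA mulVf // mul1r.
rewrite normrM normfV ltr_pdivrMl ?normr_gt0 //.
apply: le_lt_trans HH _; rewrite ltr_pM2l ?normr_gt0 //.
rewrite /e' mulrAC ltr_pdivrMr // ltr_pM2l // /M; lra.
Qed.

(** First and second derivatives are carried as explicit functions of the direction, and the second
    derivative is taken twice in the same direction: tests along lines need no mixed derivatives,
    and sums, products and compositions get explicit formulas. *)
Definition C2on U f (G H : V -> V -> R) : Prop := forall x, U x -> forall p,
  is_derive x p f (G x p) /\ is_derive x p (fun y => G y p) (H x p).

Definition he f x p : R := \sum_(k < N) p 0 k * gr (partial k f) x p.

Lemma Ck_on_C2on U f : open U -> Ck_on 2 U f -> C2on U f (gr f) (he f).
Proof.
move=> oU fC x Ux p; split.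
  apply: (is_derive_gr p oU Ux) => [i y Uy|i].
    exact: (fC [::] isT).2.
  exact: (fC [:: i] isT).1.
apply: is_derive_sumf => k; apply: is_derive_scalef.
apply: (is_derive_gr p oU Ux) => [i y Uy|i].
  exact: (fC [:: k] isT).2.
exact: (fC [:: i; k] isT).1.
Qed.

Lemma gr_basis f x i : gr f x (basis_vec i) = partial i f x.
Proof.
rewrite /gr (bigD1 i) //= basis_vecE eqxx mul1r big1 ?addr0 // => j ji.
by rewrite basis_vecE (negbTE ji) mul0r.
Qed.

Lemma he_basis f x i : he f x (basis_vec i) = pderiv [:: i; i] f x.
Proof.
rewrite /he (bigD1 i) //= basis_vecE eqxx mul1r big1 ?addr0.
  by rewrite gr_basis.
by move=> j ji; rewrite basis_vecE (negbTE ji) mul0r.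
Qed.

Lemma gr_dot f x p : gr f x p = dot (gradient f x) p.
Proof. by apply: eq_bigr => k _; rewrite mxE mulrC. Qed.

Lemma C2onS U U' f G H : U' `<=` U -> C2on U f G H -> C2on U' f G H.
Proof. by move=> sU h x /sU; exact: h. Qed.

Lemma C2on_add U f g Gf Gg Hf Hg : C2on U f Gf Hf -> C2on U g Gg Hg ->
  C2on U (fun x => f x + g x) (fun x p => Gf x p + Gg x p) (fun x p => Hf x p + Hg x p).
Proof.
move=> fC gC x Ux p; have [f1 f2] := fC x Ux p; have [g1 g2] := gC x Ux p.
by split; exact: is_derive_addf.
Qed.

Lemma C2on_mul U f g Gf Gg Hf Hg : C2on U f Gf Hf -> C2on U g Gg Hg ->
  C2on U (fun x => f x * g x) (fun x p => Gf x p * g x + f x * Gg x p)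
    (fun x p => Hf x p * g x + 2 * Gf x p * Gg x p + f x * Hg x p).
Proof.
move=> fC gC x Ux p; have [f1 f2] := fC x Ux p; have [g1 g2] := gC x Ux p.
split; first exact: is_derive_mulf.
have h := is_derive_addf (is_derive_mulf f2 g1) (is_derive_mulf f1 g2).
by apply: (is_derive_eq h); ring.
Qed.

Lemma C2on_const U (c : R) : C2on U (fun=> c) (fun _ _ => 0) (fun _ _ => 0).
Proof. by move=> x _ p; split; exact: is_derive_const. Qed.

Lemma C2on_scale U (c : R) f G H : C2on U f G H ->
  C2on U (fun x => c * f x) (fun x p => c * G x p) (fun x p => c * H x p).
Proof.
by move=> fC x Ux p; have [f1 f2] := fC x Ux p; split; exact: is_derive_scalef.
Qed.

Lemma C2on_sub_scale U f G H (c : R) g Gg Hg : C2on U f G H -> C2on U g Gg Hg ->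
  C2on U (fun x => f x - c * g x) (fun x p => G x p - c * Gg x p) (fun x p => H x p - c * Hg x p).
Proof.
move=> fC gC x Ux p; have [f1 f2] := fC x Ux p; have [g1 g2] := gC x Ux p.
by split; apply: is_derive_subf => //; exact: is_derive_scalef.
Qed.

Lemma C2on_comp U f G H (phi phi1 phi2 : R -> R) : C2on U f G H ->
  (forall x, U x -> is_derive (f x) 1 phi (phi1 (f x)) /\
                    is_derive (f x) 1 phi1 (phi2 (f x))) ->
  C2on U (fun x => phi (f x)) (fun x p => phi1 (f x) * G x p)
    (fun x p => phi2 (f x) * G x p ^+ 2 + phi1 (f x) * H x p).
Proof.
move=> fC dphi x Ux p; have [f1 f2] := fC x Ux p; have [d1 d2] := dphi x Ux.
split; first exact: is_derive_comp_real.
have h := is_derive_mulf (is_derive_comp_real d2 f1) f2.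
by apply: (is_derive_eq h); ring.
Qed.

Lemma C2on_dot U y : C2on U (fun x => dot x y) (fun _ p => dot p y) (fun _ _ => 0).
Proof.
move=> x _ p; split; last exact: is_derive_const.
apply/is_derive_epsP => e e0; exists 1 => // h h0 _.
by rewrite !dotE addrK mulrA mulVf // mul1r subrr normr0.
Qed.

Lemma C2on_sqdist U y : C2on U (fun x => dot (x - y) (x - y))
  (fun x p => 2 * dot (x - y) p) (fun _ p => 2 * dot p p).
Proof.
move=> x _ p; split.
  apply/is_derive_epsP => e e0; exists (e / (dot p p + 1)) => [|h h0 hh].
    by rewrite divr_gt0 // ltr_wpDl // dot_ge0.
  rewrite !dotE (dotC y p) (dotC x p) (dotC y x).
  set E := (X in `|X| < _); have -> : E = h * dot p p.
    by rewrite /E; field.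
  rewrite normrM (ger0_norm (dot_ge0 p)).
  have := dot_ge0 p; rewrite ltr_pdivlMr in hh; last by rewrite ltr_wpDl // dot_ge0.
  by move: hh; have := normr_ge0 h; nra.
apply/is_derive_epsP => e e0; exists 1 => // h h0 _.
set E := (X in `|X| < _); suff -> : E = 0 by rewrite normr0.
by rewrite /E !dotE; field.
Qed.

Lemma C2on_line_at U f G H x p s : C2on U f G H -> U (s *: p + x) ->
  is_derive s (1 : R) (fun s => f (s *: p + x)) (G (s *: p + x) p) /\
  is_derive s (1 : R) (fun s => G (s *: p + x) p) (H (s *: p + x) p).
Proof.
move=> fC Us; have [d1 d2] := fC _ Us p.
by split; [exact: is_derive_line_at d1 | exact: (is_derive_line_at (f := fun y => G y p)) d2].
Qed.

End DirectionalDerivatives.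

(** * Compactness *)

Section Topology.
Context {R : realType} {N : nat}.
Notation V := 'rV[R]_N.
Implicit Types (A K U : set V) (x y z p : V) (f : V -> R).

Lemma closure_enormP A x :
  closure A x <-> forall e, 0 < e -> exists2 y, A y & enorm (y - x) < e.
Proof.
split=> [cA e e0|h B /nbhs_enormP[d d0 hB]].
  have /cA[y [Ay /= hy]] : nbhs x [set y | enorm (y - x) < e].
    by apply/nbhs_enormP; exists e.
  by exists y.
by have [y Ay hy] := h _ d0; exists y; split=> //; exact: hB.
Qed.

Lemma boundary_openP A x : open A -> boundary A x <-> closure A x /\ ~ A x.
Proof. by rewrite /boundary openE => oA; split=> -[cx nx]; split=> // h; apply: nx; [exact: oA|exact: interior_subset]. Qed.

Lemma closure_open_cases A x : open A -> closure A x -> A x \/ boundary A x.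
Proof.
by move=> oA cx; have [Ax|nAx] := pselect (A x); [left|right; apply/boundary_openP].
Qed.

Lemma bounded_enormP A : bounded_set A <-> exists M, forall x, A x -> enorm x <= M.
Proof.
split=> [[M [_ hM]]|[M hM]].
  exists (N%:R * (M + 1)) => x Ax; apply: le_trans (enorm_le_norm _) _.
  by apply: ler_wpM2l => //; apply: hM => //; rewrite ltrDl.
exists M; split; first exact: num_real.
by move=> M' MM' x Ax; apply: le_trans (norm_le_enorm _) (le_trans (hM _ Ax) (ltW MM')).
Qed.

Lemma bounded_compact A : bounded_set A -> closed A -> compact A.
Proof. exact: bounded_closed_compact. Qed.

Lemma bounded_closure_compact A : bounded_set A -> compact (closure A).
Proof.
move=> /bounded_enormP[M hM]; apply: bounded_compact; last exact: closed_closure.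
apply/bounded_enormP; exists (M + 1) => x /closure_enormP /(_ 1 ltr01)[y Ay yx].
by have := enormD (x - y) y; rewrite subrK enormB; have := hM _ Ay; lra.
Qed.

Lemma compact_boundary A : bounded_set A -> compact (boundary A).
Proof.
move=> bA; apply: (subclosed_compact _ (bounded_closure_compact bA)); last by move=> x [].
by apply: closedI; [exact: closed_closure|apply: open_closedC; exact: open_interior].
Qed.

Lemma compact_closed_ball x (r : R) : compact [set y | enorm (y - x) <= r].
Proof.
apply: bounded_compact.
  apply/bounded_enormP; exists (r + enorm x) => y /= yr.
  by have := enormD (y - x) x; rewrite subrK; lra.
rewrite -[X in closed X]setCK; apply: open_closedC; apply/open_enormP => y /= /negP.
rewrite -ltNge => ry; exists (enorm (y - x) - r) => [|z zy]; first by rewrite subr_gt0.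
apply/negP; rewrite -ltNge; have := enorm_sub_le y z x.
by rewrite (enormB y z); lra.
Qed.

Lemma compact_fun_bounded K f : compact K -> (forall x, K x -> {for x, continuous f}) ->
  exists2 M, 0 < M & forall x, K x -> `|f x| <= M.
Proof.
move=> cK cf.
have /compact_bounded[M [_ hM]] : compact (f @` K).
  by apply: continuous_compact => //; apply/continuous_in_subspaceT => x; rewrite inE; exact: cf.
exists (Num.max M 0 + 1) => [|x Kx]; first by rewrite ltr_wpDl // le_max lexx orbT.
apply: (hM (Num.max M 0 + 1)); last by exists x.
by rewrite ltr_pwDr // le_max lexx.
Qed.

Lemma finite_uniform_bound (I : finType) K (f : I -> V -> R) :
  (forall i, exists2 M, 0 < M & forall x, K x -> `|f i x| <= M) ->
  exists2 M, 0 < M & forall i x, K x -> `|f i x| <= M.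
Proof.
move=> h; have /choice[M hM] : forall i, exists m, 0 < m /\ forall x, K x -> `|f i x| <= m.
  by move=> i; have [m m0 hm] := h i; exists m.
exists (\sum_i M i + 1) => [|i x Kx].
  by rewrite ltr_wpDl // sumr_ge0 // => i _; rewrite ltW //; case: (hM i).
apply: le_trans ((hM i).2 x Kx) _; rewrite (bigD1 i) //= -addrA lerDl addr_ge0 //.
by apply: sumr_ge0 => j _; rewrite ltW //; case: (hM j).
Qed.

Lemma gr_bound f x p (M : R) : (forall k, `|partial k f x| <= M) ->
  `|gr f x p| <= N%:R * M * enorm p.
Proof.
move=> h; apply: le_trans (ler_norm_sum _ _ _) _.
apply: (@le_trans _ _ (\sum_(k < N) M * enorm p)); last first.
  by rewrite sumr_const card_ord -[X in X <= _]mulr_natl mulrA.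
by apply: ler_sum => k _; rewrite normrM mulrC ler_pM // coord_le_enorm.
Qed.

Lemma he_bound f x p (M : R) : (forall j k, `|partial j (partial k f) x| <= M) ->
  `|he f x p| <= N%:R ^+ 2 * M * dot p p.
Proof.
move=> h; apply: le_trans (ler_norm_sum _ _ _) _.
apply: (@le_trans _ _ (\sum_(k < N) enorm p * (N%:R * M * enorm p))); last first.
  rewrite sumr_const card_ord -[X in X <= _]mulr_natl -enorm_sqr.
  by rewrite le_eqVlt; apply/orP; left; apply/eqP; ring.
by apply: ler_sum => k _; rewrite normrM ler_pM // ?coord_le_enorm // gr_bound.
Qed.

Lemma Ck_on_compact_bound U K f : open U -> compact K -> K `<=` U -> Ck_on 2 U f ->
  exists2 M, 0 < M & forall x, K x -> [/\ `|f x| <= M,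
    forall p, `|gr f x p| <= M * enorm p & forall p, `|he f x p| <= M * dot p p].
Proof.
move=> oU cK KU fC.
have [M0 M00 h0] := compact_fun_bounded cK (fun x Kx => (fC [::] isT).1 x (KU _ Kx)).
have [M1 M10 h1] := @finite_uniform_bound _ K (fun i => partial i f)
  (fun i => compact_fun_bounded cK (fun x Kx => (fC [:: i] isT).1 x (KU _ Kx))).
have [M2 M20 h2] := @finite_uniform_bound _ K (fun ij : 'I_N * 'I_N => partial ij.1 (partial ij.2 f))
  (fun ij => compact_fun_bounded cK (fun x Kx => (fC [:: ij.1; ij.2] isT).1 x (KU _ Kx))).
have n0 : 0 <= N%:R :> R by [].
exists (M0 + N%:R * M1 + N%:R ^+ 2 * M2).
  by have := mulr_ge0 n0 (ltW M10); have := mulr_ge0 (sqr_ge0 (N%:R : R)) (ltW M20); lra.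
move=> x Kx; split=> [|p|p].
- apply: le_trans (h0 x Kx) _.
  by have := mulr_ge0 n0 (ltW M10); have := mulr_ge0 (sqr_ge0 (N%:R : R)) (ltW M20); lra.
- apply: le_trans (gr_bound p (fun k => h1 k x Kx)) _; apply: ler_wpM2r => //.
  by have := mulr_ge0 (sqr_ge0 (N%:R : R)) (ltW M20); lra.
- apply: le_trans (he_bound p (fun j k => h2 (j, k) x Kx)) _.
  apply: ler_wpM2r; first exact: dot_ge0.
  by have := mulr_ge0 n0 (ltW M10); lra.
Qed.

End Topology.

(** * Defining functions of a smooth domain *)

Section DefiningFunction.
Context {R : realType} {N : nat}.
Notation V := 'rV[R]_N.
Implicit Types (Omega U : set V) (x y z p nu : V) (psi phi : V -> R) (n : V -> V).

(** Both sign conditions are stable under addition, which an equivalence between [Omega z] and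
    [psi z < 0] would not be for functions that vanish away from their chart. Nondegeneracy of the
    gradient field [n] is left out because it holds only after summation. *)
Record predefining Omega psi n (H : V -> V -> R) (B : R) : Prop := {
  pd_C2 : C2on setT psi (fun x p => dot (n x) p) H;
  pd_hess : forall x p, `|H x p| <= B * dot p p;
  pd_neg : forall z, psi z < 0 -> Omega z;
  pd_le0 : forall z, Omega z -> psi z <= 0 }.

(** The direction [p] itself points outward; it is [- p] that enters the domain. *)
Definition inward Omega z p := exists2 e, 0 < e & forall h, 0 < h < e -> Omega (z - h *: p).

Lemma C2on_continuous psi (G H : V -> V -> R) (B : R) : C2on setT psi G H ->
  (forall x p, `|G x p| <= B * enorm p) -> forall x, {for x, continuous psi}.
Proof.
move=> C hB x; apply/continuous_enormP => e e0.
have B0 : 0 <= `|B| by [].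
exists (e / (`|B| + 1)) => [|y hy]; first by rewrite divr_gt0 // ltr_wpDl.
have [|c _] := @mean_value0 R (fun s => psi (s *: (y - x) + x))
  (fun s => G (s *: (y - x) + x) (y - x)) 1.
  by move=> s _; exact: (C2on_line_at C _).1.
rewrite scale0r add0r scale1r subrK mulr1 => ->.
apply: le_lt_trans (hB _ _) _; rewrite ltr_pdivlMr in hy; last by rewrite ltr_wpDl.
apply: le_lt_trans hy; rewrite mulrC; apply: ler_wpM2l => //.
by have := ler_norm B; lra.
Qed.

Lemma chart_zero Omega U z phi : open Omega -> boundary Omega z ->
  local_defining_function Omega z U phi -> phi z = 0.
Proof.
move=> oO /(boundary_openP _ oO)[cz nz] [oU Uz sphi _ hO].
apply/eqP; rewrite eq_le; apply/andP; split; last by rewrite leNgt; apply/negP => /(hO z Uz).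
rewrite leNgt; apply/negP => pz.
have cphi : {for z, continuous phi} := (sphi 2 [::] isT).1 z Uz.
have [d d0 hd] := (continuous_enormP phi z).1 cphi _ pz.
have [d' d'0 hd'] := (open_enormP U).1 oU z Uz.
have [|y Oy] := (closure_enormP Omega z).1 cz (Num.min d d'); first by rewrite lt_min d0.
rewrite lt_min => /andP[/hd h /hd' Uy].
have := (hO y Uy).1 Oy; have := ler_norm (phi z - phi y); rewrite distrC in h; lra.
Qed.

Lemma chart_inward Omega U z phi p : open Omega -> boundary Omega z ->
  local_defining_function Omega z U phi -> 0 < dot (gradient phi z) p ->
  inward Omega z p.
Proof.
move=> oO bz ch gp; have pz := chart_zero oO bz ch.
case: ch => oU Uz sphi _ hO.
have dphi := (Ck_on_C2on oU (sphi 2) Uz p).1.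
rewrite gr_dot in dphi; move/is_derive_line: dphi => dphi.
have [r r0 hr] := is_derive_sign_near dphi gp.
have [d' d'0 hd'] := (open_enormP U).1 oU z Uz.
have g1 : 0 < enorm p + 1 by rewrite ltr_wpDl.
exists (Num.min r (d' / (enorm p + 1))); first by rewrite lt_min r0 divr_gt0.
move=> h /andP[h0]; rewrite lt_min => /andP[hr1 hr2].
have Uh : U (z - h *: p).
  apply: hd'; rewrite addrAC subrr add0r enormN enormZ gtr0_norm //.
  rewrite ltr_pdivlMr // in hr2; apply: le_lt_trans hr2.
  by apply: ler_wpM2l; [exact: ltW | rewrite lerDl].
apply/(hO _ Uh).
have := hr (- h); rewrite subr0 normrN gtr0_norm // => /(_ hr1).
rewrite oppr_eq0 gt_eqF // => /(_ isT).
rewrite scale0r add0r pz subr0 nmulr_lgt0 ?invr_lt0 ?oppr_lt0 //.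
by rewrite scaleNr addrC.
Qed.

(** The cut-off is nonnegative, so it respects the sign of [phi]; at boundary points [phi] vanishes
    and the gradient of the product is the cut-off times that of [phi]. The vector [p] is exported
    with [inward] because positivity of [dot (n z) p] along such a vector survives the summation of
    charts. *)
Lemma chart_predefining Omega U x0 phi : open Omega -> boundary Omega x0 ->
  local_defining_function Omega x0 U phi ->
  exists rho psi n H B, [/\ 0 < rho, 0 <= B, predefining Omega psi n H B &
    forall z, boundary Omega z -> enorm (z - x0) < rho ->
      exists2 p, inward Omega z p & 0 < dot (n z) p].
Proof.
move=> oO bx0 [oU Ux0 sphi g0 hO].
have [i0 hi0] : exists i, partial i phi x0 != 0.
  apply: contrapT => h; move/negP: g0; apply; apply/eqP/rowP => i; rewrite !mxE.
  by apply: contrapT => /eqP hi; apply: h; exists i.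
have [d1 d10 hd1] := (open_enormP U).1 oU x0 Ux0.
have ci : {for x0, continuous (partial i0 phi)} by exact: (sphi 2 [:: i0] isT).1.
have [d2 d20 hd2] : exists2 d, 0 < d & forall y, enorm (y - x0) < d -> partial i0 phi y != 0.
  move/continuous_enormP: ci => /(_ `|partial i0 phi x0|); rewrite normr_gt0 => /(_ hi0)[d d0 hd].
  exists d => // y /hd; apply: contraTneq => ->; rewrite sub0r normrN ltxx //.
pose rho := Num.min d1 d2 / 2.
have m0 : 0 < Num.min d1 d2 by rewrite lt_min d10 d20.
have [m1 m2] : Num.min d1 d2 <= d1 /\ Num.min d1 d2 <= d2 by rewrite !ge_min !lexx orbT.
have rho0 : 0 < rho by rewrite /rho; lra.
have [rd1 rd2] : rho < d1 /\ rho < d2 by rewrite /rho; lra.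
pose K := [set z | enorm (z - x0) <= rho].
have KU : K `<=` U by move=> z /= Kz; apply: hd1; exact: le_lt_trans rd1.
have phiC : Ck_on 2 U phi := sphi 2.
have [M M0 hM] := Ck_on_compact_bound oU (@compact_closed_ball _ _ x0 rho) KU phiC.
pose k := rho ^- 2.
have k0 : 0 < k by rewrite invr_gt0 exprn_gt0.
pose q z := 1 + (- k) * dot (z - x0) (z - x0).
have qC : C2on setT q (fun z p => 0 + (- k) * (2 * dot (z - x0) p))
    (fun z p => 0 + (- k) * (2 * dot p p)).
  by apply: C2on_add; [exact: C2on_const | apply: C2on_scale; exact: C2on_sqdist].
pose b s : R := Num.max 0 s ^+ 3; pose b1 s : R := 3 * Num.max 0 s ^+ 2.
pose b2 s : R := 3 * (2 * Num.max 0 s ^+ 1).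
have bC : C2on setT (fun z => b (q z)) _ _ := C2on_comp (phi1 := b1) (phi2 := b2) qC
  (fun z _ => conj (is_derive_posX 1 (q z)) (is_derive_scalef 3 (is_derive_posX 0 (q z)))).
have {}bC := C2onS (@subsetT _ U) bC.
pose psi z := b (q z) * phi z.
have pC := C2on_mul bC (Ck_on_C2on oU phiC).
pose n z := b (q z) *: gradient phi z + (b1 (q z) * (- k) * 2 * phi z) *: (z - x0).
pose Gb z p := b1 (q z) * (0 + (- k) * (2 * dot (z - x0) p)).
pose Hb z p := b2 (q z) * (0 + (- k) * (2 * dot (z - x0) p)) ^+ 2
  + b1 (q z) * (0 + (- k) * (2 * dot p p)).
pose GG z p := Gb z p * phi z + b (q z) * gr phi z p.
pose HH z p := Hb z p * phi z + 2 * Gb z p * gr phi z p + b (q z) * he phi z p.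
have {}pC : C2on U psi GG HH := pC.
have GGE z p : GG z p = dot (n z) p.
  by rewrite /GG /Gb /n !dotE gr_dot add0r /=; ring.
have out z : ~ K z -> [/\ b (q z) = 0, b1 (q z) = 0 & b2 (q z) = 0].
  move=> /negP; rewrite -ltNge => rz.
  have qz : q z <= 0.
    rewrite /q mulNr subr_le0 -enorm_sqr /k mulrC ler_pdivlMr ?exprn_gt0 // mul1r.
    by rewrite ler_pXn2r ?nnegrE // ltW.
  by rewrite /b /b1 /b2 max_l // expr0n expr1 expr0n /= !mulr0.
have outnear z : ~ K z -> \forall y \near z, ~ K y.
  move=> /negP; rewrite -ltNge => rz; apply/nbhs_enormP.
  exists (enorm (z - x0) - rho) => [|y hy]; first by rewrite subr_gt0.
  apply/negP; rewrite -ltNge; have := enorm_sub_le z y x0.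
  by rewrite (enormB z y); lra.
have psi0 z : ~ K z -> psi z = 0 by move=> /out[h _ _]; rewrite /psi h mul0r.
have n0 z : ~ K z -> n z = 0 by move=> /out[h1 h2 _]; rewrite /n h1 h2 !mul0r !scale0r addr0.
have H0 z p : ~ K z -> HH z p = 0.
  by move=> /out[h1 h2 h3]; rewrite /HH /Gb /Hb h1 h2 h3; ring.
have b01 z : 0 <= Num.max 0 (q z) <= 1.
  rewrite le_max lexx /= ge_max ler01 /= /q mulNr gerBl mulr_ge0 ?dot_ge0 // ltW //.
(* Product rule: [b], [b1], [b2] are bounded by 1, 3, 6 on the ball, the gradient of [q] by
   [2 / rho], its Hessian by [2 * k], and [phi] with its derivatives by [M]. *)
exists rho, psi, n, HH, (M + 3 * (2 / rho) * M * 2 + (6 * (2 / rho) ^+ 2 + 6 * k) * M).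
split; first exact: rho0.
- have := mulr_ge0 (ltW k0) (ltW M0); have := sqr_ge0 (2 / rho).
  have : 0 < 2 / rho by rewrite divr_gt0.
  by move: M0 k0; nra.
- split.
  + move=> z _ p; have [Kz|nKz] := pselect (K z).
      have [d dd] := pC z (KU z Kz) p; rewrite GGE in d; split; first exact: d.
      have e : (fun y => GG y p) = (fun y => dot (n y) p) by apply/funext => y; exact: GGE.
      by rewrite e in dd.
    rewrite (n0 z nKz) dot0l (H0 z p nKz); split.
      apply: (near_eq_is_derive (f := fun=> 0)).
      by apply: filterS (outnear z nKz) => y /psi0.
    apply: (near_eq_is_derive (f := fun=> 0)).
    by apply: filterS (outnear z nKz) => y /n0 ->; rewrite dot0l.
  + move=> z p; have [Kz|nKz] := pselect (K z); last first.
      rewrite H0 // normr0 mulr_ge0 ?dot_ge0 //.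
      have := mulr_ge0 (ltW k0) (ltW M0); have := sqr_ge0 (2 / rho).
      have : 0 < 2 / rho by rewrite divr_gt0.
      by move: M0 k0; nra.
    have [h1 h2 h3] := hM z Kz.
    have /andP[c0 c1] := b01 z.
    have a0 := enorm_ge0 p; set a := enorm p in a0 *.
    pose L := 2 / rho; have L0 : 0 < L by rewrite divr_gt0.
    have aq : `|0 + (- k) * (2 * dot (z - x0) p)| <= L * a.
      rewrite add0r normrM normrN (ger0_norm (ltW k0)) normrM ger0_norm //.
      apply: (@le_trans _ _ (k * (2 * (rho * a)))).
        apply: ler_wpM2l; first exact: ltW.
        apply: ler_wpM2l => //; apply: le_trans (cauchy_schwarz _ _) _.
        by apply: ler_wpM2r.
      by rewrite le_eqVlt; apply/orP; left; apply/eqP; rewrite /k /L; field; exact: lt0r_neq0.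
    have ab : `|b (q z)| <= 1 by rewrite /b ger0_norm ?exprn_ge0 // exprn_ile1.
    have ab1 : `|b1 (q z)| <= 3.
      rewrite /b1 ger0_norm ?mulr_ge0 ?exprn_ge0 // -[leRHS]mulr1 ler_wpM2l //.
      exact: exprn_ile1.
    have ab2 : `|b2 (q z)| <= 6.
      rewrite /b2 expr1 ger0_norm ?mulr_ge0 //; lra.
    have aG : `|Gb z p| <= 3 * (L * a) by rewrite /Gb normrM ler_pM.
    have aH : `|Hb z p| <= 6 * (L * a) ^+ 2 + 3 * (k * (2 * a ^+ 2)).
      rewrite /Hb; apply: le_trans (ler_normD _ _) _; apply: lerD.
        rewrite normrM; apply: ler_pM => //; rewrite normrX.
        by rewrite lerXn2r // nnegrE // mulr_ge0 // ltW.
      rewrite normrM; apply: ler_pM => //.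
      rewrite add0r normrM normrN (ger0_norm (ltW k0)) normrM -enorm_sqr.
      by rewrite !ger0_norm ?sqr_ge0.
    rewrite /HH -enorm_sqr -/a; apply: le_trans (ler_normD _ _) _.
    rewrite [leRHS](_ : _ = (6 * (L * a) ^+ 2 + 3 * (k * (2 * a ^+ 2))) * M +
       2 * (3 * (L * a)) * (M * a) + 1 * (M * a ^+ 2)); last by rewrite /L; ring.
    apply: lerD; last first.
      by rewrite normrM; apply: ler_pM => //; rewrite /a enorm_sqr.
    apply: le_trans (ler_normD _ _) _; apply: lerD.
      by rewrite normrM; apply: ler_pM.
    by rewrite normrM; apply: ler_pM => //; rewrite normrM (ger0_norm (ler0n R 2)); exact: ler_wpM2l.
  + move=> z; have [Kz|/psi0 -> //] := pselect (K z); last by rewrite ltxx.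
    move=> h; apply/(hO z (KU z Kz)); move: h; rewrite /psi.
    have h0 : 0 <= b (q z) by rewrite /b exprn_ge0 //; case/andP: (b01 z).
    by apply: contraTT; rewrite -!leNgt => hp; rewrite mulr_ge0.
  + move=> z; have [Kz|/psi0 -> //] := pselect (K z).
    move=> /(hO z (KU z Kz)) hp; rewrite /psi; apply: mulr_ge0_le0; last exact: ltW.
    by rewrite /b exprn_ge0 //; case/andP: (b01 z).
- move=> z bz zr; have Kz : K z by exact: ltW.
  have Uz := KU z Kz.
  have gz : 0 < dot (gradient phi z) (gradient phi z).
    rewrite lt_def dot_ge0 andbT dot_eq0.
    have : partial i0 phi z != 0 by apply: hd2; exact: lt_trans rd2.
    by apply: contraNneq => /rowP/(_ i0); rewrite !mxE => ->.
  have chz : local_defining_function Omega z U phi.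
    by split=> //; rewrite -dot_eq0 gt_eqF.
  have pz := chart_zero oO bz chz.
  exists (gradient phi z).
  + exact: chart_inward oO bz chz gz.
  + rewrite /n pz mulr0 scale0r addr0 dotZl mulr_gt0 // /b exprn_gt0 //.
    rewrite lt_max /q mulNr subr_gt0 -enorm_sqr /k mulrC ltr_pdivrMr ?exprn_gt0 // mul1r.
    by rewrite ltr_pXn2r ?nnegrE ?zr ?orbT // ltW.
Qed.
End DefiningFunction.

Section GlobalDefiningFunction.
Context {R : realType} {N : nat}.
Notation V := 'rV[R]_N.
Implicit Types (Omega U : set V) (x y z p nu : V) (psi phi : V -> R) (n : V -> V).

Lemma mean_value01 (k k' : R -> R) :
  (forall s : R, 0 <= s <= 1 -> is_derive s 1 k (k' s)) ->
  exists2 c, 0 < c < 1 & k 1 - k 0 = k' c.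
Proof. by move=> d; have [c hc e] := mean_value ltr01 d; exists c => //; rewrite e subr0 mulr1. Qed.

Lemma C2on_segment_mvt U phi (G H : V -> V -> R) x y : C2on U phi G H ->
  (forall s, 0 <= s <= 1 -> U (s *: (y - x) + x)) ->
  exists2 c, 0 < c < 1 & phi y - phi x = G (c *: (y - x) + x) (y - x).
Proof.
move=> C hU; have [|c hc] := @mean_value01 (fun s => phi (s *: (y - x) + x))
    (fun s => G (s *: (y - x) + x) (y - x)).
  by move=> s /hU h; exact: (C2on_line_at C h).1.
by rewrite scale1r subrK scale0r add0r => h; exists c.
Qed.

Lemma C2on_taylor U phi (G H : V -> V -> R) x y M : C2on U phi G H ->
  (forall s, 0 <= s <= 1 -> U (s *: (y - x) + x) /\ `|H (s *: (y - x) + x) (y - x)| <= M) ->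
  `|phi y - phi x - G x (y - x)| <= M.
Proof.
move=> C hU; have [c /andP[c0 c1] ->] := C2on_segment_mvt C (fun s hs => (hU s hs).1).
have [|c' /andP[c'0 c'c]] := @mean_value _ (fun s => G (s *: (y - x) + x) (y - x))
    (fun s => H (s *: (y - x) + x) (y - x)) 0 c c0.
  move=> s /andP[s0 sc]; have h : 0 <= s <= 1 by rewrite s0 (le_trans sc (ltW c1)).
  exact: (C2on_line_at C (hU s h).1).2.
rewrite scale0r add0r subr0 => ->; rewrite normrM (gtr0_norm c0).
have h : 0 <= c' <= 1 by rewrite !ltW // (lt_trans c'c).
by apply: le_trans (hU _ h).2; rewrite ler_piMr // ltW.
Qed.

Lemma predefining_taylor Omega psi n H B x y : predefining Omega psi n H B ->
  `|psi y - psi x - dot (n x) (y - x)| <= B * dot (y - x) (y - x).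
Proof.
move=> pd; apply: (C2on_taylor (pd_C2 pd)) => s _; split=> //; exact: (pd_hess pd).
Qed.

Lemma predefining_continuous Omega psi n H B x : 0 <= B -> predefining Omega psi n H B ->
  {for x, continuous psi}.
Proof.
move=> B0 pd; apply/continuous_enormP => e e0.
pose C := enorm (n x) + B + 1.
have C0 : 0 < C by rewrite /C ltr_wpDl // addr_ge0.
exists (Num.min 1 (e / C)) => [|y]; first by rewrite lt_min ltr01 divr_gt0.
rewrite lt_min ltr_pdivlMr // => /andP[h1 h2].
have := predefining_taylor x y pd; rewrite -enorm_sqr => h.
have c := cauchy_schwarz (n x) (y - x).
have t : `|psi y - psi x| <= `|psi y - psi x - dot (n x) (y - x)| + `|dot (n x) (y - x)|.
  by have := ler_normD (psi y - psi x - dot (n x) (y - x)) (dot (n x) (y - x)); rewrite subrK.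
apply: le_lt_trans t _; apply: le_lt_trans h2.
have a0 := enorm_ge0 (y - x); set a := enorm (y - x) in h1 h c a0 *.
have : B * a ^+ 2 <= B * a.
  by apply: ler_wpM2l => //; rewrite expr2 ler_piMr // ltW.
rewrite /C; lra.
Qed.

Lemma predefining_closure Omega psi n H B z : 0 <= B -> predefining Omega psi n H B ->
  closure Omega z -> psi z <= 0.
Proof.
move=> B0 pd /closure_enormP cz; rewrite leNgt; apply/negP => pz.
have [d d0 hd] := (continuous_enormP psi z).1 (predefining_continuous B0 pd) _ pz.
have [y /(pd_le0 pd) h /hd] := cz d d0; rewrite distrC.
by have := ler_norm (psi z - psi y); lra.
Qed.

Lemma predefining_boundary Omega psi n H B z : open Omega -> 0 <= B ->
  predefining Omega psi n H B -> boundary Omega z -> psi z = 0.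
Proof.
move=> oO B0 pd /(boundary_openP _ oO)[cz nz].
apply/eqP; rewrite eq_le (predefining_closure B0 pd cz) /= leNgt.
by apply/negP => /(pd_neg pd).
Qed.

Lemma predefining_inward Omega psi n H B z p : open Omega -> 0 <= B ->
  predefining Omega psi n H B -> boundary Omega z -> inward Omega z p -> 0 <= dot (n z) p.
Proof.
move=> oO B0 pd bz [e e0 he].
have /is_derive_line d := (pd_C2 pd (I : setT z) p).1.
apply: (is_derive_left_max d); exists e => // s /andP[s1 s2].
rewrite scale0r add0r (predefining_boundary oO B0 pd bz).
have := he (- s); rewrite scaleNr opprK addrC => h; apply: (pd_le0 pd); apply: h; lra.
Qed.

Lemma predefining_add Omega psi1 n1 H1 B1 psi2 n2 H2 B2 :
  predefining Omega psi1 n1 H1 B1 -> predefining Omega psi2 n2 H2 B2 ->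
  predefining Omega (fun z => psi1 z + psi2 z) (fun z => n1 z + n2 z)
    (fun z p => H1 z p + H2 z p) (B1 + B2).
Proof.
move=> pd1 pd2; split.
- move=> z zT p; have [d1 d2] := C2on_add (pd_C2 pd1) (pd_C2 pd2) zT p.
  by split; [rewrite dotDl | under eq_fun do rewrite dotDl].
- move=> x p; apply: le_trans (ler_normD _ _) _; rewrite mulrDl.
  by apply: lerD; [exact: (pd_hess pd1)|exact: (pd_hess pd2)].
- move=> z h; have [h1|h1] := ltP (psi1 z) 0; first exact: (pd_neg pd1).
  by apply: (pd_neg pd2); lra.
- by move=> z Oz; have := pd_le0 pd1 Oz; have := pd_le0 pd2 Oz; lra.
Qed.

Lemma predefining0 Omega : predefining Omega (fun=> 0) (fun=> 0) (fun _ _ => 0) 0.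
Proof.
split=> [||z|z] //.
- move=> z zT p; have [d1 d2] := C2on_const (0 : R) zT p.
  by split; [rewrite dot0l | under eq_fun do rewrite dot0l].
- by move=> x p; rewrite normr0 mul0r.
- by rewrite ltxx.
Qed.

(** [psi] may vanish at points of [Omega] far from the boundary. Nondegeneracy is asked on the
    boundary only and is carried to nearby points by the Lipschitz bound on [n]. *)
Record defining Omega psi n (H : V -> V -> R) (B c : R) : Prop := {
  df_pre : predefining Omega psi n H B;
  df_B : 1 <= B;
  df_c : 0 < c;
  df_nondeg : forall z, boundary Omega z -> c <= enorm (n z) }.

(** Only second derivatives in a repeated direction are bounded, so the gradients are compared
    through values of [psi]: three Taylor expansions eliminate all values and leave
    [dot (n x - n y) w]. *)
Lemma predefining_gradient_lipschitz Omega psi n H B x y : 0 <= B ->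
  predefining Omega psi n H B -> enorm (n x - n y) <= 6 * B * enorm (x - y).
Proof.
move=> B0 pd; set r := enorm (x - y).
have [/eqP|d0] := eqVneq (enorm (n x - n y)) 0.
  by rewrite enorm_eq0 => /eqP ->; rewrite enorm0 !mulr_ge0 // /r.
have d1 : 0 < enorm (n x - n y) by rewrite lt_def d0 enorm_ge0.
set d := enorm (n x - n y) in d0 d1 *.
have [/eqP|r0] := eqVneq r 0.
  rewrite enorm_eq0 subr_eq0 => /eqP xy; move: d1; rewrite /d xy subrr enorm0 ltxx //.
have r1 : 0 < r by rewrite lt_def r0 /r enorm_ge0.
(* A displacement of length [r] along [n x - n y], for which [dot (n x - n y) w = r * d]. The three
   remainders are [B r^2], [4 B r^2] and [B r^2], whence the factor 6. *)
pose w := (r / d) *: (n x - n y); pose z := x + w.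
have wE : enorm w = r by rewrite /w enormZ gtr0_norm ?divr_gt0 // -/d divfK.
have h1 := predefining_taylor x z pd.
have h2 := predefining_taylor y z pd.
have h3 := predefining_taylor y x pd.
rewrite /z (addrC x w) addrK -enorm_sqr wE in h1.
rewrite -/r -enorm_sqr -/r in h3.
have zy : enorm (z - y) <= 2 * r.
  rewrite /z addrAC; apply: le_trans (enormD _ _) _; rewrite wE -/r; lra.
have h2' : B * dot (z - y) (z - y) <= B * (4 * r ^+ 2).
  apply: ler_wpM2l => //; rewrite -enorm_sqr (_ : 4 * r ^+ 2 = (2 * r) ^+ 2); last by ring.
  by rewrite lerXn2r // nnegrE // mulr_ge0 // ltW.
have e : dot (n x - n y) w = r * d.
  by rewrite /w dotZr -enorm_sqr -/d; field.
have e2 : dot (n y) (z - y) = dot (n y) (x - y) + dot (n y) w.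
  rewrite -dotDr /z; congr dot; rewrite addrAC //.
rewrite dotDl dotNl in e; rewrite e2 in h2; have {}h2 := le_trans h2 h2'.
rewrite /z (addrC x w) in h2.
set A := psi (w + x) in h1 h2.
move: h1 h2 h3; rewrite !ler_norml => /andP[a1 a2] /andP[b1 b2] /andP[c1 c2].
have : r * d <= 6 * B * r ^+ 2 by lra.
by rewrite (_ : 6 * B * r ^+ 2 = r * (6 * B * r)); [rewrite ler_pM2l | ring].
Qed.

(* Finitely many local defining functions, multiplied by the cut-offs
   max(0, 1 - |z - x0|^2 / rho^2)^3, are added up. *)
Lemma defining_function_exists Omega : smooth_bounded_domain Omega ->
  exists psi n H B c, defining Omega psi n H B c.
Proof.
move=> [oO _ _ bO hch].
pose P x0 (d : R * (V -> R) * (V -> V) * (V -> V -> R) * R) :=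
  let: (rho, psi, n, H, B) := d in [/\ 0 < rho, 0 <= B, predefining Omega psi n H B &
    forall z, boundary Omega z -> enorm (z - x0) < rho ->
      exists2 p, inward Omega z p & 0 < dot (n z) p].
have /choice[D hD] : forall x0, exists d, boundary Omega x0 -> P x0 d.
  move=> x0; have [bx|] := pselect (boundary Omega x0); last first.
    by move=> nb; exists (0, fun=> 0, fun=> 0, fun _ _ => 0, 0).
  have [U [phi hphi]] := hch x0 bx.
  have [rho [psi [n [H [B h]]]]] := chart_predefining oO bx hphi.
  by exists (rho, psi, n, H, B).
pose rho x0 := (D x0).1.1.1.1.
have S (s : seq V) : (forall x0, x0 \in s -> boundary Omega x0) ->
    exists psi n H B, [/\ 0 <= B, predefining Omega psi n H B &
    forall z, boundary Omega z -> (exists2 x0, x0 \in s & enorm (z - x0) < rho x0) ->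
      exists2 p, inward Omega z p & 0 < dot (n z) p].
  elim: s => [_|x0 s IH hs].
    exists (fun=> 0), (fun=> 0), (fun _ _ => 0), 0; split=> //; first exact: predefining0.
    by move=> z _ [].
  have [|psi1 [n1 [H1 [B1 [B10 pd1 h1]]]]] := IH.
    by move=> x xs; apply: hs; rewrite inE xs orbT.
  have bx0 : boundary Omega x0 by apply: hs; rewrite inE eqxx.
  have := hD x0 bx0; have : rho x0 = (D x0).1.1.1.1 by [].
  case: (D x0) => [[[[r2 psi2] n2] H2] B2] /= rE [r20 B20 pd2 h2].
  exists (fun z => psi2 z + psi1 z), (fun z => n2 z + n1 z),
    (fun z p => H2 z p + H1 z p), (B2 + B1); split.
  - by rewrite addr_ge0.
  - exact: predefining_add.
  move=> z bz [x]; rewrite inE => /orP[/eqP ->|xs] hz.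
    (* Gradients of different charts cannot cancel: a direction that is [inward] has a nonnegative
       product with the gradient of every predefining function, and a positive one with that of the
       chart containing [z]. *)
    rewrite rE in hz; have [p ip np] := h2 z bz hz; exists p => //.
    by rewrite dotDl ltr_pwDl // (predefining_inward oO B10 pd1).
  have [|p ip np] := h1 z bz; first by exists x.
  by exists p => //; rewrite dotDl ltr_wpDl // (predefining_inward oO B20 pd2).
have cb := compact_boundary bO.
have : cover_compact (boundary Omega) by rewrite -compact_cover.
move=> /(_ V (boundary Omega) (fun x0 => [set z | enorm (z - x0) < rho x0]%R)).
case.
- move=> x0 bx0; apply/open_enormP => z /= hz.
  exists (rho x0 - enorm (z - x0)) => [|y hy]; first by rewrite subr_gt0.
  by have := enorm_sub_le y z x0; lra.
- move=> z bz; exists z => //=; rewrite subrr enorm0.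
  by have := hD z bz; rewrite /rho; case: (D z) => [[[[? ?] ?] ?] ?] /= [].
move=> D' D'b D'c.
have [|psi [n [H [B [B0 pd hn]]]]] := S (finmap.enum_fset D').
  by move=> x0 /D'b; rewrite inE.
have {}hn z : boundary Omega z -> 0 < enorm (n z).
  move=> bz; rewrite enorm_gt0; have [x0 /= xD xz] := D'c z bz.
  have [|p _] := hn z bz; first by exists x0.
  by apply: contraTneq => ->; rewrite dot0l ltxx.
have [c c0 hc] : exists2 c, 0 < c & forall z, boundary Omega z -> c <= enorm (n z).
  have [[z0 bz0]|nb] := pselect (boundary Omega !=set0); last first.
    by exists 1 => // z bz; exfalso; apply: nb; exists z.
  have [] := @compact_EVT_min _ R (fun z => enorm (n z)) (boundary Omega) _ cb.
  - by exists z0.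
  - apply/continuous_in_subspaceT => z _; apply/continuous_enormP => e e0.
    exists (e / (6 * B + 1)) => [|y hy]; first by rewrite divr_gt0 // ltr_wpDl ?mulr_ge0.
    rewrite ltr_pdivlMr in hy; last by rewrite ltr_wpDl ?mulr_ge0.
    have h := predefining_gradient_lipschitz y z B0 pd.
    have a1 := enormD (n y - n z) (n z); have a2 := enormD (n z - n y) (n y).
    rewrite !subrK (enormB (n z)) in a1 a2.
    have : `|enorm (n y) - enorm (n z)| <= enorm (n y - n z).
      by rewrite ler_norml; apply/andP; split; lra.
    have := enorm_ge0 (y - z); lra.
  - move=> z; rewrite inE => bz hz; exists (enorm (n z)); first exact: hn.
    by move=> y by_; apply: hz; rewrite inE.
exists psi, n, H, (B + 1), c; split=> //; last by rewrite lerDr.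
case: pd => h1 h2 h3 h4; split=> // x p; apply: le_trans (h2 x p) _.
by apply: ler_wpM2r; [exact: dot_ge0|rewrite lerDl].
Qed.

End GlobalDefiningFunction.

(** * Exterior normals, the boundary weight and quasiconvexity of the domain *)

Section NormalDirection.
Context {R : realType} {N : nat}.
Notation V := 'rV[R]_N.
Variables (Omega : set V) (psi : V -> R) (n : V -> V) (H : V -> V -> R) (B c : R).
Hypothesis oO : open Omega.
Hypothesis df : defining Omega psi n H B c.
Implicit Types (x y z p nu : V).

Let pd := df_pre df.
Let B1 := df_B df.
Let c0 := df_c df.
Let B0 : 0 <= B. Proof. exact: le_trans ler01 B1. Qed.

Lemma addrDK x p : x + p - x = p.
Proof. by rewrite addrAC subrr add0r. Qed.

(** Every [p] with positive product with the chart normal [v] is [inward], so [n x] has nonnegative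
    product with a whole open half-space and must be a multiple of [v]. In particular the exterior
    normal does not depend on the chart. *)
Lemma exterior_normalP x nu : boundary Omega x -> exterior_normal Omega x nu ->
  [/\ n x = enorm (n x) *: nu, enorm nu = 1 & inward Omega x nu].
Proof.
move=> bx [U [phi [ch ->]]]; have g0 : gradient phi x != 0 by case: ch.
set g := gradient phi x in g0 *.
have eg : 0 < enorm g by rewrite enorm_gt0.
set v := (enorm g)^-1 *: g.
have ev : enorm v = 1 by rewrite enormZ ger0_norm ?invr_ge0 // mulVf // gt_eqF.
have vv : dot v v = 1 by rewrite -enorm_sqr ev expr1n.
have gv : g = enorm g *: v by rewrite scalerA divff ?gt_eqF // scale1r.
have xv : 0 < dot v v -> inward Omega x v.
  by move=> h; apply: (chart_inward oO bx ch); rewrite -/g gv dotZl mulr_gt0.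
have inw p : 0 < dot v p -> 0 <= dot (n x) p.
  move=> vp; apply: (predefining_inward oO B0 pd bx).
  by apply: (chart_inward oO bx ch); rewrite -/g gv dotZl mulr_gt0.
clearbody v.
have nv : 0 <= dot (n x) v by apply: inw; rewrite vv.
have nn : dot (n x) (n x) <= dot (n x) v ^+ 2.
  rewrite leNgt; apply/negP => h.
  set a := dot (n x) v in nv h *; set b := dot (n x) (n x) in h *.
  (* If [n x] were not parallel to [v], the vector [d *: v - (n x - a *: v)] would lie in the
     half-space, while its product with [n x] is [d * a - (b - a ^+ 2)]; this [d] is small enough to
     make it negative. *)
  pose d := (b - a ^+ 2) / (2 * (a + 1)).
  have a1 : 0 < a + 1 by arith.
  have d0 : 0 < d by rewrite divr_gt0 ?subr_gt0 // mulr_gt0.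
  have := inw (d *: v - (n x - a *: v)).
  rewrite !dotE vv (dotC v (n x)) -/a -/b => hh.
  have /hh : 0 < d * 1 - (a - a * 1) by arith.
  have e : d * (a + 1) * 2 = b - a ^+ 2 by rewrite /d; field; arith.
  by rewrite expr2 in e h *; nra.
have na : dot (n x) v = enorm (n x).
  apply/eqP; rewrite eq_le; apply/andP; split.
    by have := dot_le (n x) v; rewrite ev mulr1.
  by rewrite -(@ler_pXn2r _ 2) ?nnegrE // enorm_sqr.
split=> //; last by apply: xv; rewrite vv.
apply/eqP; rewrite -subr_eq0 -dot_eq0 !dotE (dotC v) na vv -enorm_sqr.
by apply/eqP; ring.
Qed.

(** The uniform exterior ball condition in analytic form: expand [psi] at [x], where it vanishes,
    use [psi y <= 0], and divide by the length of [n x], which is at least [c]. *)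
Lemma exterior_quadratic x nu y : boundary Omega x -> exterior_normal Omega x nu ->
  closure Omega y -> dot nu (y - x) <= B / c * dot (y - x) (y - x).
Proof.
move=> bx ex cy; have [nE _ _] := exterior_normalP bx ex.
have nc := df_nondeg df bx.
have := predefining_taylor x y pd; rewrite (predefining_boundary oO B0 pd bx).
have := predefining_closure B0 pd cy.
rewrite ler_norml subr0 nE dotZl; set e := enorm (n x) in nc *.
set a := dot nu _; set q := dot _ _ => h1 /andP[h2 h3].
have q0 : 0 <= q by exact: dot_ge0.
rewrite mulrAC ler_pdivlMr //.
have := c0; have := mulr_ge0 B0 q0; have [a0|a0] := leP 0 a; nra.
Qed.

Lemma psi_decay x nu h : boundary Omega x -> exterior_normal Omega x nu ->
  0 < h <= c / (2 * B) -> psi (x - h *: nu) <= - (c / 2 * h).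
Proof.
move=> bx ex /andP[h0 h1]; have [nE nu1 _] := exterior_normalP bx ex.
have nc := df_nondeg df bx.
have := predefining_taylor x (x - h *: nu) pd; rewrite (predefining_boundary oO B0 pd bx).
have -> : x - h *: nu - x = - (h *: nu) by rewrite addrDK.
rewrite nE -enorm_sqr enormN enormZ nu1 mulr1 (gtr0_norm h0).
rewrite !dotE -enorm_sqr nu1 expr1n mulr1 subr0 ler_norml => /andP[_].
set e := enorm (n x) in nc *.
have B2 : 0 < 2 * B by have := B1; arith.
rewrite ler_pdivlMr // in h1; rewrite expr2; have := B1.
by nra.
Qed.

Lemma gradient_bounded : bounded_set Omega ->
  exists2 M, 1 <= M & forall x, closure Omega x -> enorm (n x) <= M.
Proof.
move=> /bounded_closure_compact /compact_bounded/bounded_enormP[M hM].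
have M0 : 0 <= `|M| by []. have nn0 := enorm_ge0 (n 0).
exists (enorm (n 0) + 6 * B * `|M| + 1) => [|x /hM xM].
  by have := mulr_ge0 B0 M0; arith.
have h := predefining_gradient_lipschitz x 0 B0 pd; rewrite subr0 in h.
have t := enormD (n x - n 0) (n 0); rewrite subrK in t.
have : B * enorm x <= B * `|M|.
  by apply: ler_wpM2l => //; exact: le_trans (ler_norm M).
by arith.
Qed.

(** The weight is 1 + exp(a psi). Since [psi <= 0] on the closure it stays between 1 and 2 whatever
    [a] is, while its outward slope at the boundary grows with [a]: any slope can be had at bounded
    cost. *)
Lemma boundary_weight (A : R) : bounded_set Omega -> 0 < A -> exists g G K M,
  [/\ C2on setT g G K, 0 < M,
      (forall x, {for x, continuous g}),
      (forall x, closure Omega x -> [/\ 1 <= g x <= 2,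
        forall p, `|G x p| <= M * enorm p & forall p, `|K x p| <= M * dot p p]) &
      (forall x nu, boundary Omega x -> exterior_normal Omega x nu ->
        exists2 e, 0 < e & forall h, 0 < h < e -> g (x - h *: nu) <= g x - A * h)].
Proof.
move=> bO A0; have [M M1 hM] := gradient_bounded bO.
(* The slope is at least [a * c]; one factor 2 is lost in [psi_decay] and another in exp(-s) <= 1 -
   s / 2 for small [s]. *)
pose a := 4 * A / c; have a0 : 0 < a by rewrite divr_gt0 // mulr_gt0.
have ac : a * c = 4 * A by rewrite /a divfK // lt0r_neq0.
clearbody a.
have := C2on_add (C2on_const (1 : R)) (C2on_comp (phi := expR) (phi1 := expR) (phi2 := expR)
  (C2on_scale a (pd_C2 pd)) (fun x _ => conj (is_derive_expR _) (is_derive_expR _))).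
move=> C; exists (fun x => 1 + expR (a * psi x)),
  (fun x p => 0 + expR (a * psi x) * (a * dot (n x) p)),
  (fun x p => 0 + (expR (a * psi x) * (a * dot (n x) p) ^+ 2 + expR (a * psi x) * (a * H x p))),
  (a * M + (a * M) ^+ 2 + a * B); split=> //.
- have := mulr_ge0 (ltW a0) B0; have : 0 < a * M by rewrite mulr_gt0 // (lt_le_trans ltr01).
  have := sqr_ge0 (a * M); arith.
- move=> x.
  have h1 : psi z @[z --> x] --> psi x := predefining_continuous B0 pd.
  have h2 : {for x, continuous (fun z => a * psi z)} := cvgM (cvg_cst _) h1.
  have h3 : {for x, continuous (fun z => expR (a * psi z))}.
    apply: (@continuous_comp _ _ _ (fun z => a * psi z) expR); [exact: h2|exact: continuous_expR].
  exact: (cvgD (cvg_cst _) h3).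
- move=> x cx; have px := predefining_closure B0 pd cx.
  have e1 : expR (a * psi x) <= 1.
    by rewrite -expR0 ler_expR mulr_ge0_le0 // ltW.
  have e0 := expR_gt0 (a * psi x).
  have aM : 0 <= a * M by rewrite mulr_ge0 ?ltW // (lt_le_trans ltr01).
  have aB := mulr_ge0 (ltW a0) B0.
  have gp p : `|a * dot (n x) p| <= a * M * enorm p.
    rewrite normrM (gtr0_norm a0) -mulrA ler_wpM2l ?(ltW a0) //.
    apply: le_trans (cauchy_schwarz _ _) _; apply: ler_wpM2r => //; exact: hM.
  split=> [|p|p]; first by arith.
  + rewrite add0r normrM (gtr0_norm e0); apply: (@le_trans _ _ (1 * (a * M * enorm p))).
      by apply: ler_pM => //; exact: ltW.
    by rewrite mul1r; apply: ler_wpM2r => //; have := sqr_ge0 (a * M); arith.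
  + rewrite add0r -mulrDr normrM (gtr0_norm e0).
    apply: (@le_trans _ _ (1 * ((a * M * enorm p) ^+ 2 + a * B * dot p p))).
      apply: ler_pM => //.
      apply: le_trans (ler_normD _ _) _; apply: lerD.
        by rewrite normrX lerXn2r ?nnegrE // mulr_ge0.
      rewrite normrM (gtr0_norm a0) -mulrA ler_wpM2l ?(ltW a0) //; exact: (pd_hess pd).
    rewrite mul1r exprMn enorm_sqr -mulrDl; apply: ler_wpM2r; first exact: dot_ge0.
    arith.
- move=> x nu bx ex.
  exists (Num.min (c / (2 * B)) (2 / (a * c))) => [|h].
    have Bp : 0 < B by exact: lt_le_trans B1.
    by rewrite lt_min; apply/andP; split; apply: divr_gt0 => //; apply: mulr_gt0.
  rewrite lt_min => /andP[h0 /andP[h1 h2]].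
  have hp : psi (x - h *: nu) <= - (c / 2 * h).
    by apply: psi_decay => //; rewrite h0 ltW.
  rewrite (predefining_boundary oO B0 pd bx) mulr0 expR0.
  set s := a * (c / 2 * h).
  have s0 : 0 < s by apply: mulr_gt0 => //; apply: mulr_gt0 => //; exact: divr_gt0.
  have s1 : s < 1.
    by move: h2; rewrite ltr_pdivlMr ?mulr_gt0 // /s => h2; arith.
  have -> : A * h = s / 2 by rewrite (_ : A = a * c / 4); [rewrite /s; field | rewrite ac; field].
  have : expR (a * psi (x - h *: nu)) <= expR (- s).
    by rewrite ler_expR /s -mulrN ler_wpM2l // ltW.
  have : expR (- s) <= 1 - s / 2; last by arith.
  have := expR_ge1Dx s; have := expRN s; have := expR_gt0 s.
  move=> E0 -> E1; rewrite -[X in X <= _]mul1r ler_pdivrMr //.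
  by nra.
Qed.

Lemma segment_exit x y : Omega x -> ~ Omega y ->
  exists2 s, 0 < s <= 1 & boundary Omega (s *: (y - x) + x).
Proof.
move=> Ox nOy; pose S := [set s : R | 0 <= s <= 1 /\ ~ Omega (s *: (y - x) + x)].
have cl : continuous (fun s : R => s *: (y - x) + x).
  move=> s; apply: cvgD; last exact: cvg_cst.
  by apply: cvgZ; [exact: cvg_id|exact: cvg_cst].
have cS : compact S.
  apply: (subclosed_compact _ (@segment_compact R 0 1)); last first.
    by move=> s [h _]; rewrite /= in_itv.
  rewrite (_ : S = `[0, 1]%classic `&` ~` ((fun s : R => s *: (y - x) + x) @^-1` Omega)).
    apply: closedI; first exact: interval_closed.
    by apply: open_closedC; apply: open_comp => // s _; exact: cl.
  by apply/seteqP; split=> s /=; rewrite in_itv.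
have [||s] := @compact_EVT_min _ R id S _ cS.
- by exists 1; split; rewrite ?ler01 ?lexx // scale1r subrK.
- by apply: continuous_subspaceT => t; exact: cvg_id.
rewrite inE => -[/andP[s0 s1] ns] hs; exists s.
  rewrite s1 andbT lt_def s0 andbT; apply/eqP => se; apply: ns.
  by rewrite se scale0r add0r.
apply/boundary_openP => //; split=> //; apply/closure_enormP => e e0.
have sp : 0 < s.
  by rewrite lt_def s0 andbT; apply/eqP => se; apply: ns; rewrite se scale0r add0r.
pose t := Num.max 0 (s - e / (enorm (y - x) + 1) / 2).
have E0 : 0 < enorm (y - x) + 1 by rewrite ltr_wpDl.
have ee : 0 < e / (enorm (y - x) + 1) by rewrite divr_gt0.
have ts : t < s by rewrite /t gt_max sp /=; arith.
have t0 : 0 <= t by rewrite /t le_max lexx.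
exists (t *: (y - x) + x).
  apply: contrapT => nt; have : t \in S by rewrite inE; split=> //; rewrite t0 (le_trans (ltW ts)).
  by move=> /hs /=; arith.
rewrite opprD addrACA subrr addr0 -scalerBl enormZ distrC gtr0_norm ?subr_gt0 //.
have : s - t <= e / (enorm (y - x) + 1) / 2.
  by have : s - e / (enorm (y - x) + 1) / 2 <= t; [rewrite /t le_max lexx orbT|arith].
move=> h; apply: (@le_lt_trans _ _ (e / (enorm (y - x) + 1) / 2 * enorm (y - x))).
  exact: ler_wpM2r.
rewrite mulrAC ltr_pdivrMr // mulrAC ltr_pdivrMr //; have := enorm_ge0 (y - x); nra.
Qed.

(* Points of Omega that are close can be joined inside Omega: push both in the
   direction - n x by twice their distance. *)
Lemma quasiconvex_lipschitz (f : V -> R) (G : V -> V -> R) L x y :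
  (forall z, Omega z -> forall p, is_derive z p f (G z p)) ->
  Omega x -> Omega y -> enorm (y - x) <= c / (24 * B) -> 0 <= L ->
  (forall z, Omega z -> enorm (z - x) <= 3 * enorm (y - x) ->
     forall p, `|G z p| <= L * enorm p) ->
  `|f y - f x| <= 5 * L * enorm (y - x).
Proof.
move=> df_ Ox Oy hd L0 hG; set d := enorm (y - x) in hd hG *.
have d0 : 0 <= d by exact: enorm_ge0.
have seg a b : (forall s, 0 <= s <= 1 -> Omega (s *: (b - a) + a) /\
     enorm (s *: (b - a) + a - x) <= 3 * d) -> `|f b - f a| <= L * enorm (b - a).
  move=> hs; have [|c' /andP[c'0 c'1]] := @mean_value01 R (fun s => f (s *: (b - a) + a))
      (fun s => G (s *: (b - a) + a) (b - a)).
    by move=> s /hs[h _]; apply: is_derive_line_at; exact: df_.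
  rewrite scale1r subrK scale0r add0r => ->.
  by have [|h1 h2] := hs c' _; [rewrite !ltW | exact: hG].
have B24 : 0 < 24 * B by have := B1; arith.
have hd' : 24 * B * d <= c by rewrite mulrC -ler_pdivlMr.
have [allin|] := pselect (forall s, 0 <= s <= 1 -> Omega (s *: (y - x) + x)).
  apply: (@le_trans _ _ (L * d)).
    apply: seg => s hs; split; first exact: allin.
    rewrite addrK enormZ -/d; case/andP: hs => s0 s1; rewrite ger0_norm //; nra.
  by have := mulr_ge0 L0 d0; arith.
(* The segment leaves [Omega], so [x] is within [d] of a boundary point and [n x] cannot degenerate.
   The bound [24 * B * d <= c] then makes all quadratic errors smaller than the first-order decrease
   of [psi] along the push. *)
move=> /existsNP[s /not_implyP[/andP[s0 s1] ns]].
have [t /andP[t0 t1]] := segment_exit Ox ns.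
rewrite addrK; set z := _ + x => bz.
have zx : enorm (z - x) <= d.
  rewrite /z addrK !enormZ -/d (gtr0_norm t0) ger0_norm // mulrA.
  by rewrite ler_piMl // mulr_ile1 // ltW.
have nz := df_nondeg df bz.
have lip := predefining_gradient_lipschitz z x B0 pd.
have tr := enormD (n z - n x) (n x); rewrite subrK in tr.
have BE : B * enorm (z - x) <= B * d by exact: ler_wpM2l.
have nx : c / 2 <= enorm (n x) by have := c0; arith.
have nx0 : 0 < enorm (n x) by have := c0; arith.
pose e := (enorm (n x))^-1 *: n x.
have e1 : enorm e = 1 by rewrite enormZ ger0_norm ?invr_ge0 // mulVf // gt_eqF.
have ne : dot (n x) e = enorm (n x).
  by rewrite dotZr -enorm_sqr expr2 mulrA mulVf ?mul1r // gt_eqF.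
clearbody e; have d1 : 0 < d.
  rewrite lt_def d0 andbT /d enorm_eq0 subr_eq0; apply/eqP => yx; apply: ns.
  by rewrite yx subrr scaler0 add0r.
have Bd := mulr_gt0 (lt_le_trans ltr01 B1) d1.
have P1 r : 0 <= r <= 2 * d -> Omega (x - r *: e).
  move=> /andP[r0 r2]; have [->|rn0] := eqVneq r 0; first by rewrite scale0r subr0.
  have r1 : 0 < r by rewrite lt_def rn0.
  apply: (pd_neg pd).
  have := predefining_taylor x (x - r *: e) pd.
  rewrite addrDK -enorm_sqr enormN enormZ e1 mulr1 (gtr0_norm r1) dotNr dotZr ne.
  rewrite ler_norml => /andP[_]; have := pd_le0 pd Ox; rewrite expr2.
  have := mulr_ge0 B0 r0; have : B * r <= 2 * (B * d) by have := ler_wpM2l B0 r2; arith.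
  nra.
have P2 r : 0 <= r <= 2 * d -> Omega (y - r *: e).
  move=> /andP[r0 r2]; have [->|rn0] := eqVneq r 0; first by rewrite scale0r subr0.
  have r1 : 0 < r by rewrite lt_def rn0.
  apply: (pd_neg pd).
  have := predefining_taylor y (y - r *: e) pd.
  rewrite addrDK -enorm_sqr enormN enormZ e1 mulr1 (gtr0_norm r1) dotNr dotZr.
  rewrite ler_norml => /andP[_]; have := pd_le0 pd Oy; rewrite expr2.
  have := mulr_ge0 B0 r0; have : B * r <= 2 * (B * d) by have := ler_wpM2l B0 r2; arith.
  have : enorm (n x) - 6 * (B * d) <= dot (n y) e.
    have := predefining_gradient_lipschitz x y B0 pd; rewrite (enormB x y) -/d.
    have := dot_le (n x - n y) e; rewrite dotDl dotNl e1 mulr1 ne; arith.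
  nra.
have P3 r : 0 <= r <= 1 -> Omega (r *: (y - x) + (x - (2 * d) *: e)).
  move=> /andP[r0 r1]; apply: (pd_neg pd).
  set w := r *: (y - x) + _.
  have wx : w - x = r *: (y - x) - (2 * d) *: e.
    by rewrite /w addrA addrAC addrK.
  have := predefining_taylor x w pd; rewrite wx -enorm_sqr dotDr dotNr !dotZr ne.
  have : enorm (r *: (y - x) - (2 * d) *: e) <= 3 * d.
    apply: le_trans (enormD _ _) _; rewrite enormN !enormZ e1 -/d (ger0_norm r0).
    rewrite ger0_norm; last by arith.
    by have := ler_wpM2r d0 r1; arith.
  set q := enorm (_ - _) => q3 hh.
  have q0 : 0 <= q by exact: enorm_ge0.
  have : B * q ^+ 2 <= 9 * d * (B * d).
    rewrite (_ : 9 * d * (B * d) = B * (3 * d) ^+ 2); last by ring.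
    by apply: ler_wpM2l => //; rewrite lerXn2r // nnegrE //; arith.
  move: hh; rewrite ler_norml => /andP[_]; have := pd_le0 pd Ox.
  have : r * dot (n x) (y - x) <= enorm (n x) * d.
    apply: (@le_trans _ _ (r * (enorm (n x) * d))); first by rewrite ler_wpM2l // dot_le.
    by rewrite ler_piMl // mulr_ge0.
  have : d * (c / 2) <= d * enorm (n x) by rewrite ler_wpM2l.
  have : 24 * B * d * d <= c * d by rewrite ler_wpM2r.
  have := mulr_gt0 c0 d1; arith.
(* The detour has pieces of length [2 * d], [d] and [2 * d], whence the factor 5; all its points
   stay within [3 * d] of [x]. *)
have s1' : `|f (x - (2 * d) *: e) - f x| <= L * (2 * d).
  apply: le_trans (seg _ _ _) _; last by rewrite addrDK enormN enormZ e1 mulr1 ger0_norm //; arith.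
  move=> r /andP[r0 r1]; rewrite addrDK scalerN scalerA (addrC _ x); split.
    by apply: P1; nra.
  by rewrite addrDK enormN enormZ e1 mulr1 ger0_norm; nra.
have s2' : `|f (y - (2 * d) *: e) - f y| <= L * (2 * d).
  apply: le_trans (seg _ _ _) _; last by rewrite addrDK enormN enormZ e1 mulr1 ger0_norm //; arith.
  move=> r /andP[r0 r1]; rewrite [y - _]addrC addrK scalerN scalerA (addrC _ y); split.
    by apply: P2; nra.
  rewrite addrAC; apply: le_trans (enormD _ _) _; rewrite -/d enormN enormZ e1 mulr1 ger0_norm; nra.
have s3' : `|f (y - (2 * d) *: e) - f (x - (2 * d) *: e)| <= L * d.
  have yx : (y - (2 * d) *: e) - (x - (2 * d) *: e) = y - x by rewrite opprB addrA subrK.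
  apply: le_trans (seg _ _ _) _; rewrite yx // => r hr; split; first exact: P3.
  rewrite addrA addrAC addrK; apply: le_trans (enormD _ _) _.
  case/andP: hr => r0 r1; rewrite enormN !enormZ e1 -/d (ger0_norm r0) ger0_norm; nra.
move: s1' s2' s3'; rewrite !ler_norml; arith.
Qed.

End NormalDirection.

(** * First touching *)

Section WithinContinuity.
Context {R : realType}.

(** The pointwise form of [{within A, continuous f}], to which the limit rules for sums, products
    and compositions apply directly. *)
Definition wcont (T : topologicalType) (A : set T) (f : T -> R) : Prop :=
  forall p, A p -> f q @[q --> within A (nbhs p)] --> f p.

Lemma wcontP (T : topologicalType) (A : set T) (f : T -> R) :
  {within A, continuous f} <-> wcont A f.
Proof. exact: subspace_continuousP. Qed.

Lemma wcont_add (T : topologicalType) (A : set T) (f g : T -> R) :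
  wcont A f -> wcont A g -> wcont A (fun x => f x + g x).
Proof. by move=> cf cg p Ap; exact: (cvgD (cf p Ap) (cg p Ap)). Qed.

Lemma wcont_opp (T : topologicalType) (A : set T) (f : T -> R) :
  wcont A f -> wcont A (fun x => - f x).
Proof. by move=> cf p Ap; exact: (cvgN (cf p Ap)). Qed.

Lemma wcont_sub (T : topologicalType) (A : set T) (f g : T -> R) :
  wcont A f -> wcont A g -> wcont A (fun x => f x - g x).
Proof. by move=> cf cg; apply: wcont_add => //; exact: wcont_opp. Qed.

Lemma wcont_mul (T : topologicalType) (A : set T) (f g : T -> R) :
  wcont A f -> wcont A g -> wcont A (fun x => f x * g x).
Proof. by move=> cf cg p Ap; exact: (cvgM (cf p Ap) (cg p Ap)). Qed.

Lemma wcont_cst (T : topologicalType) (A : set T) (c : R) : wcont A (fun=> c).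
Proof. by move=> p Ap; exact: cvg_cst. Qed.

Lemma wcont_sum (I : finType) (T : topologicalType) (A : set T) (f : I -> T -> R) :
  (forall i, wcont A (f i)) -> wcont A (fun x => \sum_i f i x).
Proof.
move=> h; elim: (index_enum I) => [|i s IH].
  by under eq_fun do rewrite big_nil; exact: wcont_cst.
by under eq_fun do rewrite big_cons; exact: wcont_add.
Qed.

Lemma wcont_real (T : topologicalType) (A : set T) (f : T -> R) (phi : R -> R) :
  wcont A f -> (forall p, A p -> {for f p, continuous phi}) ->
  wcont A (fun x => phi (f x)).
Proof. by move=> cf cphi p Ap; exact: (cvg_comp _ _ (cf p Ap) (cphi p Ap)). Qed.

Lemma wcont_for (T : topologicalType) (A : set T) (f : T -> R) :
  (forall p, A p -> {for p, continuous f}) -> wcont A f.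
Proof. by move=> cf p Ap; apply: cvg_within_filter; exact: cf. Qed.

Lemma wcont_precomp (S T : topologicalType) (A : set T) (B : set S) (g : S -> T) (f : T -> R) :
  wcont A f -> continuous g -> (forall p, B p -> A (g p)) -> wcont B (fun x => f (g x)).
Proof.
move=> cf cg gB p Bp U /(cf _ (gB p Bp)) h.
have h' : nbhs (g p) [set y | A y -> U (f y)] := h.
have := cg p _ h'; rewrite /nbhs /= /within /= => hh.
by apply: filterS hh => q /= hq Bq; apply: hq; exact: gB.
Qed.

Lemma wcont_subset (T : topologicalType) (A B : set T) (f : T -> R) :
  B `<=` A -> wcont A f -> wcont B f.
Proof. by move=> BA cf; apply: (wcont_precomp cf (g := id)) => // p; exact: cvg_id. Qed.

Lemma continuous_pairing (S T U : topologicalType) (f : S -> T) (g : S -> U) :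
  continuous f -> continuous g -> continuous (fun s => (f s, g s)).
Proof.
move=> cf cg s A [[P Q] [/= /cf hP /cg hQ] hPQ].
have h : nbhs s [set q | P (f q) /\ Q (g q)] by apply: filterI; [exact: hP|exact: hQ].
by apply: (filterS _ h) => q [h1 h2]; exact: hPQ.
Qed.

Lemma compact_superlevel (T : topologicalType) (A : set T) (f : T -> R) :
  compact A -> wcont A f -> compact (A `&` [set x | 0 <= f x]).
Proof.
move=> cA /wcontP /continuous_closedP cf.
have /closed_subspaceP[V cV VA] := cf _ (@closed_ge R 0).
rewrite (_ : A `&` _ = A `&` V); first exact: compact_closedI.
by rewrite (setIC A V) VA setIC.
Qed.

(** The points with [F >= 0] form a compact subset of space-time, so a least time exists among them.
    The space [T] is abstract because the lemma is applied to closures of domains, to pairs of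
    points and to a single point. *)
Lemma first_touch (T : topologicalType) (K : set T) (t1 : R) (F : T -> R -> R) :
  compact K -> wcont (K `*` [set t | 0 <= t <= t1]) (fun p => F p.1 p.2) ->
  (forall x, K x -> F x 0 < 0) ->
  (forall x t, K x -> 0 < t <= t1 -> F x t = 0 ->
     (forall y, K y -> F y t <= 0) -> (forall y s, K y -> 0 <= s < t -> F y s < 0) -> False) ->
  forall x t, K x -> 0 <= t <= t1 -> F x t < 0.
Proof.
move=> cK cF F0 touch x t Kx tt; rewrite ltNge; apply/negP => Fxt.
pose A := K `*` [set t | 0 <= t <= t1].
have cA : compact A.
  apply: compact_setX => //; rewrite (_ : [set t | _] = `[0, t1]%classic); first exact: segment_compact.
  by apply/seteqP; split=> s /=; rewrite in_itv.
have cS := compact_superlevel cA cF.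
have [||[x0 t0]] := @compact_EVT_min _ R (fun p => p.2) _ _ cS.
- by exists (x, t); split.
- by apply: continuous_subspaceT => p; exact: cvg_snd.
rewrite inE => -[/= [/= Kx0 /andP[t00 t01]] Ft0] hmin.
have before y s : K y -> 0 <= s < t0 -> F y s < 0.
  move=> Ky /andP[s0 st]; rewrite ltNge; apply/negP => Fys.
  have /hmin /= : (y, s) \in A `&` [set p | 0 <= F p.1 p.2].
    by rewrite inE; split=> //; split=> //=; rewrite s0 (le_trans (ltW st)).
  lra.
have t0p : 0 < t0.
  rewrite lt_def t00 andbT; apply/eqP => e; have := F0 _ Kx0; rewrite -e; lra.
(* A positive value at time [t0] would persist at slightly earlier times, where all values are
   negative. *)
have Ft y : K y -> F y t0 <= 0.
  move=> Ky; rewrite leNgt; apply/negP => Fy.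
  have /= := cF (y, t0) _ [set r | 0 < r] _; case.
  - by split=> //=; rewrite t00.
  - by apply/nbhs_realP; exists (F y t0) => // r /=; rewrite ltr_norml; lra.
  move=> [P Q] /= [nP /nbhs_realP[d d0 hQ]] h.
  pose s := Num.max 0 (t0 - d / 2).
  have st : s < t0 by rewrite /s gt_max t0p /=; lra.
  have s0 : 0 <= s by rewrite /s le_max lexx.
  have sd : t0 - d / 2 <= s by rewrite /s le_max lexx orbT.
  have /= hh : 0 < F y s.
    apply: (h (y, s)); split=> //=; first exact: nbhs_singleton.
      by apply: hQ; rewrite ler0_norm; lra.
    by rewrite s0 (le_trans (ltW st)).
  by have := before y s Ky; rewrite s0 st => /(_ isT); lra.
apply: (touch x0 t0) => //; first by rewrite t0p.
by apply/eqP; rewrite eq_le Ft.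
Qed.

End WithinContinuity.

(** * Lipschitz bound for the signal by doubling of variables *)

Section Auxiliary.
Context {R : realType} {N : nat}.
Notation V := 'rV[R]_N.
Implicit Types (x y z p nu : V).

(* Stated through a differentiable extension z, so that the rules for two-sided
   derivatives apply. *)
Definition left_derive (y : R -> R) (t l : R) : Prop :=
  exists2 z : R -> R, is_derive t 1 z l & forall r, 0 < r <= t -> z r = y r.

Lemma is_time_derivative_left (T : R) (y : R -> R) t l : 0 < t <= T -> is_time_derivative T y t l ->
  left_derive y t l.
Proof.
move=> /andP[t0 tT] hl.
exists (fun r => if r <= t then y r else y t + l * (r - t)); last first.
  by move=> r /andP[_ ->].
apply/is_derive_epsP => e e0.
have := hl _ (nbhsx_ballx l e e0).
rewrite /nbhs /= /within /dnbhs /= => /nbhs_ballP[d /= d0 hd].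
exists (Num.min d t) => [|h h0]; first by rewrite lt_min d0.
rewrite lexx lt_min [_%:A]mulr1 => /andP[h1 h2].
have [ht|ht] := leP (h + t) t; last first.
  have -> : h^-1 * (y t + l * (h + t - t) - y t) - l = 0 by field.
  by rewrite normr0.
have := hd (h + t); rewrite /ball /= opprD addrCA subrr addr0 normrN => /(_ h1).
rewrite distrC addrK mulrC; apply.
  by rewrite -subr_eq0 addrK.
rewrite ltr_norml in h2; rewrite (le_trans ht tT) andbT; lra.
Qed.

Lemma normal_derivative_eps Omega (f : V -> R) x nu e :
  zero_normal_derivative Omega f -> boundary Omega x -> exterior_normal Omega x nu ->
  0 < e -> exists2 d, 0 < d & forall h, 0 < h < d -> `|f x - f (x - h *: nu)| <= e * h.
Proof.
move=> zf bx ex e0; have := zf x nu bx ex _ (nbhsx_ballx 0 e e0).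
rewrite /nbhs /= /at_right /within /= => /nbhs_ballP[d /= d0 hd].
exists d => // h /andP[h0 hd']; have := hd h; rewrite /ball /= !sub0r !normrN gtr0_norm //.
move=> /(_ hd' h0); rewrite normrM normfV (gtr0_norm h0) mulrC ltr_pdivrMr // => hh.
exact: ltW.
Qed.

(** The trace of a quadratic form is the same in every orthonormal frame; the hypothesis is the
    completeness relation of the frame. *)
Lemma laplacian_rotation (f : V -> R) x (Q : 'I_N -> V) :
  (forall j k, \sum_i Q i 0 k * Q i 0 j = (j == k)%:R) ->
  \sum_i he f x (Q i) = laplacian f x.
Proof.
move=> hQ; rewrite /laplacian.
transitivity (\sum_(k < N) \sum_(j < N)
    (\sum_i Q i 0 k * Q i 0 j) * partial j (partial k f) x).
  rewrite exchange_big /=; under [RHS]eq_bigr do under eq_bigr do rewrite mulr_suml.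
  under [RHS]eq_bigr do rewrite exchange_big /=.
  apply: eq_bigr => k _; apply: eq_bigr => i _; rewrite /gr mulr_sumr.
  by apply: eq_bigr => j _; rewrite mulrA.
apply: eq_bigr => k _; rewrite (bigD1 k) //= hQ eqxx mul1r big1 ?addr0 // => j jk.
by rewrite hQ (negbTE jk) mul0r.
Qed.

(** For a unit vector [nu], the reflection in the hyperplane orthogonal to [nu]. *)
Definition reflect_along nu p : V := p - (2 * dot p nu) *: nu.

Lemma reflect_basis_orthonormal nu : enorm nu = 1 -> forall j k,
  \sum_i reflect_along nu (basis_vec i) 0 k * reflect_along nu (basis_vec i) 0 j = (j == k)%:R.
Proof.
move=> n1 j k.
have e i l : reflect_along nu (basis_vec i) 0 l = (l == i)%:R - 2 * nu 0 i * nu 0 l.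
  by rewrite /reflect_along !mxE eqxx /= dotC dot_basis.
have d (F : 'I_N -> R) l : \sum_i (l == i)%:R * F i = F l.
  rewrite (bigD1 l) //= eqxx mul1r big1 ?addr0 // => i il.
  by rewrite eq_sym (negbTE il) mul0r.
transitivity (\sum_i ((k == i)%:R * (j == i)%:R - 2 * ((k == i)%:R * (nu 0 i * nu 0 j))
   - 2 * ((j == i)%:R * (nu 0 i * nu 0 k)) + 4 * (nu 0 k * nu 0 j) * (nu 0 i * nu 0 i))).
  by apply: eq_bigr => i _; rewrite !e; ring.
rewrite big_split /= !sumrB -!mulr_sumr !d -/(dot nu nu) -enorm_sqr n1 expr1n.
ring.
Qed.

Lemma enorm_reflect nu p : enorm nu = 1 -> enorm (reflect_along nu p) = enorm p.
Proof.
move=> n1; apply/eqP; rewrite -(@eqrXn2 _ 2) // !enorm_sqr /reflect_along.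
have nn : dot nu nu = 1 by rewrite -enorm_sqr n1 expr1n.
by rewrite !dotE nn (dotC nu p); apply/eqP; ring.
Qed.

Lemma enorm_continuous : continuous (enorm : V -> R).
Proof.
move=> x; apply/continuous_enormP => e e0; exists e => // y hy.
apply: le_lt_trans hy; rewrite ler_norml.
have := enormD (y - x) x; have := enormD (x - y) y; rewrite !subrK (enormB x y).
by move=> h1 h2; apply/andP; split; lra.
Qed.

(** Moving a boundary point [x] into the domain may increase its distance to [y], but by the
    exterior ball condition the first-order increase is only [h * Q] times that distance. The domain
    need not be convex. *)
Lemma enorm_shift_le x y nu h Q : 0 < enorm (x - y) -> 0 < h -> 0 <= Q ->
  enorm nu = 1 -> dot nu (y - x) <= Q * dot (y - x) (y - x) ->
  enorm (x - h *: nu - y) <= enorm (x - y) + h * Q * enorm (x - y) + h ^+ 2 / (2 * enorm (x - y)).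
Proof.
move=> r0 h0 Q0 n1 hq; set r := enorm (x - y) in r0 *.
have rr : dot (y - x) (y - x) = r ^+ 2 by rewrite -enorm_sqr enormB.
have bnd : 0 <= r + h * Q * r + h ^+ 2 / (2 * r).
  by rewrite !addr_ge0 ?mulr_ge0 ?sqr_ge0 ?invr_ge0 // ?mulr_ge0 // ltW.
rewrite -(@ler_pXn2r _ 2) ?nnegrE //.
have -> : x - h *: nu - y = - ((y - x) + h *: nu) by rewrite opprD opprB addrAC.
rewrite enorm_sqr; have nn : dot nu nu = 1 by rewrite -enorm_sqr n1 expr1n.
set w := y - x in hq rr *; clearbody w.
rewrite !dotE rr nn (dotC w nu); rewrite rr in hq.
set c := h ^+ 2 / (2 * r).
have cE : 2 * r * c = h ^+ 2 by rewrite /c; field; exact: lt0r_neq0.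
have c0 : 0 <= c by rewrite /c divr_ge0 ?sqr_ge0 ?mulr_ge0 // ltW.
have := sqr_ge0 (h * Q * r + c).
have : h * dot nu w <= h * (Q * r ^+ 2) by rewrite ler_wpM2l // ltW.
move=> a1 a2; have := mulr_ge0 (mulr_ge0 (ltW h0) Q0) (ltW r0).
have -> : (r + h * Q * r + c) ^+ 2 = r ^+ 2 + 2 * (h * (Q * r ^+ 2)) + 2 * r * c
   + (h * Q * r + c) ^+ 2 by ring.
rewrite cE; lra.
Qed.

End Auxiliary.

(** * Doubling of variables with the reflection coupling *)

Section Doubling.
Context {R : realType} {N : nat}.
Notation V := 'rV[R]_N.
Implicit Types (x y z p nu : V).

(** A concave modulus of continuity, comparable to [r] as long as [4 * k * r <= 1]. Its second
    derivative [- 2 * k] is what beats the terms coming from the weight. *)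
Definition modulus (k r : R) : R := r - k * r ^+ 2.

Lemma modulus_step (k r s d : R) : 0 < k -> 0 <= s -> 4 * k * r <= 1 -> 0 <= d -> s <= r + d ->
  0 <= r -> modulus k s <= modulus k r + d.
Proof.
move=> k0 s0 kr d0 sd r0; rewrite /modulus.
have e : s - k * s ^+ 2 - (r - k * r ^+ 2) = (s - r) * (1 - k * (s + r)) by ring.
have [sr|sr] := leP s r.
  have : (s - r) * (1 - k * (s + r)) <= 0.
    by apply: mulr_le0_ge0; nra.
  arith.
have : (s - r) * (1 - k * (s + r)) <= (s - r) * 1.
  apply: ler_wpM2l; first arith.
  have : 0 <= k * (s + r) by apply: mulr_ge0; arith.
  arith.
arith.
Qed.

(** The distance grows by about [h * Q * r], which the weights multiply by at most 4; the weight
    drops by [8 * (Q + 1) * h] times a modulus of at least [3 / 4 * r]. The balance is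
    [4 Q + 1 - 6 (Q + 1) <= - 5] times [h * r]. *)
Lemma doubling_boundary_step (k Q gx gy g' : R) x y nu h : 0 < k -> 0 <= Q ->
  0 < enorm (x - y) -> 4 * k * enorm (x - y) <= 1 -> enorm nu = 1 ->
  dot nu (y - x) <= Q * dot (y - x) (y - x) ->
  gx <= 2 -> 1 <= gy <= 2 -> 1 <= g' -> g' <= gx - 8 * (Q + 1) * h ->
  0 < h -> 2 * h <= enorm (x - y) ^+ 2 ->
  modulus k (enorm (x - h *: nu - y)) * (g' + gy) <=
  modulus k (enorm (x - y)) * (gx + gy) - 5 * h * enorm (x - y).
Proof.
move=> k0 Q0 r0 kr n1 hq gx2 /andP[gy1 gy2] g'1 g'x h0 hh.
have sh := enorm_shift_le r0 h0 Q0 n1 hq.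
set s := enorm (x - _ - y) in sh *; set r := enorm (x - y) in r0 kr hh sh *.
have s0 : 0 <= s by exact: enorm_ge0.
set c := h ^+ 2 / (2 * r) in sh.
have cE : 2 * r * c = h ^+ 2 by rewrite /c; field; exact: lt0r_neq0.
have c0 : 0 <= c by rewrite /c divr_ge0 ?sqr_ge0 ?mulr_ge0 // ltW.
have c1 : 4 * c <= h * r.
  rewrite -(@ler_pM2l _ r) // (_ : r * (4 * c) = 2 * (2 * r * c)); last by ring.
  rewrite cE (_ : r * (h * r) = h * r ^+ 2); last by ring.
  by rewrite expr2 mulrCA ler_pM2l.
have d0 : 0 <= h * Q * r + c by rewrite addr_ge0 // mulr_ge0 ?mulr_ge0 // ltW.
have sd : s <= r + (h * Q * r + c) by arith.
have := modulus_step k0 s0 kr d0 sd (ltW r0).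
set d := h * Q * r + c in d0 *; set ps := modulus k s; set pr := modulus k r.
move=> psr.
have pr1 : 3 * r <= 4 * pr.
  by rewrite /pr /modulus; have : 4 * k * r * r <= 1 * r; [rewrite ler_pM2r|arith].
have : ps * (g' + gy) <= (pr + d) * (g' + gy) by apply: ler_wpM2r; arith.
have : (pr + d) * (g' + gy) <= (pr + d) * (gx - 8 * (Q + 1) * h + gy).
  by apply: ler_wpM2l; arith.
have : d * (gx + gy) <= d * 4 by apply: ler_wpM2l; arith.
have : (6 * (Q + 1) * h) * r <= 8 * (Q + 1) * h * pr.
  rewrite (_ : 8 * (Q + 1) * h * pr = (2 * (Q + 1) * h) * (4 * pr)); last by ring.
  rewrite (_ : 6 * (Q + 1) * h * r = (2 * (Q + 1) * h) * (3 * r)); last by ring.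
  by apply: ler_wpM2l => //; apply: mulr_ge0; arith.
have : 0 <= d * (8 * (Q + 1) * h) by apply: mulr_ge0 => //; apply: mulr_ge0; arith.
have : 4 * d <= 4 * (h * Q * r) + h * r by rewrite /d; arith.
have : 0 <= h * Q * r by rewrite mulr_ge0 ?mulr_ge0 // ltW.
have : 0 < h * r by rewrite mulr_gt0.
arith.
Qed.

Lemma is_derive_modulus (k r c s : R) :
  is_derive s 1 (fun s => modulus k (r + c * s)) (c * (1 - 2 * k * (r + c * s))).
Proof.
have d : is_derive s 1 (fun s : R => r + c * s) c.
  have := is_derive_addf (@is_derive_const R R^o r s 1) (is_derive_scalef c (is_derive_id s 1)).
  by rewrite add0r mulr1.
have := is_derive_subf d (is_derive_scalef k (is_derive_mulf d d)).
move=> h; rewrite (_ : (fun s : R => modulus k (r + c * s)) =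
  (fun y : R => r + c * y - k * ((r + c * y) * (r + c * y)))).
  by apply: (is_derive_eq h); ring.
by apply/funext => s0; rewrite /modulus expr2.
Qed.

Variable Omega : set V.
Hypothesis hOmega : smooth_bounded_domain Omega.

Let oO : open Omega. Proof. by case: hOmega. Qed.
Let bO : bounded_set Omega. Proof. by case: hOmega. Qed.

Lemma closure_inner x nu : boundary Omega x -> inward Omega x nu ->
  exists2 e, 0 < e & forall h, 0 < h < e -> closure Omega (x - h *: nu).
Proof. by move=> bx [e e0 he]; exists e => // h /he; exact: subset_closure. Qed.

Lemma boundary_normal x : boundary Omega x -> exists nu, exterior_normal Omega x nu.
Proof.
case: hOmega => _ _ _ _ hb bx; have [U [phi h]] := hb x bx.
by exists ((enorm (gradient phi x))^-1 *: gradient phi x), U, phi.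
Qed.

(* Interior step of the doubling argument: the second differences are taken
   along the reflection coupling, which makes |x - y| vary along x - y only. *)
Lemma doubling_interior (w : V -> R) g (G K : V -> V -> R) (k L d M : R) x y :
  Ck_on 2 Omega w -> C2on setT g G K -> 0 < k -> 0 <= L -> 0 < M ->
  (forall z, closure Omega z -> [/\ 1 <= g z <= 2,
        forall p, `|G z p| <= M * enorm p & forall p, `|K z p| <= M * dot p p]) ->
  Omega x -> Omega y -> 0 < enorm (x - y) -> 4 * k * enorm (x - y) < 1 ->
  w x - w y - L * (modulus k (enorm (x - y)) * (g x + g y)) - d = 0 ->
  (forall x' y', Omega x' -> Omega y' -> 4 * k * enorm (x' - y') <= 1 ->
    w x' - w y' - L * (modulus k (enorm (x' - y')) * (g x' + g y')) - d <= 0) ->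
  1 <= k -> N%:R * M <= k ->
  laplacian w x - laplacian w y <= - (6 * k * L).
Proof.
move=> wC gC k0 L0 M0 hg Ox Oy r0 kr F0 Fle k1 kN.
set r := enorm (x - y) in r0 kr F0.
pose nu := r^-1 *: (x - y).
have n1 : enorm nu = 1 by rewrite enormZ ger0_norm ?invr_ge0 ?(ltW r0) // mulVf // gt_eqF.
have xyE : x - y = r *: nu by rewrite scalerA divff ?scale1r // gt_eqF.
have wC2 := Ck_on_C2on oO wC.
have [gx gGx gKx] := hg x (subset_closure Ox).
have [gy gGy gKy] := hg y (subset_closure Oy).
have [dx dx0 hdx] := (open_enormP Omega).1 oO x Ox.
have [dy dy0 hdy] := (open_enormP Omega).1 oO y Oy.
clearbody nu.
have kr0 : 0 <= k * r * r by rewrite !mulr_ge0 // ltW.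
have kr2 : 4 * k * r * r <= 1 * r by rewrite ler_pM2r // ltW.
have kr3 : 1 * r <= k * r by rewrite ler_pM2r.
have mr0 : 0 <= modulus k r by rewrite /modulus; arith.
have mr1 : modulus k r <= 1 by rewrite /modulus; arith.
(* Summed over [i], the first term gives [- 8 k (g x + g y) <= - 16 k], as [nu] is a unit vector and
   [g >= 1]; the other terms give at most [10 N M <= 10 k]. This is the origin of [- 6 k L]. *)
have key (i : 'I_N) : he w x (basis_vec i) - he w y (reflect_along nu (basis_vec i)) <=
   L * (- (8 * k * nu 0 i ^+ 2) * (g x + g y) + 8 * M + 2 * M).
  set a := basis_vec i; set b := reflect_along nu a.
  have a1 : enorm a = 1 by exact: enorm_basis.
  have b1 : enorm b = 1 by rewrite enorm_reflect.
  set c := 2 * nu 0 i.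
  have ab : a - b = c *: nu by rewrite /b /reflect_along opprB addrC subrK dotC dot_basis.
  have ni : `|nu 0 i| <= 1 by rewrite -n1 coord_le_enorm.
  have c2 : `|c| <= 2 by rewrite /c normrM ger0_norm //; arith.
  have dist s : x + s *: a - (y + s *: b) = (r + c * s) *: nu.
    by rewrite opprD addrACA xyE -scalerBr ab scalerA -scalerDl (mulrC s).
  have dx1 : `|G x a| <= M by have := gGx a; rewrite a1 mulr1.
  have dy1 : `|G y b| <= M by have := gGy b; rewrite b1 mulr1.
  have kx1 : `|K x a| <= M by have := gKx a; rewrite -enorm_sqr a1 expr1n mulr1.
  have ky1 : `|K y b| <= M by have := gKy b; rewrite -enorm_sqr b1 expr1n mulr1.
  have t1 : c * (1 - 2 * k * r) * (G x a + G y b) <= 4 * M.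
    apply: le_trans (ler_norm _) _; rewrite normrM [`|c * _|]normrM.
    have u1 : `|1 - 2 * k * r| <= 1.
      have : 0 < k * r by rewrite mulr_gt0.
      by rewrite ler_norml; move=> ?; apply/andP; split; arith.
    have u2 : `|G x a + G y b| <= 2 * M by apply: le_trans (ler_normD _ _) _; arith.
    rewrite (_ : 4 * M = 2 * 1 * (2 * M)); last by ring.
    have u3 : `|c| * `|1 - 2 * k * r| <= 2 * 1 by apply: ler_pM.
    by apply: ler_pM => //; apply: mulr_ge0.
  have t2 : modulus k r * (K x a + K y b) <= 2 * M.
    have u2 : K x a + K y b <= 2 * M.
      by have := ler_norm (K x a); have := ler_norm (K y b); arith.
    have [u|u] := leP 0 (K x a + K y b); last first.
      by have := mulr_ge0_le0 mr0 (ltW u); arith.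
    by have : modulus k r * (K x a + K y b) <= 1 * (K x a + K y b); [exact: ler_wpM2r|arith].
  pose f s := w (s *: a + x) - w (s *: b + y)
     - L * (modulus k (r + c * s) * (g (s *: a + x) + g (s *: b + y))) - d.
  pose f1 s := gr w (s *: a + x) a - gr w (s *: b + y) b
     - L * (c * (1 - 2 * k * (r + c * s)) * (g (s *: a + x) + g (s *: b + y)) +
            modulus k (r + c * s) * (G (s *: a + x) a + G (s *: b + y) b)) - 0.
  (* [dx] and [dy] keep both points in [Omega]; [r / 2] keeps [r + c * s] nonnegative, hence equal
     to the distance, since [c] is at most 2 in absolute value; the last bound keeps the pair in the
     range where the hypothesis applies. *)
  pose e := Num.min (Num.min dx dy) (Num.min (r / 2) ((1 - 4 * k * r) / (8 * k))).
  have e0 : 0 < e by rewrite /e !lt_min dx0 dy0 divr_gt0 // divr_gt0 ?subr_gt0 ?mulr_gt0.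
  have inx s : `|s| < e -> Omega (s *: a + x).
    by rewrite /e !lt_min => /andP[/andP[h _] _]; apply: hdx; rewrite addrK enormZ a1 mulr1.
  have iny s : `|s| < e -> Omega (s *: b + y).
    by rewrite /e !lt_min => /andP[/andP[_ h] _]; apply: hdy; rewrite addrK enormZ b1 mulr1.
  have [|||h1 h2] := @second_derivative_test _ f f1
     (he w x a - he w y b
     - L * ((- (2 * k * c ^+ 2) * (g x + g y) + (c * (1 - 2 * k * r)) * (G x a + G y b)) +
            (c * (1 - 2 * k * r) * (G x a + G y b) + modulus k r * (K x a + K y b))) - 0) e e0.
  - move=> s se; have [wx _] := C2on_line_at wC2 (inx s se).
    have [wy _] := C2on_line_at wC2 (iny s se).
    have [ggx _] := @C2on_line_at _ _ _ _ _ _ x a s gC I.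
    have [ggy _] := @C2on_line_at _ _ _ _ _ _ y b s gC I.
    exact: (is_derive_subf (is_derive_subf (is_derive_subf wx wy) (is_derive_scalef L
      (is_derive_mulf (is_derive_modulus k r c s) (is_derive_addf ggx ggy))))
      (@is_derive_const R R^o d s 1)).
  - have z0 : `|0 : R| < e by rewrite normr0.
    have [_ wx] := C2on_line_at wC2 (inx 0 z0).
    have [_ wy] := C2on_line_at wC2 (iny 0 z0).
    have [ggx ggx2] := @C2on_line_at _ _ _ _ _ _ x a 0 gC I.
    have [ggy ggy2] := @C2on_line_at _ _ _ _ _ _ y b 0 gC I.
    have dm : is_derive (0 : R) 1 (fun s => c * (1 - 2 * k * (r + c * s))) (- (2 * k * c ^+ 2)).
      have h := is_derive_scalef c (is_derive_subf (@is_derive_const R R^o 1 0 1)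
        (is_derive_scalef (2 * k) (is_derive_addf (@is_derive_const R R^o r 0 1)
        (is_derive_scalef c (is_derive_id (0 : R) 1))))).
      by apply: (is_derive_eq h); ring.
    have h := is_derive_subf (is_derive_subf (is_derive_subf wx wy) (is_derive_scalef L
      (is_derive_addf (is_derive_mulf dm (is_derive_addf ggx ggy))
      (is_derive_mulf (is_derive_modulus k r c 0) (is_derive_addf ggx2 ggy2)))))
      (@is_derive_const R R^o 0 0 1).
    by apply: (is_derive_eq h); rewrite !scale0r !add0r !mulr0 !addr0.
  - move=> s se; rewrite {2}/f !scale0r !add0r mulr0 addr0 F0.
    have [se2 se3] : `|s| < r / 2 /\ `|s| < (1 - 4 * k * r) / (8 * k).
      by move: se; rewrite /e !lt_min => /andP[_ /andP[]].
    have cs : `|c * s| <= 2 * `|s| by rewrite normrM ler_wpM2r.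
    have rs0 : 0 <= r + c * s by move: cs; rewrite ler_norml => /andP[cs1 _]; arith.
    have rs1 : r + c * s <= r + 2 * `|s| by move: cs; rewrite ler_norml => /andP[_ cs1]; arith.
    have E : enorm (s *: a + x - (s *: b + y)) = r + c * s.
      by rewrite (addrC _ x) (addrC _ y) dist enormZ n1 mulr1 ger0_norm.
    have := Fle _ _ (inx s se) (iny s se); rewrite E /f; apply.
    apply: (@le_trans _ _ (4 * k * (r + 2 * `|s|))); first by rewrite ler_wpM2l // mulr_ge0 // ltW.
    by move: se3; rewrite ltr_pdivlMr ?mulr_gt0 //; arith.
  rewrite subr0 subr_le0 in h2; apply: le_trans h2 _; apply: ler_wpM2l => //.
  clear -t1 t2; rewrite (_ : 8 * k * nu 0 i ^+ 2 = 2 * k * c ^+ 2); last by rewrite /c; ring.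
  arith.
have lapy : \sum_i he w y (reflect_along nu (basis_vec i)) = laplacian w y.
  exact: (laplacian_rotation w y (reflect_basis_orthonormal n1)).
have lapx : \sum_i he w x (basis_vec i) = laplacian w x.
  by apply: eq_bigr => i _; exact: he_basis.
clear -key lapx lapy n1 L0 k0 kN M0 gx gy.
rewrite -lapx -lapy -sumrB; apply: le_trans (ler_sum _ (fun i _ => key i)) _.
clear lapx lapy key.
rewrite -mulr_sumr !big_split /= !sumr_const !card_ord -mulr_suml.
rewrite (_ : \sum_i - (8 * k * nu 0 i ^+ 2) = - (8 * k)); last first.
  rewrite sumrN -mulr_sumr; congr (- _).
  have <- : dot nu nu = \sum_i nu 0 i ^+ 2 by apply: eq_bigr => i _; rewrite expr2.
  by rewrite -enorm_sqr n1 expr1n mulr1.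
rewrite -mulrN mulrC (_ : 6 * k = - (- (6 * k))); last by rewrite opprK.
rewrite -mulNr opprK; apply: ler_wpM2r => //.
rewrite -(mulr_natl (8 * M) N) -(mulr_natl (2 * M) N).
case/andP: gx => gx1 _; case/andP: gy => gy1 _; clear n1.
have : 8 * k * 2 <= 8 * k * (g x + g y) by apply: ler_wpM2l; arith.
arith.
Qed.

End Doubling.

Section DoublingTheorem.
Context {R : realType} {N : nat}.
Notation V := 'rV[R]_N.
Implicit Types (x y z nu : V).

(** A first touching of 0 by [w x t - w y t - L (modulus |x - y|) (g x + g y) - d] is excluded
    everywhere: on the diagonal by [d], at distance [r0] by the size of [L], at the boundary by the
    weight, inside by the reflection coupling. [L] is chosen before [t1] and [w], so it will not
    depend on [eps]. *)
Lemma doubling_lipschitz (Omega : set V) (alpha S L0 r1 : R) :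
  smooth_bounded_domain Omega -> 0 < alpha -> 0 <= S -> 0 <= L0 -> 0 < r1 ->
  exists2 L, 0 < L & forall (t1 : R) (w : V -> R -> R),
    wcont (closure Omega `*` [set t | 0 <= t <= t1]) (fun p : V * R => w p.1 p.2) ->
    (forall t, 0 < t <= t1 -> Ck_on 2 Omega (w ^~ t)) ->
    (forall x t, Omega x -> 0 < t <= t1 ->
       exists2 l, left_derive (w x) t l & `|l - alpha * laplacian (w ^~ t) x| <= S) ->
    (forall t, 0 < t <= t1 -> zero_normal_derivative Omega (w ^~ t)) ->
    (forall x t, closure Omega x -> 0 <= t <= t1 -> `|w x t| <= S) ->
    (forall x y, closure Omega x -> closure Omega y -> enorm (x - y) <= r1 ->
       `|w x 0 - w y 0| <= L0 * enorm (x - y)) ->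
    forall x y t, closure Omega x -> closure Omega y -> 0 <= t <= t1 ->
      `|w x t - w y t| <= L * enorm (x - y).
Proof.
have num (a b lx ly s kaL aL : R) : 0 <= lx - ly -> a - b <= - (6 * kaL) -> s < aL ->
  aL <= kaL -> lx - a <= s -> - (ly - b) <= s -> 0 <= s -> False by move=> *; arith.
move=> hOmega al0 S0 L00 r10; have [oO _ _ bO _] := hOmega.
have [psi [n [H [B [c df]]]]] := defining_function_exists hOmega.
pose Q := B / c.
have Q0 : 0 <= Q by rewrite divr_ge0 ?(ltW (df_c df)) // (le_trans ler01 (df_B df)).
have A0 : 0 < 8 * (Q + 1) by rewrite mulr_gt0 // ltr_wpDl.
have [g [G [K [M [gC M0 gcont hg gbd]]]]] := boundary_weight oO df bO A0.
(* [N * M] absorbs the derivatives of the weight, [r1^-1] ensures [r0 <= r1], and 1 gives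
   [k >= 1]. *)
pose k := N%:R * M + r1^-1 + 1.
have NM : 0 <= N%:R * M by rewrite mulr_ge0 // ltW.
have r1i : 0 < r1^-1 by rewrite invr_gt0.
have [k1 kN k0 kr1] : [/\ 1 <= k, N%:R * M <= k, 0 < k & r1^-1 <= k].
  by rewrite /k; split; arith.
pose r0 := (4 * k)^-1.
have r00 : 0 < r0 by rewrite invr_gt0 mulr_gt0.
have kr0 : 4 * k * r0 = 1 by rewrite divff // lt0r_neq0 // mulr_gt0.
have r01 : r0 <= r1.
  rewrite /r0 -[r1]invrK lef_pV2 ?posrE ?mulr_gt0 //; arith.
(* One term for each case: [L0] for the initial time, [2 * S / r0] for pairs at distance [r0],
   [S / alpha] for interior points, where the defect of the heat equation is at most [S] at each of
   the two points. *)
pose L := L0 + 2 * S / r0 + S / alpha + 1.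
have Sr0 : 0 <= 2 * S / r0 by rewrite divr_ge0 ?mulr_ge0 // ltW.
have Sal : 0 <= S / alpha by rewrite divr_ge0 // ltW.
have [L1 LL0 LS LSa] : [/\ 0 < L, L0 <= L, 2 * S / r0 <= L & S / alpha < L].
  by rewrite /L; split; arith.
have hQ x nu y : boundary Omega x -> exterior_normal Omega x nu -> closure Omega y ->
  dot nu (y - x) <= Q * dot (y - x) (y - x) by exact: (exterior_quadratic oO df).
clearbody L k r0 Q.
exists (4 * L) => [|t1 w wc wC wt wn wS w0]; first exact: mulr_gt0.
have main d : 0 < d -> forall x y t, closure Omega x -> closure Omega y -> 0 <= t <= t1 ->
    enorm (x - y) <= r0 -> w x t - w y t - L * (modulus k (enorm (x - y)) * (g x + g y)) - d < 0.
  move=> d0.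
  pose K2 : set (V * V) := (closure Omega `*` closure Omega) `&`
     [set p | 0 <= r0 - enorm (p.1 - p.2)].
  pose F (p : V * V) t := w p.1 t - w p.2 t
     - L * (modulus k (enorm (p.1 - p.2)) * (g p.1 + g p.2)) - d.
  have cO := bounded_closure_compact bO.
  have ce : continuous (fun p : V * V => enorm (p.1 - p.2)).
    move=> p; apply: (@continuous_comp _ _ _ (fun p : V * V => p.1 - p.2) enorm).
      by apply: cvgB; [exact: cvg_fst|exact: cvg_snd].
    exact: enorm_continuous.
  have cK2 : compact K2.
    apply: compact_superlevel; first exact: compact_setX.
    by apply: wcont_sub; [exact: wcont_cst|apply: wcont_for => p _; exact: ce].
  have gr01 r : 0 <= r <= r0 -> 3 * r <= 4 * modulus k r /\ modulus k r <= r.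
    move=> /andP[ra rb]; rewrite /modulus.
    have : 4 * k * r * r <= 4 * k * r0 * r by apply: ler_wpM2r => //; apply: ler_wpM2l => //; arith.
    have : 0 <= k * (r * r) by rewrite !mulr_ge0 // ltW.
    by rewrite kr0 mul1r -!mulrA -expr2 => ? ?; split; arith.
  have Fc : wcont (K2 `*` [set t | 0 <= t <= t1]) (fun q => F q.1 q.2).
    have c11 : continuous (fun q : V * V * R => q.1.1).
      by move=> q; apply: (@continuous_comp _ _ _ fst fst); exact: cvg_fst.
    have c12 : continuous (fun q : V * V * R => q.1.2).
      by move=> q; apply: (@continuous_comp _ _ _ fst snd); [exact: cvg_fst|exact: cvg_snd].
    have c1 : continuous (fun q : V * V * R => (q.1.1, q.2)).
      by apply: continuous_pairing; [exact: c11|move=> q; exact: cvg_snd].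
    have c2 : continuous (fun q : V * V * R => (q.1.2, q.2)).
      by apply: continuous_pairing; [exact: c12|move=> q; exact: cvg_snd].
    have e1 : wcont (K2 `*` [set t | 0 <= t <= t1]) (fun q : V * V * R => enorm (q.1.1 - q.1.2)).
      by apply: wcont_for => q _; apply: (@continuous_comp _ _ _ fst
         (fun p : V * V => enorm (p.1 - p.2))); [exact: cvg_fst|exact: ce].
    apply: wcont_sub; last exact: wcont_cst.
    apply: wcont_sub; [apply: wcont_sub|apply: wcont_mul; first exact: wcont_cst].
    - by apply: (wcont_precomp wc c1) => q [[[h1 h2] _] h3]; exact: conj h1 h3.
    - by apply: (wcont_precomp wc c2) => q [[[h1 h2] _] h3]; exact: conj h2 h3.
    apply: wcont_mul.
      apply: wcont_sub => //; apply: wcont_mul; first exact: wcont_cst.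
      by rewrite (_ : (fun x : V * V * R => enorm (x.1.1 - x.1.2) ^+ 2) = (fun q : V * V * R => enorm (q.1.1 - q.1.2) * enorm (q.1.1 - q.1.2)));
        [exact: wcont_mul|apply/funext => q; rewrite expr2].
    apply: wcont_add; apply: wcont_for => q _.
      by apply: (@continuous_comp _ _ _ (fun q : V * V * R => q.1.1) g);
        [exact: c11|exact: gcont].
    by apply: (@continuous_comp _ _ _ (fun q : V * V * R => q.1.2) g);
        [exact: c12|exact: gcont].
  have g2 x : closure Omega x -> 1 <= g x <= 2 by move=> cx; have [h _ _] := hg x cx.
  have low x y : closure Omega x -> closure Omega y -> enorm (x - y) <= r0 ->
      3 * (L * enorm (x - y)) <= 2 * (L * (modulus k (enorm (x - y)) * (g x + g y))).
    move=> /g2/andP[gx _] /g2/andP[gy _] hr.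
    have [|h1 _] := gr01 (enorm (x - y)); first by rewrite enorm_ge0 hr.
    set r := enorm _ in h1 hr *; have r0' : 0 <= r by exact: enorm_ge0.
    set m := modulus k r in h1 *; clearbody r m.
    rewrite mulrCA [X in _ <= X]mulrCA; apply: ler_wpM2l; first exact: ltW.
    have : m * 2 <= m * (g x + g y) by apply: ler_wpM2l; arith.
    clear -h1; lra.
  have ft : forall p t, K2 p -> 0 <= t <= t1 -> F p t < 0.
    apply: (first_touch cK2 Fc).
    - move=> [x y] [[/= cx cy] hr]; rewrite subr_ge0 in hr.
      have t10 : 0 <= enorm (x - y) by [].
      have := low x y cx cy hr; have := w0 x y cx cy (le_trans hr r01).
      have : L0 * enorm (x - y) <= L * enorm (x - y) by exact: ler_wpM2r.
      rewrite /F /= => h1 h2 h3; have := ler_norm (w x 0 - w y 0).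
      set A := L * (modulus _ _ * _) in h3 *; set r := enorm _ in h1 h2 h3 t10 *.
      have := mulr_ge0 (ltW L1) t10; set Lr := L * r in h1 h3 *; clear -h1 h2 h3 d0; lra.
    move=> [x y] t [[/= cx cy] hr] /andP[t0 tt] F0 Fle Fbefore; rewrite /= subr_ge0 in hr.
    have tt0 : 0 <= t <= t1 by rewrite tt ltW.
    have tt1 : 0 < t <= t1 by rewrite tt t0.
    have rp : 0 < enorm (x - y).
      rewrite lt_def enorm_ge0 andbT; apply/eqP => r0'.
      move: F0; rewrite /F /= r0' /modulus expr0n mulr0 subrr mul0r mulr0 subr0.
      move/eqP: r0'; rewrite enorm_eq0 subr_eq0 => /eqP ->; rewrite subrr.
      by move=> h; clear -h d0; lra.
    have rlt : enorm (x - y) < r0.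
      rewrite lt_neqAle hr andbT; apply/eqP => re.
      have := low x y cx cy hr; rewrite re => h1.
      have h2 : 2 * S <= L * r0 by rewrite -ler_pdivrMr.
      have := wS x t cx tt0; have := wS y t cy tt0.
      move: F0; rewrite /F /= re => h3.
      set A := L * (modulus _ _ * _) in h1 h3; rewrite !ler_norml => /andP[h4 h5] /andP[h6 h7].
      have h8 : 0 < L * r0 by exact: mulr_gt0.
      by clear -h1 h2 h3 h4 h5 h6 h7 h8 d0; lra.
    have kr : 4 * k * enorm (x - y) < 1.
      have h4k : 0 < 4 * k by rewrite mulr_gt0.
      by have := ltr_pM2l h4k (enorm (x - y)) r0; rewrite kr0 rlt => ->.
    have bstep x' y' nu : closure Omega x' -> closure Omega y' -> boundary Omega x' ->
        exterior_normal Omega x' nu -> enorm (x' - y') = enorm (x - y) ->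
        exists2 e, 0 < e & forall h, 0 < h < e -> [/\ closure Omega (x' - h *: nu),
          `|w x' t - w (x' - h *: nu) t| <= L * enorm (x - y) * h,
          enorm (x' - h *: nu - y') <= r0 &
          modulus k (enorm (x' - h *: nu - y')) * (g (x' - h *: nu) + g y') <=
          modulus k (enorm (x - y)) * (g x' + g y') - 5 * h * enorm (x - y)].
      move=> cx' cy' bx ex rE.
      have [nE n1 inw] := exterior_normalP oO df bx ex.
      have [e1 e10 he1] := closure_inner bx inw.
      have [e2 e20 he2] := normal_derivative_eps (wn t tt1) bx ex (mulr_gt0 L1 rp).
      have [e3 e30 he3] := gbd x' nu bx ex.
      pose e4 := r0 - enorm (x - y); have e40 : 0 < e4 by rewrite subr_gt0.
      pose e5 := enorm (x - y) ^+ 2 / 2.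
      have e50 : 0 < e5 by rewrite divr_gt0 // exprn_gt0.
      exists (Num.min (Num.min e1 e2) (Num.min e3 (Num.min e4 e5))) => [|h].
        by rewrite !lt_min e10 e20 e30 e40 e50.
      rewrite !lt_min => /andP[h0 /andP[/andP[h1 h2] /andP[h3 /andP[h4 h5]]]].
      have ch : closure Omega (x' - h *: nu) by apply: he1; rewrite h0.
      have gE := he3 h; rewrite h0 h3 in gE; have {}gE := gE isT.
      split=> //.
      - by apply: he2; rewrite h0.
      - rewrite addrAC; apply: le_trans (enormD _ _) _; rewrite enormN enormZ n1 mulr1 rE gtr0_norm //.
        by rewrite /e4 in h4; clear -h4; lra.
      - rewrite -rE; apply: (@doubling_boundary_step _ _ k Q) => //; rewrite ?rE //.
        + exact: ltW.
        + exact: hQ.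
        + by case/andP: (g2 _ cx').
        + exact: g2.
        + by case/andP: (g2 _ ch).
        + by rewrite mulrC -ler_pdivlMr // ltW.
    have rsym : enorm (y - x) = enorm (x - y) by rewrite enormB.
    have [Ox|bx] := closure_open_cases oO cx; last first.
      have [nu ex] := boundary_normal hOmega bx.
      have [e e0 he] := bstep x y nu cx cy bx ex erefl.
      have [|ch h1 h2 h3] := he (e / 2); first by clear -e0; lra.
      have := Fle (x - (e / 2) *: nu, y); move: F0; rewrite /F /=.
      have hK : K2 (x - (e / 2) *: nu, y) by split=> //=; rewrite subr_ge0.
      move=> F0 /(_ hK).
      have h4 : L * (modulus k (enorm (x - (e / 2) *: nu - y)) * (g (x - (e / 2) *: nu) + g y))
         <= L * (modulus k (enorm (x - y)) * (g x + g y) - 5 * (e / 2) * enorm (x - y)).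
        by apply: ler_wpM2l => //; exact: ltW.
      have h5 : 0 < L * enorm (x - y) * e by rewrite !mulr_gt0.
      move: h1; rewrite ler_norml => /andP[_ h1].
      rewrite mulrBr in h4; move: F0 h1 h4 h5.
      set E := enorm (x - y); set a := w _ t; set b := w _ t; set c' := w _ t.
      set P := L * (modulus k E * _); set P' := L * (modulus _ _ * _).
      by clear; move=> *; arith.
    have [Oy|by_] := closure_open_cases oO cy; last first.
      have [nu ey] := boundary_normal hOmega by_.
      have [e e0 he] := bstep y x nu cy cx by_ ey rsym.
      have [|ch h1 h2 h3] := he (e / 2); first by clear -e0; lra.
      have := Fle (x, y - (e / 2) *: nu); move: F0; rewrite /F /=.
      rewrite (enormB x (y - (e / 2) *: nu)) (addrC (g x) (g y)) (addrC (g x)).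
      have hK : K2 (x, y - (e / 2) *: nu) by split=> //=; rewrite subr_ge0 enormB.
      move=> F0 /(_ hK).
      have h4 : L * (modulus k (enorm (y - (e / 2) *: nu - x)) * (g (y - (e / 2) *: nu) + g x))
         <= L * (modulus k (enorm (x - y)) * (g y + g x) - 5 * (e / 2) * enorm (x - y)).
        by apply: ler_wpM2l => //; exact: ltW.
      have h5 : 0 < L * enorm (x - y) * e by rewrite !mulr_gt0.
      move: h1; rewrite ler_norml => /andP[h1 _].
      rewrite mulrBr in h4; move: F0 h1 h4 h5.
      set E := enorm (x - y); set a := w _ t; set b := w _ t; set c' := w _ t.
      set P := L * (modulus k E * _); set P' := L * (modulus _ _ * _).
      by clear; move=> *; arith.
    have lap : laplacian (w ^~ t) x - laplacian (w ^~ t) y <= - (6 * k * L).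
      apply: (@doubling_interior _ _ Omega hOmega (w ^~ t) g G K k L d M x y) => //.
      - exact: wC.
      - exact: ltW.
      move=> x' y' Ox' Oy' hr'; apply: (Fle (x', y')); split; last first.
        rewrite /= subr_ge0 -(@ler_pM2l _ (4 * k)) ?kr0 //; exact: mulr_gt0.
      by split; exact: subset_closure.
    have [lx [zx dzx zxE] hlx] := wt x t Ox tt1.
    have [ly [zy dzy zyE] hly] := wt y t Oy tt1.
    have dl : 0 <= lx - ly.
      apply: (is_derive_left_max (is_derive_subf dzx dzy)); exists t => // s /andP[s0 st].
      rewrite subrr in s0.
      rewrite zxE ?s0 ?(ltW st) // zyE ?s0 ?(ltW st) // zxE ?t0 ?lexx // zyE ?t0 ?lexx //.
      have := Fbefore (x, y) s; rewrite (ltW s0) st => /(_ _ isT) hF.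
      have {}hF : F (x, y) s < 0 by apply: hF; split=> //=; rewrite subr_ge0.
      move: hF F0; rewrite /F /=; set P := L * _; clear; move=> *; arith.
    have al : alpha * (laplacian (w ^~ t) x - laplacian (w ^~ t) y) <= alpha * - (6 * k * L).
      by apply: ler_wpM2l => //; exact: ltW.
    have LS2 : S < alpha * L by rewrite mulrC -ltr_pdivrMr.
    have LS3 : alpha * L <= k * (alpha * L).
      by rewrite -[X in X <= _]mul1r; apply: ler_wpM2r => //; rewrite mulr_ge0 // ltW.
    have a1 := le_trans (ler_norm _) hlx.
    have a2 : - (ly - alpha * laplacian (w ^~ t) y) <= S.
      by apply: le_trans hly; rewrite -normrN; exact: ler_norm.
    apply: (num _ _ _ _ _ _ _ dl _ LS2 LS3 a1 a2 S0).
    apply: le_trans (le_trans _ al) _; first by rewrite mulrBr.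
    by rewrite mulrN le_eqVlt; apply/orP; left; apply/eqP; ring.
  move=> x y t cx cy tt hr; apply: (ft (x, y)) => //; split=> //=.
  by rewrite subr_ge0.
have half x y t : closure Omega x -> closure Omega y -> 0 <= t <= t1 ->
    w x t - w y t <= 4 * L * enorm (x - y).
  move=> cx cy tt; have r'0 := enorm_ge0 (x - y).
  have [hr|hr] := leP (enorm (x - y)) r0; last first.
    have := wS x t cx tt; have := wS y t cy tt.
    rewrite !ler_norml => /andP[h1 h2] /andP[h3 h4].
    have h5 : 2 * S <= L * r0 by rewrite -ler_pdivrMr.
    have h6 : L * r0 <= L * enorm (x - y) by rewrite ler_wpM2l ?ltW.
    have h7 : 0 <= L * enorm (x - y) by rewrite mulr_ge0 // ltW.
    by clear -h1 h2 h3 h4 h5 h6 h7; lra.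
  apply/ler_addgt0Pr => d d0; have := main d d0 x y t cx cy tt hr.
  have [/andP[gx gx2] _ _] := hg x cx; have [/andP[gy gy2] _ _] := hg y cy.
  have : modulus k (enorm (x - y)) * (g x + g y) <= enorm (x - y) * 4.
    apply: (@le_trans _ _ (enorm (x - y) * (g x + g y))).
      apply: ler_wpM2r; first by clear -gx gy; lra.
      by rewrite /modulus lerBlDr lerDl mulr_ge0 ?sqr_ge0 // ltW.
    by apply: ler_wpM2l => //; clear -gx2 gy2; lra.
  move=> h; have : L * (modulus k (enorm (x - y)) * (g x + g y)) <= L * (enorm (x - y) * 4).
    by rewrite ler_wpM2l // ltW.
  rewrite (_ : 4 * L * enorm (x - y) = L * (enorm (x - y) * 4)); last by ring.
  set A := L * _; set A' := L * _; clear; move=> *; arith.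
move=> x y t cx cy tt; rewrite ler_norml half // andbT.
by have := half y x t cy cx tt; rewrite (enormB y) => h; clear -h; lra.
Qed.

End DoublingTheorem.

(** * The attractant *)

Section Haptotaxis.
Context {R : realType} {N : nat}.
Notation V := 'rV[R]_N.
Implicit Types (x y z nu : V).

Lemma is_derive_affine (a b s : R) : is_derive s 1 (fun r : R => a + b * r) b.
Proof.
have h := is_derive_addf (@is_derive_const R R^o a s 1) (is_derive_scalef b (is_derive_id s 1)).
by apply: (is_derive_eq h); rewrite add0r mulr1.
Qed.

(** First touching with the strict majorant obtained by adding [e' * (1 + t)]. The slope bound is
    asked only where [y] already exceeds the line, so terms of favourable sign may be dropped
    there. *)
Lemma left_growth (t1 c b : R) (y : R -> R) :
  wcont [set t | 0 <= t <= t1] y -> y 0 <= b ->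
  (forall t, 0 < t <= t1 -> b + c * t < y t -> exists2 l, left_derive y t l & l <= c) ->
  forall t, 0 <= t <= t1 -> y t <= b + c * t.
Proof.
move=> cy y0 hy t tt; apply/ler_addgt0Pr => e e0.
pose e' := e / (1 + `|t|).
have n0 : 0 < 1 + `|t| by rewrite ltr_pwDl.
have e'0 : 0 < e' by rewrite divr_gt0.
pose F (_ : R) t := y t - (b + c * t + e' * (1 + t)).
have cF : wcont ([set 0 : R] `*` [set t | 0 <= t <= t1]) (fun p => F p.1 p.2).
  have c2 : wcont ([set 0 : R] `*` [set t | 0 <= t <= t1]) (fun p => p.2).
    by apply: wcont_for => p _; exact: cvg_snd.
  apply: wcont_sub; first by apply: (wcont_precomp cy) => [p|p [_]//]; exact: cvg_snd.
  apply: wcont_add; last by apply: wcont_mul; [exact: wcont_cst|apply: wcont_add => //; exact: wcont_cst].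
  by apply: wcont_add; [exact: wcont_cst|apply: wcont_mul => //; exact: wcont_cst].
have tE : e' * (1 + t) <= e.
  by case/andP: tt => t0 _; rewrite /e' ger0_norm // divfK // lt0r_neq0 //; arith.
suff : F 0 t < 0 by rewrite /F; arith.
apply: (first_touch (@compact_set1 _ (0 : R)) cF) => //.
  by move=> x _; rewrite /F; arith.
move=> x s -> /andP[s0 st]; rewrite /F => Fs _ Fb.
have es : 0 < e' * (1 + s) by rewrite mulr_gt0 //; arith.
have [||l [z dz zE] lc] := hy s; [by rewrite s0|by arith|].
have d : is_derive s 1 (fun r => z r - (b + c * r + e' * (1 + r))) (l - (c + e')).
  have h := is_derive_subf dz (is_derive_addf (is_derive_affine b c s)
    (is_derive_scalef e' (is_derive_affine 1 1 s))).
  rewrite (_ : (fun r : R => z r - (b + c * r + e' * (1 + r))) = (fun y : R => z y - (b + c * y + e' * (1 + 1 * y)))).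
    by apply: (is_derive_eq h); rewrite mulr1.
  by apply/funext => r; rewrite mul1r.
suff : 0 <= l - (c + e') by arith.
apply: (is_derive_left_max d); exists s => // r /andP[r0 rs].
rewrite subrr in r0; rewrite zE ?r0 ?(ltW rs) // zE ?s0 ?lexx // Fs.
by have := Fb 0 r erefl; rewrite (ltW r0) rs => /(_ isT); arith.
Qed.

Lemma left_derive_shift (y : R -> R) a t l : 0 <= a -> left_derive y (a + t) l ->
  left_derive (fun s => y (a + s)) t l.
Proof.
move=> a0 [z dz zE]; exists (fun s => z (a + 1 * s)) => [|r /andP[r0 rt]].
  have e : a + 1 * t = a + t by rewrite mul1r.
  have dz' : is_derive (a + 1 * t) 1 z l by rewrite e.
  have h := is_derive_comp_real (f := fun s : R => a + 1 * s) dz' (is_derive_affine a 1 t).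
  by apply: (is_derive_eq h); rewrite mulr1.
by rewrite mul1r zE // ltr_wpDl // lerD2l.
Qed.

Lemma left_derive_sub (y1 y2 : R -> R) t l1 l2 : left_derive y1 t l1 ->
  left_derive y2 t l2 -> left_derive (fun s => y1 s - y2 s) t (l1 - l2).
Proof.
move=> [z1 d1 e1] [z2 d2 e2]; exists (fun s => z1 s - z2 s); first exact: is_derive_subf.
by move=> r hr; rewrite e1 // e2.
Qed.

(** The derivative of [y1 - y2] is [- lambda m1 (y1 - y2) - lambda (m1 - m2) y2]. Where [y1 - y2] is
    nonnegative, the only case [left_growth] asks about, the first term helps, so no exponential
    factor appears. The starting time [a] is free so that time intervals with different [D] can be
    concatenated. *)
Lemma decay_comparison (lambda a b Vm D : R) (y1 y2 m1 m2 : R -> R) :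
  0 < lambda -> 0 <= a -> a <= b -> 0 <= Vm -> 0 <= D ->
  wcont [set t | 0 <= t <= b] y1 -> wcont [set t | 0 <= t <= b] y2 ->
  (forall t, 0 < t <= b -> left_derive y1 t (- lambda * m1 t * y1 t)) ->
  (forall t, 0 < t <= b -> left_derive y2 t (- lambda * m2 t * y2 t)) ->
  (forall t, a < t <= b -> 0 <= m1 t /\ 0 <= y2 t <= Vm /\ `|m1 t - m2 t| <= D) ->
  y1 b - y2 b <= `|y1 a - y2 a| + lambda * Vm * D * (b - a).
Proof.
move=> l0 a0 ab Vm0 D0 c1 c2 d1 d2 hm.
have sh : continuous (fun s : R => a + s).
  by move=> s; apply: cvgD; [exact: cvg_cst|exact: cvg_id].
have e : a + (b - a) = b by rewrite addrC subrK.
suff : (fun s => y1 (a + s) - y2 (a + s)) (b - a) <= `|y1 a - y2 a| + lambda * Vm * D * (b - a).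
  by rewrite /= e.
apply: (@left_growth (b - a) (lambda * Vm * D) _ (fun s => y1 (a + s) - y2 (a + s))).
- by apply: wcont_sub; [apply: (wcont_precomp c1 sh)|apply: (wcont_precomp c2 sh)] => p /= /andP[p0 p1];
    apply/andP; split; arith.
- by rewrite addr0; exact: ler_norm.
- move=> t /andP[t0 tb] hy.
  have at_ : 0 < a + t <= b by apply/andP; split; arith.
  exists (- lambda * m1 (a + t) * y1 (a + t) - - lambda * m2 (a + t) * y2 (a + t)).
    by apply: left_derive_sub; apply: left_derive_shift => //; [exact: d1|exact: d2].
  have [|m0 [/andP[v0 v1] mD]] := hm (a + t); first by apply/andP; split; arith.
  have yp : 0 <= y1 (a + t) - y2 (a + t).
    have : 0 <= lambda * Vm * D * t by rewrite !mulr_ge0 // ltW.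
    by have := normr_ge0 (y1 a - y2 a); arith.
  set A := y1 _ in yp *; set B := y2 _ in v0 v1 yp *; set M1 := m1 _ in m0 mD *; set M2 := m2 _ in mD *.
  rewrite (_ : _ - _ = - (lambda * (M1 * (A - B))) + lambda * (B * - (M1 - M2))); last by ring.
  have h1 : 0 <= lambda * (M1 * (A - B)) by rewrite !mulr_ge0 // ltW.
  have h2 : lambda * (B * - (M1 - M2)) <= lambda * (Vm * D).
    apply: ler_wpM2l; first exact: ltW.
    apply: (@le_trans _ _ (B * D)); last exact: ler_wpM2r.
    apply: ler_wpM2l => //; apply: le_trans mD; rewrite -normrN; exact: ler_norm.
  rewrite -mulrA; clear -h1 h2; lra.
- by apply/andP; split; arith.
Qed.

Lemma wcont_eps (C : set V) (I : set R) (f : V -> R -> R) x t e :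
  wcont (C `*` I) (fun p : V * R => f p.1 p.2) -> C x -> I t -> 0 < e ->
  exists2 d, 0 < d & forall y s, C y -> I s -> enorm (y - x) < d -> `|s - t| < d ->
    `|f y s - f x t| < e.
Proof.
move=> cf Cx It e0; have /= := cf (x, t) (conj Cx It) _ (nbhsx_ballx (f x t) e e0).
move=> [[P Q] /= [/nbhs_enormP[d d0 hP] /nbhs_realP[d' d'0 hQ]] h].
exists (Num.min d d') => [|y s Cy Is]; first by rewrite lt_min d0.
rewrite !lt_min => /andP[yd _] /andP[_ sd].
have := h (y, s) (conj (hP y yd) (hQ s sd)) (conj Cy Is).
by rewrite /= /ball /= distrC.
Qed.

Lemma wcont_section (C : set V) (I : set R) (f : V -> R -> R) x :
  wcont (C `*` I) (fun p : V * R => f p.1 p.2) -> C x -> wcont I (f x).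
Proof.
move=> cf Cx; apply: (wcont_precomp cf (g := fun t : R => (x, t))) => //.
by apply: continuous_pairing => t; [exact: cvg_cst|exact: cvg_id].
Qed.

Variables (Omega : set V) (T : R).
Hypothesis oO : open Omega.

(** The Neumann condition holds at each time separately, whereas integrating the equation of [v]
    needs it uniformly in time. The normal component [Gam] of the gradient extends continuously to
    [x], vanishes there, and is therefore uniformly small near [x] by compactness of [[delta, T]];
    [delta > 0] because regularity is known for positive times only. *)
Lemma normal_quotient_uniform (m : V -> R -> R) x nu delta om :
  classical Omega T m ->
  (forall t, 0 < t <= T -> zero_normal_derivative Omega (m ^~ t)) ->
  boundary Omega x -> exterior_normal Omega x nu -> enorm nu = 1 -> inward Omega x nu ->
  0 < delta <= T -> 0 < om ->
  exists2 d, 0 < d & forall h h' s, 0 < h' < h -> h < d -> delta <= s <= T ->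
    `|m (x - h' *: nu) s - m (x - h *: nu) s| <= om * (h - h').
Proof.
move=> cl neu bx ex n1 [e0 e00 inw] /andP[de0 deT] om0.
have cx : closure Omega x by case: bx.
have [g hg] : exists g : 'I_N -> V -> R -> R, forall i,
    wcont (closure Omega `*` [set t | 0 < t <= T]) (fun p : V * R => g i p.1 p.2) /\
    forall y t, Omega y -> 0 < t <= T -> g i y t = partial i (m ^~ t) y.
  have [g hg] := choice (classical_gradient_bdry cl); exists g => i.
  by have [/wcontP h1 h2] := hg i.
pose Gam y s := \sum_i nu 0 i * g i y s.
have cG : wcont (closure Omega `*` [set t | 0 < t <= T]) (fun p : V * R => Gam p.1 p.2).
  apply: wcont_sum => i; apply: wcont_mul; first exact: wcont_cst.
  exact: (hg i).1.
have dG h s : 0 < h < e0 -> 0 < s <= T ->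
    is_derive h 1 (fun r => m (x - r *: nu) s) (- Gam (x - h *: nu) s).
  move=> hh ss; have Oh := inw h hh.
  have C := Ck_on_C2on oO (classical_space_derivable cl ss).
  have Oh' : Omega (h *: (- nu) + x) by rewrite scalerN addrC.
  have [d _] := C2on_line_at C Oh'.
  rewrite (_ : (fun r => m (x - r *: nu) s) = (fun s0 => m (s0 *: - nu + x) s)); last first.
    by apply/funext => r; rewrite scalerN addrC.
  apply: (is_derive_eq d); rewrite /gr /Gam -sumrN; apply: eq_bigr => i _.
  by rewrite mxE mulNr (hg i).2 // scalerN addrC.
have mvt h h' s : 0 < h' < h -> h < e0 -> 0 < s <= T ->
    exists2 xi, 0 < xi < h & m (x - h *: nu) s - m (x - h' *: nu) s = - Gam (x - xi *: nu) s * (h - h').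
  move=> /andP[h'0 h'h] he ss.
  have [|xi /andP[x1 x2] E] := @mean_value _ (fun r => m (x - r *: nu) s)
     (fun r => - Gam (x - r *: nu) s) h' h h'h.
    by move=> r /andP[r0 r1]; apply: dG => //; apply/andP; split; arith.
  by exists xi => //; apply/andP; split; arith.
have dist h : 0 < h -> enorm (x - h *: nu - x) = h.
  by move=> h0; rewrite addrAC subrr add0r enormN enormZ n1 mulr1 gtr0_norm.
have cc h : 0 < h < e0 -> closure Omega (x - h *: nu).
  by move=> /inw; exact: subset_closure.
(* The Neumann condition speaks of a quotient at [x], the extension of values inside. The mean value
   theorem between depths [h'] and [h], with [h'] tending to 0, links them: a value [c] other than 0
   would force a quotient of at least half its size. *)
have G0 s : 0 < s <= T -> Gam x s = 0.
  move=> ss; apply: contrapT => /eqP c0; set c := Gam x s in c0.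
  have ac : 0 < `|c| by rewrite normr_gt0.
  have ac2 : 0 < `|c| / 2 by rewrite divr_gt0.
  have [d1 d10 hd1] := wcont_eps cG cx ss ac2.
  have ac4 : 0 < `|c| / 4 by rewrite divr_gt0.
  have [d2 d20 hd2] := normal_derivative_eps (neu s ss) bx ex ac4.
  pose h := Num.min (Num.min d1 d2) e0 / 2.
  have mn : 0 < Num.min (Num.min d1 d2) e0 by rewrite !lt_min d10 d20.
  have [m1 m2 m3] : [/\ Num.min (Num.min d1 d2) e0 <= d1, Num.min (Num.min d1 d2) e0 <= d2 &
     Num.min (Num.min d1 d2) e0 <= e0] by rewrite !ge_min !lexx !orbT.
  have [h0 hh1 hh2 hh3] : [/\ 0 < h, h < d1, h < d2 & h < e0] by exact: half_lt3 mn m1 m2 m3.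
  have key e : 0 < e -> `|c * h| <= `|c| / 2 * h + `|c| / 4 * h + e.
    move=> e_0; pose e1 := e / (2 * `|c| + 1).
    have D0 : 0 < 2 * `|c| + 1 by clear -ac; lra.
    have e10 : 0 < e1 by rewrite divr_gt0.
    pose h' := Num.min h e1 / 2.
    have mn' : 0 < Num.min h e1 by rewrite !lt_min h0.
    have [m1' m2'] : Num.min h e1 <= h /\ Num.min h e1 <= e1 by rewrite !ge_min !lexx !orbT.
    have [h'0 h'1 h'2] : [/\ 0 < h', h' < h & h' < e1] by rewrite /h'; clear -mn' m1' m2'; split; arith.
    have [|||xi /andP[xi0 xi1] E] := mvt h h' s; rewrite ?h'0 //.
    have xe : 0 < xi < e0 by rewrite xi0; clear -xi1 hh3; lra.
    have G1 : `|Gam (x - xi *: nu) s - c| < `|c| / 2.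
      apply: hd1 => //; first exact: cc.
        by rewrite dist //; exact: lt_trans hh1.
      by rewrite subrr normr0.
    have N1 : `|m x s - m (x - h *: nu) s| <= `|c| / 4 * h by apply: hd2; rewrite h0.
    have N2 : `|m x s - m (x - h' *: nu) s| <= `|c| / 4 * h'.
      by apply: hd2; rewrite h'0; exact: lt_trans hh2.
    have ee : e1 * (2 * `|c| + 1) = e by rewrite /e1 divfK // gt_eqF.
    have E2 : c * h = (m (x - h' *: nu) s - m x s) + (m x s - m (x - h *: nu) s)
       - (Gam (x - xi *: nu) s - c) * (h - h') + c * h'.
      by have : m (x - h *: nu) s - m (x - h' *: nu) s = - Gam (x - xi *: nu) s * (h - h') := E; arith.
    have N3 : `|(Gam (x - xi *: nu) s - c) * (h - h')| <= `|c| / 2 * h.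
      rewrite normrM; apply: ler_pM => //; first exact: ltW.
      by rewrite ger0_norm; clear -h'0 h'1; lra.
    have N4 : `|c * h'| = `|c| * h' by rewrite normrM (gtr0_norm h'0).
    have N5 : `|c| * h' <= `|c| * e1 by rewrite ler_wpM2l // ltW.
    have N6 : 0 <= `|c| * e1 by rewrite mulr_ge0 // ltW.
    rewrite E2; apply: le_trans (ler_normD _ _) _; rewrite N4.
    have T1 := ler_normB ((m (x - h' *: nu) s - m x s) + (m x s - m (x - h *: nu) s))
      ((Gam (x - xi *: nu) s - c) * (h - h')).
    have T2 := ler_normD (m (x - h' *: nu) s - m x s) (m x s - m (x - h *: nu) s).
    rewrite [`|m (x - h' *: nu) s - m x s|]distrC in T2.
    move: T1 T2 N1 N2 N3; set a1 := `|_ - _ * _|; set a2 := `|_ + _|; set a3 := `|_ * _|.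
    set a4 := `|m x s - _|; set a5 := `|m x s - _|.
    set k := `|c| in ac ee N5 N6 *; clear -ac ee N5 N6 e10; move=> *; arith.
  have : `|c * h| <= `|c| / 2 * h + `|c| / 4 * h by apply/ler_addgt0Pr => e; exact: key.
  rewrite normrM (gtr0_norm h0); have := mulr_gt0 ac h0; clear; lra.
have : compact [set s : R | delta <= s <= T].
  rewrite (_ : [set s | _] = `[delta, T]%classic); first exact: segment_compact.
  by apply/seteqP; split=> s /=; rewrite in_itv.
move=> /compact_near_coveringP hcov.
have /nbhs_realP[d d0 hd] : \forall h \near (0 : R), forall s, delta <= s <= T ->
    0 < h < e0 -> delta <= s <= T -> `|Gam (x - h *: nu) s| < om.
  apply: (hcov R (nbhs (0 : R)) (fun h s => 0 < h < e0 -> delta <= s <= T ->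
    `|Gam (x - h *: nu) s| < om)).
  move=> s /andP[s1 s2]; have ss : 0 < s <= T by rewrite s2 (lt_le_trans de0 s1).
  have [d d0 hd] := wcont_eps cG cx ss om0.
  exists ([set r : R | `|r - s| < d], [set h : R | `|h - 0| < d]).
    by split; apply/nbhs_realP; exists d.
  move=> [r h] /= [rd hd'] he /andP[r0 r1]; rewrite subr0 in hd'.
  have h0 : 0 < h by case/andP: he.
  have := hd (x - h *: nu) r (cc h he); rewrite G0 // subr0; apply.
  - by rewrite /= r1 (lt_le_trans de0 r0).
  - by rewrite dist //; apply: le_lt_trans hd'; exact: ler_norm.
  - by [].
exists (Num.min d e0) => [|h h' s hh]; first by rewrite lt_min d0.
rewrite lt_min => /andP[h1 h2] ss; case/andP: (hh) => h'0 h'h.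
have ss' : 0 < s <= T by case/andP: ss => s1 s2; rewrite s2 (lt_le_trans de0 s1).
have [xi /andP[x0 x1] E] := mvt h h' s hh h2 ss'.
rewrite distrC E normrM normrN (ger0_norm (x := h - h')) ?subr_ge0 ?(ltW h'h) //.
apply: ler_wpM2r; first by rewrite subr_ge0 ltW.
apply/ltW; apply: (hd xi) => //.
  by rewrite subr0 gtr0_norm //; exact: lt_trans h1.
by rewrite x0; exact: lt_trans h2.
Qed.

End Haptotaxis.

Lemma chain_estimate (R : realDomainType) (A B C A0 B0 C0 d p q : R) :
  `|C - A| < d -> `|C0 - A0| < d -> `|C - B| <= `|C0 - B0| + p -> `|A0 - B0| <= q ->
  `|A - B| <= p + q + (d + d).
Proof.
move=> b1 b2 b3 b4; have := ler_distD C A B; have := ler_distD A0 C0 B0.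
by rewrite (distrC A C); lra.
Qed.

(** * Bounds, Lipschitz estimate and Neumann condition for the attractant *)

Section Attractant.
Context {R : realType} {N : nat}.
Notation V := 'rV[R]_N.
Implicit Types (x y z nu : V).
Variables (Omega : set V) (T lambda L Vm : R) (m v : V -> R -> R).
Hypothesis oO : open Omega.
Hypothesis l0 : 0 < lambda.
Hypothesis L0 : 0 <= L.
Hypothesis Vm0 : 0 <= Vm.
Hypothesis vc : wcont (closure Omega `*` [set t | 0 <= t <= T]) (fun p : V * R => v p.1 p.2).
Hypothesis veq : forall x t, Omega x -> 0 < t <= T ->
  left_derive (v x) t (- lambda * m x t * v x t).
Hypothesis m0 : forall x t, Omega x -> 0 <= t <= T -> 0 <= m x t.
Hypothesis v0 : forall x t, Omega x -> 0 <= t <= T -> 0 <= v x t.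
Hypothesis vVm : forall x, Omega x -> v x 0 <= Vm.

Let vsec x t : Omega x -> t <= T -> wcont [set s | 0 <= s <= t] (v x).
Proof.
move=> Ox tT; have := wcont_section vc (subset_closure Ox).
by apply: wcont_subset => s /= /andP[s0 st]; rewrite s0 (le_trans st).
Qed.

Lemma attractant_le x t : Omega x -> 0 <= t <= T -> v x t <= v x 0.
Proof.
move=> Ox tt; have := @left_growth _ T 0 (v x 0) (v x) (vsec Ox (lexx T)) (lexx _).
rewrite -[X in _ -> _ <= X]addr0 -[X in _ -> _ <= _ + X](mul0r t); apply=> // s ss _.
exists (- lambda * m x s * v x s); first exact: veq.
have ss' : 0 <= s <= T by case/andP: ss => /ltW -> ->.
by rewrite -mulrA mulNr oppr_le0 !mulr_ge0 ?m0 ?v0 // ltW.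
Qed.

Lemma attractant_bounds x t : Omega x -> 0 <= t <= T -> 0 <= v x t <= Vm.
Proof. by move=> Ox tt; rewrite v0 // (le_trans (attractant_le Ox tt)) ?vVm. Qed.

Lemma attractant_comparison x y a t D : Omega x -> Omega y -> 0 <= a -> a <= t -> t <= T ->
  0 <= D -> (forall s, a < s <= t -> `|m x s - m y s| <= D) ->
  `|v x t - v y t| <= `|v x a - v y a| + lambda * Vm * D * (t - a).
Proof.
have half x' y' : Omega x' -> Omega y' -> 0 <= a -> a <= t -> t <= T ->
    0 <= D -> (forall s, a < s <= t -> `|m x' s - m y' s| <= D) ->
    v x' t - v y' t <= `|v x' a - v y' a| + lambda * Vm * D * (t - a).
  move=> Ox Oy a0 at_ tT D0 mD.
  apply: (@decay_comparison _ lambda a t Vm D _ _ (m x') (m y')) => //; try exact: vsec.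
  - by move=> s /andP[s0 st]; apply: veq => //; rewrite s0 (le_trans st).
  - by move=> s /andP[s0 st]; apply: veq => //; rewrite s0 (le_trans st).
  move=> s /andP[s0 st]; have ss : 0 <= s <= T.
    by rewrite (le_trans a0 (ltW s0)) (le_trans st).
  by rewrite m0 // attractant_bounds // mD // s0 st.
move=> Ox Oy a0 at_ tT D0 mD; rewrite ler_norml half // andbT.
have := half y x Oy Ox a0 at_ tT D0; rewrite (distrC (v y a)) => /(_ _) h.
have {}h : v y t - v x t <= `|v x a - v y a| + lambda * Vm * D * (t - a).
  by apply: h => s ss; rewrite distrC; exact: mD.
by lra.
Qed.

Hypothesis mL : forall x y t, Omega x -> Omega y -> 0 <= t <= T ->
  `|m x t - m y t| <= L * enorm (x - y).

Lemma attractant_lipschitz x y t : Omega x -> Omega y -> 0 <= t <= T ->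
  `|v x t - v y t| <= `|v x 0 - v y 0| + lambda * Vm * (L * enorm (x - y)) * t.
Proof.
move=> Ox Oy /andP[t0 tT]; rewrite -[X in _ <= _ + _ * X]subr0.
apply: attractant_comparison => //; first exact: mulr_ge0.
by move=> s /andP[s0 st]; apply: mL => //; rewrite (ltW s0) (le_trans st).
Qed.

(** The condition is transported from time 0 by the equation of [v], with error [e / 3] each from
    the initial datum, from the times up to [del] and from the times after [del], where the normal
    quotients of [m] are uniformly small. *)
Lemma attractant_neumann x nu t e : classical Omega T m ->
  (forall t, 0 < t <= T -> zero_normal_derivative Omega (m ^~ t)) ->
  boundary Omega x -> exterior_normal Omega x nu -> enorm nu = 1 -> inward Omega x nu ->
  (forall e, 0 < e -> exists2 d, 0 < d & forall h, 0 < h < d ->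
     `|v x 0 - v (x - h *: nu) 0| <= e * h) ->
  0 < t <= T -> 0 < e ->
  exists2 d, 0 < d & forall h, 0 < h < d -> `|v x t - v (x - h *: nu) t| <= e * h.
Proof.
move=> cl neu bx ex n1 inw hv0 /andP[t0 tT] e0; have [e1 e10 he1] := inw.
have cx : closure Omega x by case: bx.
pose c1 := lambda * Vm * L; pose c2 := lambda * Vm * T.
have T0 : 0 < T by exact: lt_le_trans tT.
have c10 : 0 <= c1 by rewrite /c1 !mulr_ge0 // ltW.
have c20 : 0 <= c2 by rewrite /c2 !mulr_ge0 // ltW.
(* Before [del] only the Lipschitz constant [L] of [m] is available; the layer is short enough for
   that to cost at most [e / 3 * h]. *)
pose del := Num.min t (e / (3 * (c1 + 1))).
have del0 : 0 < del.
  by rewrite lt_min t0 divr_gt0 // mulr_gt0 // ltr_wpDl.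
have delt : del <= t by rewrite ge_min lexx.
have delc : c1 * del <= e / 3.
  apply: (@le_trans _ _ ((c1 + 1) * (e / (3 * (c1 + 1))))).
    apply: ler_pM => //; [exact: ltW|by rewrite lerDl|by rewrite ge_min lexx orbT].
  by rewrite le_eqVlt; apply/orP; left; apply/eqP; field; lra.
pose om := e / (3 * (c2 + 1)).
have om0 : 0 < om by rewrite divr_gt0 // mulr_gt0 // ltr_wpDl.
have omc : c2 * om <= e / 3.
  apply: (@le_trans _ _ ((c2 + 1) * om)); first by apply: ler_wpM2r; [exact: ltW|rewrite lerDl].
  by rewrite le_eqVlt; apply/orP; left; apply/eqP; rewrite /om; field; lra.
have dT : 0 < del <= T by rewrite del0 (le_trans delt).
have [d1 d10 hd1] := normal_quotient_uniform oO cl neu bx ex n1 inw dT om0.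
have e30 : 0 < e / 3 by rewrite divr_gt0.
have [d2 d20 hd2] := hv0 _ e30.
exists (Num.min d1 (Num.min d2 e1)) => [|h]; first by rewrite !lt_min d10 d20.
rewrite !lt_min => /andP[h0 /andP[h1 /andP[h2 h3]]].
have Oh : Omega (x - h *: nu) by apply: he1; rewrite h0.
have step h' : 0 < h' < h -> `|v (x - h' *: nu) t - v (x - h *: nu) t| <=
    `|v (x - h' *: nu) 0 - v (x - h *: nu) 0| + 2 * (e / 3) * h.
  move=> /andP[h'0 h'h].
  have Oh' : Omega (x - h' *: nu) by apply: he1; rewrite h'0 (lt_trans h'h).
  have hh : 0 < h - h' by rewrite subr_gt0.
  have E : enorm (x - h' *: nu - (x - h *: nu)) = h - h'.
    have -> : x - h' *: nu - (x - h *: nu) = (h - h') *: nu.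
      by rewrite scalerBl opprB addrC addrA subrK.
    by rewrite enormZ n1 mulr1 gtr0_norm.
  have s1 := attractant_lipschitz Oh' Oh (t := del); rewrite (ltW del0) (le_trans delt tT) E in s1.
  have s2 : `|v (x - h' *: nu) t - v (x - h *: nu) t| <=
     `|v (x - h' *: nu) del - v (x - h *: nu) del| + lambda * Vm * (om * (h - h')) * (t - del).
    apply: attractant_comparison => //; first exact: ltW.
      by rewrite mulr_ge0 // ltW.
    by move=> s /andP[sa sb]; apply: hd1; rewrite ?h'0 // (ltW sa) (le_trans sb).
  apply: le_trans s2 _; apply: le_trans (lerD (s1 isT) (lexx _)) _.
  rewrite -addrA; apply: lerD => //.
  have a1 : lambda * Vm * (L * (h - h')) * del <= e / 3 * h.
    rewrite (_ : _ * _ * _ * _ = c1 * del * (h - h')); last by rewrite /c1; ring.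
    by apply: ler_pM => //; [rewrite mulr_ge0 // ltW|exact: ltW|rewrite gerBl ltW].
  have a2 : lambda * Vm * (om * (h - h')) * (t - del) <= e / 3 * h.
    apply: (@le_trans _ _ (c2 * om * (h - h'))).
      rewrite (_ : c2 * om * _ = lambda * Vm * (om * (h - h')) * T); last by rewrite /c2; ring.
      have p1 := ltW l0; have p2 := ltW om0; have p3 := ltW hh.
      apply: ler_wpM2l; first by apply: mulr_ge0; apply: mulr_ge0.
      by lra.
    by apply: ler_pM => //; [rewrite mulr_ge0 // ltW|exact: ltW|rewrite gerBl ltW].
  lra.
(* The equation of [v] is known inside [Omega] only, so [step] compares two inner points; letting
   the depth [h'] tend to 0 reaches [x] by continuity up to the boundary. *)
apply/ler_addgt0Pr => e' e'0.
have e'2 : 0 < e' / 2 by rewrite divr_gt0.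
have It : [set s | 0 <= s <= T] t by rewrite /= (ltW t0).
have I0 : [set s | 0 <= s <= T] 0 by rewrite /= lexx ltW.
have [d3 d30 hd3] := wcont_eps vc cx It e'2.
have [d4 d40 hd4] := wcont_eps vc cx I0 e'2.
pose h' := Num.min h (Num.min d3 d4) / 2.
have mn : 0 < Num.min h (Num.min d3 d4) by rewrite !lt_min h0 d30.
have [m1 m2 m3] : [/\ Num.min h (Num.min d3 d4) <= h, Num.min h (Num.min d3 d4) <= d3 &
   Num.min h (Num.min d3 d4) <= d4] by rewrite !ge_min !lexx !orbT.
have [h'0 h'1 h'2 h'3] : [/\ 0 < h', h' < h, h' < d3 & h' < d4].
  exact: half_lt3 mn m1 m2 m3.
have ch' : closure Omega (x - h' *: nu).
  by apply/subset_closure/he1; rewrite h'0 (lt_trans h'1).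
have dx : enorm (x - h' *: nu - x) = h'.
  by rewrite addrAC subrr add0r enormN enormZ n1 mulr1 gtr0_norm.
have b1 := hd3 _ t ch' It; rewrite dx subrr normr0 in b1; have {}b1 := b1 h'2 d30.
have b2 := hd4 _ 0 ch' I0; rewrite dx subrr normr0 in b2; have {}b2 := b2 h'3 d40.
have b3 := step h' _; rewrite h'0 h'1 in b3; have {}b3 := b3 isT.
have b4 := hd2 h _; rewrite h0 h2 in b4; have {}b4 := b4 isT.
rewrite (_ : e * h + e' = 2 * (e / 3) * h + e / 3 * h + (e' / 2 + e' / 2)); last by field.
exact: chain_estimate b1 b2 b3 b4.
Qed.

End Attractant.

(** * Comparison principle *)

Section Flat.
Context {R : realType} {N : nat}.
Notation V := 'rV[R]_N.
Implicit Types (x y z nu : V) (f g : V -> R).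

(** A vanishing one-sided normal derivative along one fixed direction, in a form that sums, products
    and compositions preserve. *)
Definition flat f x nu := forall e, 0 < e -> exists2 d, 0 < d &
  forall h, 0 < h < d -> `|f x - f (x - h *: nu)| <= e * h.

Lemma flat_comp f x nu (phi : R -> R) a : is_derive (f x) 1 phi a -> flat f x nu ->
  flat (fun y => phi (f y)) x nu.
Proof.
move=> /is_derive_epsP dphi fl e e0.
have [d d0 hd] := dphi 1 ltr01.
pose C := `|a| + 1; have C0 : 0 < C by rewrite ltr_wpDl.
have lip (y : R) : `|y - f x| < d -> `|phi y - phi (f x)| <= C * `|y - f x|.
  move=> yd; have [->|yx] := eqVneq y (f x); first by rewrite !subrr normr0 mulr0.
  have yx0 : y - f x != 0 by rewrite subr_eq0.
  have := hd (y - f x) yx0 yd; rewrite [_%:A]mulr1 subrK => h.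
  have : `|(y - f x)^-1 * (phi y - phi (f x))| <= C.
    have := ler_normD ((y - f x)^-1 * (phi y - phi (f x)) - a) a; rewrite subrK /C; lra.
  by rewrite normrM normfV mulrC ler_pdivrMr ?normr_gt0.
have ec : 0 < e / C by rewrite divr_gt0.
have [d1 d10 hd1] := fl _ ec; have [d2 d20 hd2] := fl 1 ltr01.
exists (Num.min d1 (Num.min d2 d)) => [|h]; first by rewrite !lt_min d10 d20.
rewrite !lt_min => /andP[h0 /andP[h1 /andP[h2 h3]]].
have b1 : `|f x - f (x - h *: nu)| <= e / C * h by apply: hd1; rewrite h0.
have b2 : `|f x - f (x - h *: nu)| <= 1 * h by apply: hd2; rewrite h0.
rewrite distrC in b1; rewrite distrC in b2; rewrite distrC.
apply: le_trans (lip _ _) _; first by rewrite mul1r in b2; exact: le_lt_trans h3.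
have -> : e * h = C * (e / C * h) by rewrite mulrA mulrCA divff ?mulr1 // gt_eqF.
by rewrite ler_pM2l.
Qed.

Lemma flat_add f g x nu : flat f x nu -> flat g x nu -> flat (fun y => f y + g y) x nu.
Proof.
move=> ff fg e e0; have e2 : 0 < e / 2 by rewrite divr_gt0.
have [d1 d10 hd1] := ff _ e2; have [d2 d20 hd2] := fg _ e2.
exists (Num.min d1 d2) => [|h]; first by rewrite !lt_min d10.
rewrite !lt_min => /andP[h0 /andP[h1 h2]].
have b1 : `|f x - f (x - h *: nu)| <= e / 2 * h by apply: hd1; rewrite h0.
have b2 : `|g x - g (x - h *: nu)| <= e / 2 * h by apply: hd2; rewrite h0.
rewrite opprD addrACA; apply: le_trans (ler_normD _ _) _; lra.
Qed.

Lemma flat_scale c f x nu : flat f x nu -> flat (fun y => c * f y) x nu.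
Proof.
by move=> ff; apply: (flat_comp (phi := fun r => c * r)) ff; exact: is_derive_scalef (is_derive_id _ _).
Qed.

(** Polarisation reduces a product to two squares, hence to [flat_comp], so no bounds on the factors
    are needed. *)
Lemma flat_mul f g x nu : flat f x nu -> flat g x nu -> flat (fun y => f y * g y) x nu.
Proof.
move=> ff fg.
have E : (fun y => f y * g y) = (fun y => 4^-1 * ((f y + g y) * (f y + g y)) +
    (- 4^-1) * ((f y + -1 * g y) * (f y + -1 * g y))).
  by apply/funext => y; field.
have sq (r : R) : is_derive r 1 (fun s => s * s) (1 * r + r * 1).
  by apply: is_derive_mulf; exact: is_derive_id.
rewrite E; apply: flat_add; apply: flat_scale.
  exact: (flat_comp (f := fun y => f y + g y) (phi := fun s => s * s) (sq _) (flat_add ff fg)).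
exact: (flat_comp (f := fun y => f y + -1 * g y) (phi := fun s => s * s) (sq _)
  (flat_add ff (flat_scale (-1) fg))).
Qed.

Lemma zero_normal_flat Omega f x nu : zero_normal_derivative Omega f -> boundary Omega x ->
  exterior_normal Omega x nu -> flat f x nu.
Proof. by move=> zf bx ex e e0; exact: normal_derivative_eps zf bx ex e0. Qed.

Lemma touch_contradiction (A A' B k : R) : A' <= A - k -> B - A' <= 0 -> A - B <= k / 2 ->
  0 < k -> False.
Proof. by move=> *; lra. Qed.

End Flat.

Section Comparison.
Context {R : realType} {N : nat}.
Notation V := 'rV[R]_N.
Implicit Types (x y z nu : V).
Variables (Omega : set V) (T lambda alpha : R) (chi : R -> R) (u0 v0 m0 : V -> R) (eps : R)
  (u v m : V -> R -> R).
Hypothesis hOmega : smooth_bounded_domain Omega.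
Hypothesis hchi : admissible_sensitivity chi.
Hypothesis sol : solution Omega T lambda alpha chi u0 v0 m0 eps u v m.
Variables (g : V -> R) (Gg Hg : V -> V -> R).
Hypothesis gC : C2on Omega g Gg Hg.
Hypothesis gc : wcont (closure Omega) g.
Hypothesis gN : forall x nu, boundary Omega x -> exterior_normal Omega x nu -> flat g x nu.
Variable t1 : R.
Hypothesis t1T : t1 <= T.
Hypothesis vN : forall x nu t, boundary Omega x -> exterior_normal Omega x nu -> 0 < t <= t1 ->
  flat (v ^~ t) x nu.

Let oO : open Omega. Proof. by case: hOmega. Qed.
Let bO : bounded_set Omega. Proof. by case: hOmega. Qed.

Lemma chi_derive (z : R) : is_derive z 1 chi (chi^`()%classic z) /\
  is_derive z 1 (chi^`()%classic) (chi^`(2)%classic z).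
Proof.
have [d _] := hchi.
have d0 := d 0%N z; have d1 := d 1%N z; rewrite derive1n0 in d0; rewrite derive1n1 in d1.
split; first by rewrite derive1E; exact: (derivableP d0).
by rewrite derive1nS derive1n1 derive1E; exact: (derivableP d1).
Qed.

(** Used with [g = 0] for the first bound on [u], and with [g = chi(v0)] for the barriers, where it
    agrees with [u] at time 0. *)
Definition tilde x t := u x t * expR (g x - chi (v x t)).

Definition drift x t i := gr (fun y => chi (v y t)) x (basis_vec i).

(* Right-hand side of the equation satisfied by [tilde], with [tilde] replaced
   by a function with value w, gradient Gw and pure second derivatives Hw. *)
Definition tilde_rhs x t w (Gw Hw : V -> R) : R :=
  \sum_i (Hw (basis_vec i) + (drift x t i - 2 * Gg x (basis_vec i)) * Gw (basis_vec i)
    - w * (Hg x (basis_vec i) + (drift x t i - Gg x (basis_vec i)) * Gg x (basis_vec i)))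
  + w * (lambda * (chi^`()%classic (v x t) * (m x t * v x t)))
  + eps ^- 2 * (expR (g x - chi (v x t)) * bistable (expR (chi (v x t) - g x) * w)).

Lemma chiv_C2 t : 0 < t <= T -> C2on Omega (fun x => chi (v x t))
  (fun x p => chi^`()%classic (v x t) * gr (v ^~ t) x p)
  (fun x p => chi^`(2)%classic (v x t) * gr (v ^~ t) x p ^+ 2 +
     chi^`()%classic (v x t) * he (v ^~ t) x p).
Proof.
move=> tt; apply: C2on_comp; last by move=> x _; exact: chi_derive.
exact: Ck_on_C2on oO (classical_space_derivable (sol_v_classical sol) tt).
Qed.

Lemma chiv_gr x t p : 0 < t <= T -> Omega x ->
  gr (fun y => chi (v y t)) x p = chi^`()%classic (v x t) * gr (v ^~ t) x p.
Proof.
move=> tt Ox; rewrite /gr mulr_sumr; apply: eq_bigr => k _; rewrite mulrCA; congr (_ * _).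
have [[_ h] _] := chiv_C2 tt Ox (basis_vec k).
by rewrite /partial h gr_basis.
Qed.

(** The product rule, applied after replacing the gradient of chi(v) by its chain-rule expression on
    a neighbourhood of [x]. The terms with [he] of [v] are those that [comparison] has to
    eliminate. *)
Lemma flux_divergence x t : 0 < t <= T -> Omega x ->
  divergence (fun y => u y t *: gradient (fun z => chi (v z t)) y) x =
  \sum_i (gr (u ^~ t) x (basis_vec i) * drift x t i + u x t *
     (chi^`(2)%classic (v x t) * gr (v ^~ t) x (basis_vec i) ^+ 2 +
     chi^`()%classic (v x t) * he (v ^~ t) x (basis_vec i))).
Proof.
move=> tt Ox; apply: eq_bigr => i _; rewrite /partial.
have uC := Ck_on_C2on oO (classical_space_derivable (sol_u_classical sol) tt).
have [du _] := uC x Ox (basis_vec i).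
have [_ dc] := chiv_C2 tt Ox (basis_vec i).
have d := is_derive_mulf du dc.
rewrite /drift chiv_gr //.
have [_ <-] := d; apply: near_eq_derive.
have : \forall y \near x, Omega y by exact: open_nbhs_nbhs.
apply: filterS => y Oy; rewrite !mxE; congr (_ * _).
by have [[_ h] _] := chiv_C2 tt Oy (basis_vec i); rewrite /partial h.
Qed.

Lemma tilde_wcont : wcont (closure Omega `*` [set t | 0 <= t <= t1])
  (fun p : V * R => tilde p.1 p.2).
Proof.
have sub : closure Omega `*` [set t | 0 <= t <= t1] `<=` closure Omega `*` [set t | 0 <= t <= T].
  by move=> p [h1 /= /andP[h2 h3]]; split=> //=; rewrite h2 (le_trans h3).
have /wcontP/(wcont_subset sub) uc := classical_cont (sol_u_classical sol).
have /wcontP/(wcont_subset sub) vc := classical_cont (sol_v_classical sol).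
apply: wcont_mul => //; apply: (wcont_real (phi := expR)); last first.
  by move=> p _; exact: continuous_expR.
apply: wcont_sub.
  by apply: (wcont_precomp gc (g := fun p : V * R => p.1)) => [p|p []//]; exact: cvg_fst.
by apply: (wcont_real vc) => p _; exact: is_derive_continuous (chi_derive _).1.
Qed.

(* The second derivatives of v in the flux are absorbed by the factor
   exp(g - chi(v)): only the gradient of chi(v) enters [tilde_rhs]. *)
Lemma comparison (sigma : R) (W Wt : V -> R -> R) (GW HW : R -> V -> V -> R) : sigma != 0 ->
  wcont (closure Omega `*` [set t | 0 <= t <= t1]) (fun p : V * R => W p.1 p.2) ->
  (forall t, 0 < t <= t1 -> C2on Omega (W ^~ t) (GW t) (HW t)) ->
  (forall x t, Omega x -> 0 < t <= t1 -> is_derive t 1 (W x) (Wt x t)) ->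
  (forall x, closure Omega x -> sigma * (tilde x 0 - W x 0) < 0) ->
  (forall x nu t, boundary Omega x -> exterior_normal Omega x nu -> 0 < t <= t1 ->
    exists c d, [/\ 0 < c, 0 < d & forall h, 0 < h < d ->
      sigma * W (x - h *: nu) t <= sigma * W x t - c * h]) ->
  (forall x t, Omega x -> 0 < t <= t1 -> tilde x t = W x t ->
    sigma * tilde_rhs x t (W x t) (GW t x) (HW t x) < sigma * Wt x t) ->
  forall x t, closure Omega x -> 0 <= t <= t1 -> sigma * (tilde x t - W x t) < 0.
Proof.
move=> s0 Wc WC Wd Winit Wbd Wint.
apply: (first_touch (bounded_closure_compact bO)) => //.
  by apply: wcont_mul; [exact: wcont_cst|apply: wcont_sub => //; exact: tilde_wcont].
move=> x t cx tt Fx Fle Fb.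
have tT : 0 < t <= T by case/andP: tt => h1 h2; rewrite h1 (le_trans h2).
have tW : tilde x t = W x t.
  by apply/eqP; rewrite -subr_eq0; move/eqP: Fx; rewrite mulf_eq0 (negbTE s0).
have [Ox|bx] := closure_open_cases oO cx; last first.
  have [nu ex] := boundary_normal hOmega bx.
  have [psi [n [H [B [c0 df]]]]] := defining_function_exists hOmega.
  have [_ _ [e0 e00 inw]] := exterior_normalP oO df bx ex.
  (* All ingredients of [tilde] are flat at [x], while [sigma * W] drops by [c * h] at depth [h]; so
     [sigma * (tilde - W)] would be positive just inside, and a boundary point cannot be the first
     contact. *)
  have [c [d [c_0 d0 hd]]] := Wbd x nu t bx ex tt.
  have fu : flat (u ^~ t) x nu := zero_normal_flat (sol_u_neumann sol tT) bx ex.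
  have fchi : flat (fun y => chi (v y t)) x nu := flat_comp (chi_derive _).1 (vN bx ex tt).
  have ft : flat (tilde ^~ t) x nu.
    apply: flat_mul => //; apply: (flat_comp (f := fun y => g y - chi (v y t))).
    have E : (fun y => g y - chi (v y t)) = (fun y => g y + -1 * chi (v y t)).
      by apply/funext => y; rewrite mulN1r.
    by rewrite E; apply: flat_add; [exact: gN|exact: flat_scale].
  have [d' d'0 hd'] := flat_scale sigma ft (divr_gt0 c_0 (ltr0n _ 2)).
  pose h := Num.min (Num.min d d') e0 / 2.
  have mn : 0 < Num.min (Num.min d d') e0 by rewrite !lt_min d0 d'0.
  have [m1 m2 m3] : [/\ Num.min (Num.min d d') e0 <= d, Num.min (Num.min d d') e0 <= d' &
     Num.min (Num.min d d') e0 <= e0] by rewrite !ge_min !lexx !orbT.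
  have [h0 hh1 hh2 hh3] : [/\ 0 < h, h < d, h < d' & h < e0].
    exact: half_lt3 mn m1 m2 m3.
  have ch : closure Omega (x - h *: nu) by apply/subset_closure/inw; rewrite h0.
  have b1 := hd h; rewrite h0 hh1 in b1; have {}b1 := b1 isT.
  have b2 := hd' h; rewrite h0 hh2 in b2; have {}b2 := b2 isT.
  have b3 := Fle _ ch; have ch0 : 0 < c * h by exact: mulr_gt0.
  have b4 := le_trans (ler_norm _) b2.
  by apply: (touch_contradiction (B := sigma * tilde (x - h *: nu) t) b1 _ _ ch0); [rewrite -mulrBr|rewrite tW mulrAC in b4].
have uC := Ck_on_C2on oO (classical_space_derivable (sol_u_classical sol) tT).
have cC := chiv_C2 tT.
pose E y := expR (g y + -1 * chi (v y t)).
have tE y : tilde y t = u y t * E y by rewrite /tilde /E mulN1r.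
have EC : C2on Omega E _ _ := C2on_comp (phi := expR) (phi1 := expR) (phi2 := expR)
  (C2on_add gC (C2on_scale (-1) cC)) (fun x _ => conj (is_derive_expR _) (is_derive_expR _)).
have tC := C2on_scale sigma (C2on_add (C2on_mul uC EC) (C2on_scale (-1) (WC t tt))).
have Exy : E x = expR (g x - chi (v x t)) by rewrite /E mulN1r.
set c1 := chi^`()%classic (v x t); set c2 := chi^`(2)%classic (v x t).
(* Second derivative test along one basis vector. The first-order condition expresses the derivative
   of [W] through that of [u]; the second derivative of the factor [E] then reproduces exactly the
   terms of the flux that contain second derivatives of [v], and they cancel. *)
have key i : sigma * (E x * (he (u ^~ t) x (basis_vec i)
    - (gr (u ^~ t) x (basis_vec i) * drift x t i + u x t *
     (c2 * gr (v ^~ t) x (basis_vec i) ^+ 2 + c1 * he (v ^~ t) x (basis_vec i)))))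
  <= sigma * (HW t x (basis_vec i) + (drift x t i - 2 * Gg x (basis_vec i)) * GW t x (basis_vec i)
    - W x t * (Hg x (basis_vec i) + (drift x t i - Gg x (basis_vec i)) * Gg x (basis_vec i))).
  have [d d0 hd] := (open_enormP Omega).1 oO x Ox.
  set p := basis_vec i; have p1 : enorm p = 1 by exact: enorm_basis.
  have inO s : `|s| < d -> Omega (s *: p + x) by move=> sd; apply: hd; rewrite addrK enormZ p1 mulr1.
  have z0 : `|0 : R| < d by rewrite normr0.
  have [D2a D2b] := C2on_line_at tC (inO 0 z0).
  have [|] := second_derivative_test d0 (fun s sd => (C2on_line_at tC (inO s sd)).1) D2b.
    move=> s sd; rewrite scale0r add0r -!tE !mulN1r (Fx : sigma * (_ - _) = 0).
    exact: Fle (subset_closure (inO s sd)).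
  rewrite scale0r add0r /drift chiv_gr // -/c1 -/c2.
  set Gu := gr (u ^~ t) x p; set Hu := he _ x p; set Gv := gr (v ^~ t) x p; set Hv := he (v ^~ t) x p.
  set g1 := Gg x p; set g2 := Hg x p; set w1 := GW t x p; set w2 := HW t x p.
  rewrite -tW tE -/(E x); set e := E x; set U := u x t.
  clear -s0; move=> /eqP; rewrite mulf_eq0 (negbTE s0) /= => /eqP h1 h2.
  have w1E : w1 = Gu * e + U * (e * (g1 + -1 * (c1 * Gv))) by move: h1; lra.
  rewrite -subr_ge0; rewrite -oppr_ge0 in h2; apply: le_trans h2 _.
  by rewrite le_eqVlt; apply/orP; left; apply/eqP; rewrite w1E; ring.
have [zu dzu zuE] := is_time_derivative_left tT (sol_u_eq sol Ox tT).
have [zv dzv zvE] := is_time_derivative_left tT (sol_v_eq sol Ox tT).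
have tt0 : 0 < t <= t by case/andP: tT => -> _; rewrite lexx.
have zvt : zv t = v x t by exact: zvE.
have zut : zu t = u x t by exact: zuE.
have dchi : is_derive (zv t) 1 chi c1 by rewrite zvt; exact: (chi_derive _).1.
have dE : is_derive t 1 (fun r => expR (g x + -1 * chi (zv r)))
    (E x * (0 + -1 * (c1 * (- lambda * m x t * v x t)))).
  have h := is_derive_addf (@is_derive_const R R^o (g x) t 1)
     (is_derive_scalef (-1) (is_derive_comp_real dchi dzv)).
  have h2 := is_derive_comp_real (f := fun r => g x + -1 * chi (zv r)) (is_derive_expR _) h.
  by apply: (is_derive_eq h2); rewrite zvt.
have dF := is_derive_scalef sigma (is_derive_subf (is_derive_mulf dzu dE) (Wd x t Ox tt)).
have := is_derive_left_max dF; rewrite zut zvt -/(E x) => hF.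
have {}hF := hF _.
have : exists2 d, 0 < d & forall y : R, t - d < y < t ->
    sigma * (zu y * expR (g x + -1 * chi (zv y)) - W x y) <=
    sigma * (zu t * expR (g x + -1 * chi (zv t)) - W x t).
  exists t => [|s /andP[st0 st]]; first by case/andP: tt.
  rewrite subrr in st0.
  rewrite zut zvt -/(E x) -tE Fx zuE ?st0 ?(ltW st) // zvE ?st0 ?(ltW st) //.
  have := Fb x s cx; rewrite (ltW st0) st => /(_ isT) /ltW.
  by rewrite /tilde mulN1r.
rewrite zut zvt -/(E x) => /hF {}hF.
have := Wint x t Ox tt tW; apply/negP; rewrite -leNgt.
rewrite -subr_ge0; apply: le_trans hF _.
rewrite -subr_ge0 /tilde_rhs.
have S := ler_sum (index_enum 'I_N) (fun i (_ : true) => key i).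
rewrite -!mulr_sumr sumrB in S.
rewrite flux_divergence // -/c1 -/c2 -Exy.
have -> : expR (chi (v x t) - g x) * W x t = u x t.
  by rewrite -tW /tilde mulrCA -expRD addrA subrK subrr expR0 mulr1.
have lapE : \sum_i he (u ^~ t) x (basis_vec i) = laplacian (u ^~ t) x.
  by apply: eq_bigr => i _; exact: he_basis.
rewrite lapE in S.
move: S; set lap := laplacian _ x; set S1 := \sum_i (gr _ _ _ * _ + _); set S2 := \sum_i (HW _ _ _ + _ - _).
have WE : W x t = u x t * E x by rewrite -tW tE.
rewrite WE; set e := E x; set U := u x t; set f := bistable U; set k := eps ^- 2.
set mm := m x t; set vv := v x t; set wt := Wt x t.
clear => S; rewrite -subr_ge0 in S; apply: le_trans S _.
by rewrite le_eqVlt; apply/orP; left; apply/eqP; ring.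
Qed.

End Comparison.

(** * Bounds uniform in epsilon *)

Section DataBounds.
Context {R : realType} {N : nat}.
Notation V := 'rV[R]_N.
Implicit Types (f : V -> R).

Lemma wcont_bounded (T : topologicalType) (A : set T) (f : T -> R) : compact A -> wcont A f ->
  exists2 M, 0 < M & forall x, A x -> `|f x| <= M.
Proof.
move=> cA /wcontP cf; have /compact_bounded[M [_ hM]] : compact (f @` A) by exact: continuous_compact.
exists (Num.max M 0 + 1) => [|x Ax]; first by rewrite ltr_wpDl // le_max lexx orbT.
apply: (hM (Num.max M 0 + 1)); last by exists x.
by rewrite ltr_pwDr // le_max lexx.
Qed.

Lemma Ck_closure_bound Omega f : bounded_set Omega -> Ck_closure 2 Omega f ->
  exists2 M, 0 < M & (forall x, closure Omega x -> `|f x| <= M) /\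
    (forall x p, Omega x -> [/\ `|gr f x p| <= M * enorm p, `|he f x p| <= M * dot p p &
       forall k, `|gr (partial k f) x p| <= M * enorm p]).
Proof.
move=> bO [_ cf hext]; have cO := bounded_closure_compact bO.
have [M0 M00 h0] := wcont_bounded cO ((wcontP _ _).1 cf).
have ext s : (size s <= 2)%N -> exists2 M, 0 < M & forall x, Omega x -> `|pderiv s f x| <= M.
  move=> /hext[g [cg gE]]; have [M M_0 hM] := wcont_bounded cO ((wcontP _ _).1 cg).
  by exists M => // x Ox; rewrite -gE //; apply: hM; exact: subset_closure.
have [M1 M10 h1] := @finite_uniform_bound _ _ _ Omega (fun i => partial i f) (fun i => ext [:: i] isT).
have [M2 M20 h2] := @finite_uniform_bound _ _ _ Omega
  (fun ij : 'I_N * 'I_N => partial ij.1 (partial ij.2 f)) (fun ij => ext [:: ij.1; ij.2] isT).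
have n0 : 0 <= N%:R :> R by [].
have a1 := mulr_ge0 n0 (ltW M10); have a2 := mulr_ge0 (sqr_ge0 (N%:R : R)) (ltW M20).
have a3 := mulr_ge0 n0 (ltW M20).
exists (M0 + N%:R * M1 + N%:R ^+ 2 * M2 + N%:R * M2); first lra.
split=> [x cx|x p Ox]; first by apply: le_trans (h0 x cx) _; lra.
split=> [||k].
- by apply: le_trans (gr_bound p (fun k => h1 k x Ox)) _; apply: ler_wpM2r => //; lra.
- apply: le_trans (he_bound p (fun j k => h2 (j, k) x Ox)) _.
  by apply: ler_wpM2r; [exact: dot_ge0|lra].
- by apply: le_trans (gr_bound p (fun j => h2 (j, k) x Ox)) _; apply: ler_wpM2r => //; lra.
Qed.

Lemma wcont_closure_ext Omega f x e : wcont (closure Omega) f -> closure Omega x -> 0 < e ->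
  exists2 y, Omega y & enorm (y - x) < e /\ `|f y - f x| < e.
Proof.
move=> cf cx e0.
have /= /nbhs_enormP[d d0 hd] := cf x cx _ (nbhsx_ballx (f x) e e0).
have [|y Oy] := (closure_enormP Omega x).1 cx (Num.min d e); first by rewrite lt_min d0.
rewrite lt_min => /andP[yd ye]; exists y => //; split=> //.
by have := hd y yd (subset_closure Oy); rewrite /ball /= distrC.
Qed.

Lemma closure_agree Omega f g : wcont (closure Omega) f -> wcont (closure Omega) g ->
  (forall x, Omega x -> f x = g x) -> forall x, closure Omega x -> f x = g x.
Proof.
move=> cf cg fg x cx; apply/eqP; rewrite -subr_eq0; apply/eqP.
have /= cfg := wcont_sub cf cg.
apply: contrapT => /eqP h; have h0 : 0 < `|f x - g x| by rewrite normr_gt0.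
have [y Oy [_]] := wcont_closure_ext cfg cx h0.
by rewrite fg // subrr sub0r normrN ltxx.
Qed.

Lemma closure_le Omega f c : wcont (closure Omega) f ->
  (forall x, Omega x -> f x <= c) -> forall x, closure Omega x -> f x <= c.
Proof.
move=> cf fc x cx; apply/ler_addgt0Pr => e e0.
have [y Oy [_]] := wcont_closure_ext cf cx e0.
by rewrite ltr_norml => /andP[h1 h2]; have := fc y Oy; lra.
Qed.

Lemma lipschitz_closure Omega f (L r : R) : 0 <= L -> 0 < r -> wcont (closure Omega) f ->
  (forall x y, Omega x -> Omega y -> enorm (x - y) <= r -> `|f x - f y| <= L * enorm (x - y)) ->
  forall x y, closure Omega x -> closure Omega y -> enorm (x - y) <= r / 2 ->
    `|f x - f y| <= L * enorm (x - y).
Proof.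
move=> L0 r0 cf hL x y cx cy xy; apply/ler_addgt0Pr => e e0.
pose d := Num.min (r / 4) (e / (2 * L + 2)).
have D0 : 0 < 2 * L + 2 by lra.
have d0 : 0 < d by rewrite lt_min !divr_gt0.
have dr : d <= r / 4 by rewrite ge_min lexx.
have de : d * (2 * L + 2) <= e by rewrite -ler_pdivlMr // ge_min lexx orbT.
have [x' Ox' [x1 x2]] := wcont_closure_ext cf cx d0.
have [y' Oy' [y1 y2]] := wcont_closure_ext cf cy d0.
have t1 := enorm_sub_le x' x y'; have t2 := enorm_sub_le x y y'.
rewrite (enormB y y') in t2.
have h := hL x' y' Ox' Oy'; have hr : enorm (x' - y') <= r by lra.
have {}h := h hr.
have s1 := ler_distD (f x') (f x) (f y); have s2 := ler_distD (f y') (f x') (f y).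
rewrite (distrC (f x) (f x')) in s1.
have : L * enorm (x' - y') <= L * (enorm (x - y) + 2 * d) by apply: ler_wpM2l => //; lra.
lra.
Qed.

Lemma Ck_closure_lipschitz Omega f : smooth_bounded_domain Omega -> Ck_closure 2 Omega f ->
  exists L r, [/\ 0 <= L, 0 < r & forall x y, closure Omega x -> closure Omega y ->
    enorm (x - y) <= r -> `|f x - f y| <= L * enorm (x - y)].
Proof.
move=> hO fC; have [oO _ _ bO _] := hO.
have [psi [n [H [B [c df]]]]] := defining_function_exists hO.
have [M M0 [_ hM]] := Ck_closure_bound bO fC.
have [fC2 cf _] := fC.
pose r := c / (24 * B).
have r0 : 0 < r.
  by rewrite divr_gt0 ?(df_c df) // mulr_gt0 // (lt_le_trans ltr01 (df_B df)).
exists (5 * M), (r / 2); split; [by rewrite mulr_ge0 // ltW|by rewrite divr_gt0|].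
apply: lipschitz_closure => //; [by rewrite mulr_ge0 // ltW|exact/wcontP|].
move=> x y Ox Oy xy; rewrite distrC enormB.
apply: (quasiconvex_lipschitz oO df (f := f) (G := gr f) (L := M)) => //.
- by move=> z Oz p; exact: (Ck_on_C2on oO fC2 Oz p).1.
- by rewrite enormB.
- exact: ltW.
- by move=> z Oz _ p; have [] := hM z p Oz.
Qed.

Lemma real_bounded_on (phi phi' : R -> R) (K : R) : (forall z : R, is_derive z 1 phi (phi' z)) ->
  exists2 M, 0 < M & forall z, 0 <= z <= K -> `|phi z| <= M.
Proof.
move=> d; have [M M0 hM] := @wcont_bounded R `[0, K]%classic phi (@segment_compact _ _ _)
  (wcont_for (fun p _ => is_derive_continuous (d p))).
by exists M => // z hz; apply: hM; rewrite /= in_itv.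
Qed.

Lemma directional_bound f x p (G M d : R) : is_derive x p f G -> 0 < d ->
  (forall y, enorm (y - x) < d -> `|f y - f x| <= M * enorm (y - x)) -> `|G| <= M * enorm p.
Proof.
move=> /is_derive_epsP df d0 hM; apply/ler_addgt0Pr => e e0.
have [d1 d10 hd1] := df e e0.
pose h := Num.min d1 (d / (enorm p + 1)) / 2.
have E0 : 0 < enorm p + 1 by rewrite ltr_wpDl.
have q0 : 0 < d / (enorm p + 1) by rewrite divr_gt0.
have mn : 0 < Num.min d1 (d / (enorm p + 1)) by rewrite lt_min d10.
have [m1 m2] : Num.min d1 (d / (enorm p + 1)) <= d1 /\
   Num.min d1 (d / (enorm p + 1)) <= d / (enorm p + 1) by rewrite !ge_min !lexx orbT.
have [h0 h1 h2] : [/\ 0 < h, h < d1 & h < d / (enorm p + 1)] by rewrite /h; split; lra.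
have b1 := hd1 h (lt0r_neq0 h0); rewrite gtr0_norm // in b1; have {}b1 := b1 h1.
have b2 : `|f (h *: p + x) - f x| <= M * enorm (h *: p + x - x).
  apply: hM; rewrite addrK enormZ gtr0_norm //.
  by rewrite ltr_pdivlMr // in h2; apply: le_lt_trans h2; apply: ler_wpM2l; [exact: ltW|rewrite lerDl].
rewrite addrK enormZ (gtr0_norm h0) in b2.
have b3 : `|h^-1 * (f (h *: p + x) - f x)| <= M * enorm p.
  by rewrite normrM normfV (gtr0_norm h0) ler_pdivrMl // (mulrCA h).
have := ler_normB (h^-1 * (f (h *: p + x) - f x)) (h^-1 * (f (h *: p + x) - f x) - G).
rewrite opprB addrCA subrr addr0; lra.
Qed.

End DataBounds.

Section UniformBounds.
Context {R : realType} {N : nat}.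
Notation V := 'rV[R]_N.
Variables (Omega : set V) (T lambda alpha : R) (chi : R -> R) (C0 : R) (u0 v0 m0 : V -> R).
Hypothesis hOmega : smooth_bounded_domain Omega.
Hypothesis T0 : 0 < T.
Hypothesis l0 : 0 < lambda.
Hypothesis al0 : 0 < alpha.
Hypothesis hchi : admissible_sensitivity chi.
Hypothesis data : admissible_data Omega C0 u0 v0 m0.

Let oO : open Omega. Proof. by case: hOmega. Qed.
Let bO : bounded_set Omega. Proof. by case: hOmega. Qed.
Let cO : compact (closure Omega). Proof. exact: bounded_closure_compact. Qed.

Let sol eps u v m := nonnegative_solution Omega T lambda alpha chi u0 v0 m0 eps u v m.

Lemma classical_wcont (t1 : R) w : classical Omega T w -> t1 <= T ->
  wcont (closure Omega `*` [set t | 0 <= t <= t1]) (fun p : V * R => w p.1 p.2).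
Proof.
move=> cl t1T; have /wcontP := classical_cont cl; apply: wcont_subset.
by move=> p [h1 /= /andP[h2 h3]]; split=> //=; rewrite h2 (le_trans h3).
Qed.

Lemma time_slice_wcont w (t : R) : classical Omega T w -> 0 <= t <= T ->
  wcont (closure Omega) (w ^~ t).
Proof.
move=> cl tt; have c := classical_wcont cl (lexx T).
apply: (wcont_precomp c (g := fun x : V => (x, t))) => [|x cx]; last by split.
by apply: continuous_pairing => x; [exact: cvg_id|exact: cst_continuous].
Qed.

Let zT : 0 <= (0 : R) <= T. Proof. by rewrite lexx ltW. Qed.

Lemma initial_closure eps u v m : sol eps u v m -> forall x, closure Omega x ->
  [/\ u x 0 = u0 x, v x 0 = v0 x & m x 0 = m0 x].
Proof.
move=> [[cu cv cm _ _ _ ini _ _] _ _ _] x cx.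
have [[_ /wcontP c1 _] [_ /wcontP c2 _] [_ /wcontP c3 _]] := data_C2 data.
have t1 := time_slice_wcont cu zT; have t2 := time_slice_wcont cv zT.
have t3 := time_slice_wcont cm zT.
split; [apply: (closure_agree t1 c1)|apply: (closure_agree t2 c2)|apply: (closure_agree t3 c3)] => // y Oy;
  by have [] := ini y Oy.
Qed.

Lemma nonneg_closure eps u v m : sol eps u v m -> forall x t, closure Omega x -> 0 <= t <= T ->
  [/\ 0 <= u x t, 0 <= v x t & 0 <= m x t].
Proof.
move=> [[cu cv cm _ _ _ _ _ _] pu pv pm] x t cx tt.
have h w : classical Omega T w -> nonnegative_on Omega T w -> 0 <= w x t.
  move=> cw pw; rewrite -oppr_le0.
  apply: (closure_le (f := fun y => - w y t) (wcont_opp (time_slice_wcont cw tt)) _ cx).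
  by move=> y Oy; rewrite oppr_le0; exact: pw.
by split; exact: h.
Qed.

(** The heat equation for [m] has right-hand side [u - m], controlled by [S] alone, and
    [doubling_lipschitz] uses nothing else about it. [L] is chosen before [eps] and the solution. *)
Lemma m_lipschitz (S : R) : 0 <= S -> exists2 L, 0 < L & forall eps u v m t1, sol eps u v m ->
  t1 <= T -> (forall x t, closure Omega x -> 0 <= t <= t1 -> u x t <= S /\ m x t <= S) ->
  forall x y t, closure Omega x -> closure Omega y -> 0 <= t <= t1 ->
    `|m x t - m y t| <= L * enorm (x - y).
Proof.
move=> S0; have [_ _ mC] := data_C2 data.
have [L0 [r [L00 r0 hL]]] := Ck_closure_lipschitz hOmega mC.
have S2 : 0 <= 2 * S by rewrite mulr_ge0.
have [L Lp hdoub] := doubling_lipschitz hOmega al0 S2 L00 r0.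
exists L => // eps u v m t1 s t1T hS.
have [[cu cv cm _ _ meq _ _ mneu] pu pv pm] := s.
have tT t : 0 < t <= t1 -> 0 < t <= T by move=> /andP[h1 h2]; rewrite h1 (le_trans h2).
have tT0 t : 0 <= t <= t1 -> 0 <= t <= T by move=> /andP[h1 h2]; rewrite h1 (le_trans h2).
apply: hdoub.
- exact: classical_wcont.
- by move=> t /tT tt; exact: (classical_space_derivable cm).
- move=> x t Ox tt; have tt' := tT t tt.
  exists (alpha * laplacian (m ^~ t) x + u x t - m x t).
    exact: is_time_derivative_left tt' (meq x t Ox tt').
  have tt0 : 0 <= t <= t1 by case/andP: tt => /ltW -> ->.
  have cx := subset_closure Ox.
  have [u1 m1] := hS x t cx tt0; have [u2 _ m2] := nonneg_closure s cx (tT0 t tt0).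
  rewrite (_ : _ - alpha * _ = u x t - m x t); last by ring.
  by rewrite ler_norml; apply/andP; split; lra.
- by move=> t /tT tt; exact: mneu.
- move=> x t cx tt; have [u1 m1] := hS x t cx tt; have [_ _ m2] := nonneg_closure s cx (tT0 t tt).
  by rewrite ger0_norm //; lra.
- move=> x y cx cy xy.
  have [_ _ ->] := initial_closure s cx; have [_ _ ->] := initial_closure s cy; exact: hL.
Qed.

(** A compactness bound for one solution at a time. It may depend on [eps] and serves only where the
    size of the constant disappears from the conclusion. *)
Lemma solution_bounded eps u v m : sol eps u v m -> exists2 S, 0 <= S &
  forall x t, closure Omega x -> 0 <= t <= T -> u x t <= S /\ m x t <= S.
Proof.
move=> [[cu cv cm _ _ _ _ _ _] _ _ _].
have cK : compact (closure Omega `*` [set t : R | 0 <= t <= T]).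
  apply: compact_setX => //; rewrite (_ : [set t | _] = `[0, T]%classic); first exact: segment_compact.
  by apply/seteqP; split=> s /=; rewrite in_itv.
have [M1 M10 h1] := wcont_bounded cK (classical_wcont cu (lexx T)).
have [M2 M20 h2] := wcont_bounded cK (classical_wcont cm (lexx T)).
exists (M1 + M2) => [|x t cx tt]; first by rewrite addr_ge0 ?ltW.
have := h1 (x, t) (conj cx tt); have := h2 (x, t) (conj cx tt).
rewrite /= !ler_norml => /andP[_ a1] /andP[_ a2]; split; lra.
Qed.

Let v_eq eps u v m : sol eps u v m -> forall x t, Omega x -> 0 < t <= T ->
  left_derive (v x) t (- lambda * m x t * v x t).
Proof. by move=> [s _ _ _] x t Ox tt; exact: is_time_derivative_left tt (sol_v_eq s Ox tt). Qed.

Lemma v_upper : exists2 Kd, 0 < Kd & (forall x, closure Omega x -> [/\ `|u0 x| <= Kd, `|v0 x| <= Kd & `|m0 x| <= Kd]) /\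
  (forall x p, Omega x -> `|gr v0 x p| <= Kd * enorm p /\ `|he v0 x p| <= Kd * dot p p).
Proof.
have [uC vC mC] := data_C2 data.
have [M1 M10 [h1 _]] := Ck_closure_bound bO uC.
have [M2 M20 [h2 h2']] := Ck_closure_bound bO vC.
have [M3 M30 [h3 _]] := Ck_closure_bound bO mC.
exists (M1 + M2 + M3); first by rewrite !addr_gt0.
split=> [x cx|x p Ox].
  by have := h1 x cx; have := h2 x cx; have := h3 x cx; split; lra.
have [a1 a2 _] := h2' x p Ox; split.
  by apply: le_trans a1 _; apply: ler_wpM2r => //; lra.
by apply: le_trans a2 _; apply: ler_wpM2r; [exact: dot_ge0|lra].
Qed.

Lemma v_flat eps u v m : sol eps u v m -> forall x nu t, boundary Omega x ->
  exterior_normal Omega x nu -> 0 < t <= T -> flat (v ^~ t) x nu.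
Proof.
move=> s x nu t bx ex tt e e0.
have [S S0 hS] := solution_bounded s.
have [L L0 hL] := m_lipschitz S0.
have [Kd Kd0 [hK _]] := v_upper.
have [psi [n [H [B [c df]]]]] := defining_function_exists hOmega.
have [_ n1 inw] := exterior_normalP oO df bx ex.
have [[cu cv cm _ _ _ _ _ mneu] pu pv pm] := s.
apply: (@attractant_neumann _ _ Omega T lambda L Kd m v) => //.
- exact: ltW.
- exact: ltW.
- exact: classical_wcont.
- exact: v_eq s.
- move=> y Oy; have cy := subset_closure Oy; have [_ -> _] := initial_closure s cy.
  by have [_ h _] := hK y cy; exact: le_trans (ler_norm _) h.
- by move=> y z r Oy Oz rr; apply: (hL _ _ _ _ _ s (lexx T) hS) => //; exact: subset_closure.
- move=> e' e'0; have cx : closure Omega x by case: bx.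
  have [d d0 hd] := normal_derivative_eps (data_v0_neumann data) bx ex e'0.
  have [e1 e10 he1] := inw.
  exists (Num.min d e1) => [|h]; first by rewrite lt_min d0.
  rewrite lt_min => /andP[h0 /andP[h1 h2]].
  have ch : closure Omega (x - h *: nu) by apply/subset_closure/he1; rewrite h0.
  have [_ -> _] := initial_closure s cx; have [_ -> _] := initial_closure s ch.
  by apply: hd; rewrite h0.
Qed.

(** Integrating the equation of [v] at two points transfers the Lipschitz bound of [m] to [v];
    difference quotients near an inner point then bound the gradient. *)
Lemma v_facts Kd L eps u v m : 0 < Kd -> 0 <= L ->
  (forall x, closure Omega x -> [/\ `|u0 x| <= Kd, `|v0 x| <= Kd & `|m0 x| <= Kd]) ->
  (forall x p, Omega x -> `|gr v0 x p| <= Kd * enorm p /\ `|he v0 x p| <= Kd * dot p p) ->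
  sol eps u v m ->
  (forall x y t, closure Omega x -> closure Omega y -> 0 <= t <= T ->
    `|m x t - m y t| <= L * enorm (x - y)) ->
  (forall x t, Omega x -> 0 <= t <= T -> 0 <= v x t <= Kd) /\
  (forall x t p, Omega x -> 0 < t <= T ->
     `|gr (v ^~ t) x p| <= (Kd + lambda * Kd * L * T) * enorm p).
Proof.
move=> Kd0 L0 hK hK' s mL; have [[cu cv cm _ _ _ _ _ mneu] pu pv pm] := s.
have vini y : Omega y -> v y 0 <= Kd.
  move=> Oy; have cy := subset_closure Oy; have [_ -> _] := initial_closure s cy.
  by have [_ h _] := hK y cy; exact: le_trans (ler_norm _) h.
have vb x t : Omega x -> 0 <= t <= T -> 0 <= v x t <= Kd.
  move=> Ox tt; apply: (@attractant_bounds _ _ Omega T lambda Kd m v) => //.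
  - exact: classical_wcont.
  - exact: v_eq s.
split=> // x t p Ox tt.
have tt0 : 0 <= t <= T by case/andP: tt => /ltW -> ->.
have d := (Ck_on_C2on oO (classical_space_derivable cv tt) Ox p).1.
have [d0 d00 hd0] := (open_enormP Omega).1 oO x Ox.
apply: (directional_bound d d00) => y yd; have Oy := hd0 y yd.
have mL' x' y' t' : Omega x' -> Omega y' -> 0 <= t' <= T -> `|m x' t' - m y' t'| <= L * enorm (x' - y').
  by move=> *; apply: mL => //; exact: subset_closure.
have := @attractant_lipschitz _ _ Omega T lambda L Kd m v l0 L0 (ltW Kd0) (classical_wcont cv (lexx T))
  (v_eq s) pm pv vini mL' y x t Oy Ox tt0.
have [_ -> _] := initial_closure s (subset_closure Ox).
have [_ -> _] := initial_closure s (subset_closure Oy).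
have [_ [vC2 _ _] _] := data_C2 data.
have : `|v0 y - v0 x| <= Kd * enorm (y - x).
  have seg r : 0 <= r <= 1 -> Omega (r *: (y - x) + x).
    move=> /andP[r0 r1]; apply: hd0; rewrite addrK enormZ ger0_norm //.
    by apply: le_lt_trans yd; rewrite ler_piMl.
  have [r /andP[r0 r1] ->] := C2on_segment_mvt (Ck_on_C2on oO vC2) seg.
  by have [|h _] := hK' (r *: (y - x) + x) (y - x) _; [apply: seg; rewrite !ltW|].
move=> b1 b2; apply: le_trans b2 _; rewrite mulrDl; apply: lerD => //.
rewrite (_ : _ * _ * _ = lambda * Kd * L * enorm (y - x) * t); last by ring.
rewrite (_ : _ * T * _ = lambda * Kd * L * enorm (y - x) * T); last by ring.
apply: ler_wpM2l; last by case/andP: tt.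
by rewrite !mulr_ge0 // ltW.
Qed.

End UniformBounds.

Section Elementary.
Context {R : realType} {N : nat}.

Lemma bistable_large (U : R) : 2 <= U -> bistable U <= - (3 / 2 * U).
Proof.
move=> U2; rewrite /bistable.
have h : 3 / 2 <= (U - 1) * (U - 2^-1) by nra.
have : U * (3 / 2) <= U * ((U - 1) * (U - 2^-1)) by apply: ler_wpM2l => //; lra.
lra.
Qed.

Lemma expR_bounds (X c : R) : `|c| <= X -> expR (- X) <= expR c <= expR X.
Proof. by rewrite ler_norml !ler_expR. Qed.

Lemma sum_bound (F : 'I_N -> R) (b : R) : (forall i, F i <= b) -> \sum_i F i <= N%:R * b.
Proof.
move=> h; apply: (@le_trans _ _ (\sum_(i < N) b)); first by apply: ler_sum => i _; exact: h.
by rewrite sumr_const card_ord -[X in X <= _]mulr_natl.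
Qed.

End Elementary.

(** At a contact with [Kr + del * ga] the density is at least 2, so the reaction is at most
    [- 3/2 eps^-2 W] and beats the zero-order term [W * Cm] once [eps^-2 >= Cm + 1]. The drift bound
    [D] comes from [solution_bounded] and may depend on the solution, but it enters only through the
    amplitude [del <= 1] of the weight, so the final bound is uniform. *)
Lemma density_upper_bound (R : realType) (N : nat) (Omega : set 'rV[R]_N) (T lambda alpha : R)
  (chi : R -> R) (C0 : R) (u0 v0 m0 : 'rV[R]_N -> R) (eps t1 Kd X X1 Km : R) u v m :
  smooth_bounded_domain Omega -> 0 < T -> 0 < lambda -> 0 < alpha ->
  admissible_sensitivity chi -> admissible_data Omega C0 u0 v0 m0 ->
  nonnegative_solution Omega T lambda alpha chi u0 v0 m0 eps u v m ->
  0 < eps -> 0 < Kd -> 0 < X -> 0 < X1 -> 0 <= Km -> lambda * X1 * Km * Kd + 1 <= eps ^- 2 ->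
  (forall x, closure Omega x -> [/\ `|u0 x| <= Kd, `|v0 x| <= Kd & `|m0 x| <= Kd]) ->
  (forall x p, Omega x -> `|gr v0 x p| <= Kd * enorm p /\ `|he v0 x p| <= Kd * dot p p) ->
  (forall z, 0 <= z <= Kd -> `|chi z| <= X) -> (forall z, 0 <= z <= Kd -> `|chi^`()%classic z| <= X1) ->
  t1 <= T -> (forall x t, closure Omega x -> 0 <= t <= t1 -> m x t <= Km) ->
  forall x t, closure Omega x -> 0 <= t <= t1 -> u x t <= ((Kd + 2) * expR X + 2) * expR X.
Proof.
move=> hOmega T0 l0 al0 hchi data s e0 Kd0 X0 X10 Km0 eps2 hK hK' hX hX1 t1T mKm.
have [oO _ _ bO _] := hOmega.
pose V := 'rV[R]_N.
have [psi [n [H [B [c df]]]]] := defining_function_exists hOmega.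
have [ga [G [K2 [M [gC M0 gcont hg gbd]]]]] := boundary_weight oO df bO ltr01.
have eX := expR_gt0 X.
have eX1 : 1 <= expR X by rewrite -expR0 ler_expR ltW.
(* Chosen to exceed the initial values of [tilde], at most [Kd * expR X], and to satisfy
   [Kr * expR (- X) >= 2], which forces the density into the range of [bistable_large] at
   contact. *)
pose Kr := (Kd + 2) * expR X.
pose Cm := lambda * X1 * Km * Kd.
have Kr2 : 2 <= Kr by rewrite /Kr; clear - Kd0 eX1; nra.
have Cm0 : 0 <= Cm by rewrite /Cm !mulr_ge0 // ltW.
have KreX : Kr * expR (- X) = Kd + 2.
  by rewrite /Kr -mulrA -expRD subrr expR0 mulr1.
have KreX' : Kd * expR X < Kr by rewrite /Kr ltr_pM2r //; clear; lra.
rewrite -/Kr.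
clearbody Kr.
have [S S0 hS] := solution_bounded hOmega s.
have [L' L'0 hL'] := m_lipschitz lambda chi hOmega T0 al0 data S0.
have [vb vg] := v_facts hOmega T0 l0 data Kd0 (ltW L'0) hK hK' s (hL' _ _ _ _ _ s (lexx T) hS).
have [[cu cv cm ueq veq meq ini uneu mneu] pu pv pm] := s.
have chib x t : Omega x -> 0 <= t <= T -> `|chi (v x t)| <= X.
  by move=> Ox tt; apply: hX; exact: vb.
have chib1 x t : Omega x -> 0 <= t <= T -> `|chi^`()%classic (v x t)| <= X1.
  by move=> Ox tt; apply: hX1; exact: vb.
have vbc x t : closure Omega x -> 0 <= t <= T -> 0 <= v x t <= Kd.
  move=> cx tt; have [_ -> _] := nonneg_closure s cx tt.
  by apply: (closure_le (time_slice_wcont cv tt) _ cx) => y Oy; case/andP: (vb y t Oy tt).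
have grchi (D : R) : (forall x t p, Omega x -> 0 < t <= T -> `|gr (v ^~ t) x p| <= D * enorm p) ->
    forall x t p, Omega x -> 0 < t <= T -> `|gr (fun y => chi (v y t)) x p| <= X1 * D * enorm p.
  move=> hD x t p Ox tt; rewrite (chiv_gr hOmega hchi (let: And4 s1 _ _ _ := s in s1)) //.
  rewrite normrM -mulrA; apply: ler_pM => //; last exact: hD.
  by apply: chib1 => //; case/andP: tt => /ltW -> ->.
pose D := X1 * (Kd + lambda * Kd * L' * T).
have hD x t i : Omega x -> 0 < t <= T -> `|drift chi v x t i| <= D.
  by move=> Ox tt; have := grchi _ vg x t (basis_vec i) Ox tt; rewrite enorm_basis mulr1.
have D0 : 0 <= D by rewrite !mulr_ge0 ?addr_ge0 ?mulr_ge0 // ltW.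
pose NM := N%:R * (M + D * M) + 1.
have DM0 : 0 <= D * M by apply: mulr_ge0 => //; exact: ltW.
clearbody D.
have NM0 : 1 <= NM by rewrite /NM lerDr; apply: mulr_ge0 => //; apply: addr_ge0 => //; exact: ltW.
pose del := NM^-1.
have del0 : 0 < del by rewrite invr_gt0; arith.
have del1 : del <= 1 by rewrite invf_le1 //; arith.
have delN : N%:R * (del * M + D * (del * M)) <= 1.
  rewrite (_ : N%:R * _ = del * (NM - 1)); last by rewrite /NM; ring.
  have dNM : del * NM = 1 by rewrite /del mulVf // lt0r_neq0 //; arith.
  by rewrite mulrBr dNM mulr1; arith.
have vN x nu t : boundary Omega x -> exterior_normal Omega x nu -> 0 < t <= t1 -> flat (v ^~ t) x nu.
  by move=> bx ex /andP[t0 tt1]; apply: (v_flat hOmega T0 l0 al0 data s bx ex); rewrite t0 (le_trans tt1).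
have gN x nu : boundary Omega x -> exterior_normal Omega x nu -> flat (fun _ : V => 0 : R) x nu.
  by move=> _ _ e e_0; exists 1 => // h /andP[h0 _]; rewrite subrr normr0 mulr_ge0 // ltW.
have main : forall x t, closure Omega x -> 0 <= t <= t1 ->
    1 * (tilde chi u v (fun=> 0) x t - (Kr + del * ga x)) < 0.
  apply: (comparison hOmega hchi (let: And4 s1 _ _ _ := s in s1) (C2on_const (0 : R))
    (@wcont_cst R V (closure Omega) 0) gN t1T vN (sigma := 1) (W := fun x _ => Kr + del * ga x)
    (Wt := fun _ _ => 0) (GW := fun _ x p => 0 + del * G x p)
    (HW := fun _ x p => 0 + del * K2 x p)).
  - exact: oner_neq0.
  - apply: wcont_add; first exact: wcont_cst.
    apply: wcont_mul; first exact: wcont_cst.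
    by apply: wcont_for => p _; apply: (@continuous_comp _ _ _ (fun p : V * R => p.1) ga);
      [exact: cvg_fst|exact: gcont].
  - by move=> t tt; apply: C2on_add; [exact: C2on_const|apply: C2on_scale; exact: C2onS gC].
  - move=> x cx; rewrite /tilde mul1r; have [-> -> _] := initial_closure T0 data s cx.
    have [a1 a2 _] := hK x cx; have [/andP[g1 g2] _ _] := hg x cx.
    have [p0 p1 _] := data_nonneg data cx.
    have b1 : `|chi (v0 x)| <= X by apply: hX; rewrite p1 (le_trans (ler_norm _)).
    have /andP[_ b2] : expR (- X) <= expR (0 - chi (v0 x)) <= expR X.
      by apply: expR_bounds; rewrite sub0r normrN.
    have : u0 x * expR (0 - chi (v0 x)) <= Kd * expR X.
      by apply: ler_pM => //; exact: le_trans (ler_norm _) a1.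
    have : 0 <= del * ga x by rewrite mulr_ge0 ?ltW //; arith.
    arith.
  - move=> x nu t bx ex tt; have [d d0 hd] := gbd x nu bx ex.
    exists del, d; split=> // h hh; rewrite !mul1r -addrA lerD2l -mulrBr ler_pM2l //.
    by have := hd h hh; rewrite mul1r.
  - move=> x t Ox tt _; rewrite !mul1r.
    have cx := subset_closure Ox; have [/andP[g1 g2] gG gK] := hg x cx.
    have tT : 0 < t <= T by case/andP: tt => -> /= /le_trans ->.
    have tT0 : 0 <= t <= T by case/andP: tT => /ltW -> ->.
    set W := Kr + del * ga x.
    have W2 : Kr <= W by rewrite /W lerDl mulr_ge0 ?ltW //; arith.
    rewrite /tilde_rhs.
    set S1 := \sum_i _; set S2 := W * (lambda * _); set S3 := eps ^- 2 * _.
    have s1 : S1 <= 1.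
      apply: le_trans delN; apply: sum_bound => i.
      have b1 : `|G x (basis_vec i)| <= M by have := gG (basis_vec i); rewrite enorm_basis mulr1.
      have b2 : `|K2 x (basis_vec i)| <= M.
        by have := gK (basis_vec i); rewrite -enorm_sqr enorm_basis expr1n mulr1.
      rewrite mulr0 subr0 !mulr0 addr0 mulr0 subr0 !add0r; apply: lerD.
        by rewrite ler_pM2l //; exact: le_trans (ler_norm _) b2.
      apply: le_trans (ler_norm _) _; rewrite normrM; apply: ler_pM => //; first exact: hD.
      by rewrite normrM gtr0_norm // ler_pM2l.
    have s2 : S2 <= W * Cm.
      apply: ler_wpM2l; first arith.
      rewrite /Cm -!mulrA; apply: ler_wpM2l; first exact: ltW.
      apply: le_trans (ler_norm _) _; rewrite normrM; apply: ler_pM => //; first exact: chib1.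
      have tt0 : 0 <= t <= t1 by case/andP: tt => /ltW -> ->.
      have [h1 h2] := (mKm x t cx tt0, vb x t Ox tT0).
      have [_ _ h3] := nonneg_closure s cx tT0; case/andP: h2 => h2 h4.
      by rewrite ger0_norm ?mulr_ge0 //; apply: ler_pM.
    have s3 : S3 <= - (3 / 2 * W) * (Cm + 1).
      have cb := chib x t Ox tT0.
      have /andP[b1 _] := expR_bounds cb.
      have U2 : 2 <= expR (chi (v x t) - 0) * W.
        rewrite subr0; apply: (@le_trans _ _ (expR (- X) * Kr)); first by rewrite mulrC KreX; arith.
        by apply: ler_pM => //; arith.
      have b2 : expR (0 - chi (v x t)) * bistable (expR (chi (v x t) - 0) * W) <= - (3 / 2 * W).
        apply: (@le_trans _ _ (expR (0 - chi (v x t)) * - (3 / 2 * (expR (chi (v x t) - 0) * W)))).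
          by rewrite ler_pM2l ?expR_gt0 //; exact: bistable_large.
        rewrite subr0 sub0r (_ : _ * - _ = - (3 / 2 * W) * (expR (- chi (v x t)) * expR (chi (v x t)))); last by ring.
        by rewrite -expRD addrC subrr expR0 mulr1.
      apply: (@le_trans _ _ (eps ^- 2 * - (3 / 2 * W))).
        by rewrite ler_pM2l // invr_gt0 exprn_gt0.
      rewrite mulrC ler_wnM2l // oppr_le0 mulr_ge0 //; arith.
    have : 0 <= W * Cm by rewrite mulr_ge0 //; arith.
    arith.
move=> x t cx tt; have := main x t cx tt; rewrite mul1r /tilde sub0r => h.
have tT0 : 0 <= t <= T by case/andP: tt => -> /= /le_trans ->.
have [/andP[g1 g2] _ _] := hg x cx.
have cb : `|chi (v x t)| <= X by apply: hX; exact: vbc.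
have /andP[_ b2] := expR_bounds cb.
have -> : u x t = u x t * expR (- chi (v x t)) * expR (chi (v x t)).
  by rewrite -mulrA -expRD addrC subrr expR0 mulr1.
apply: ler_pM => //.
  by apply: mulr_ge0 => //; have [h0 _ _] := nonneg_closure s cx tT0.
have : del * ga x <= 1 * 2 by apply: ler_pM => //; [exact: ltW|arith].
arith.
Qed.

(** Up to the first contact the bound on [m] holds, so the conditional premise gives [u <= Ku]
    there. At contact [alpha] times the Laplacian is below 1 by the choice of [del], while
    [u - m <= - (Kd + 1)]: [m] would be decreasing in time. *)
Lemma signal_upper_bound (R : realType) (N : nat) (Omega : set 'rV[R]_N) (T lambda alpha : R)
  (chi : R -> R) (C0 : R) (u0 v0 m0 : 'rV[R]_N -> R) (eps Kd Ku : R) u v m :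
  smooth_bounded_domain Omega -> 0 < T -> 0 < lambda -> 0 < alpha ->
  admissible_sensitivity chi -> admissible_data Omega C0 u0 v0 m0 ->
  nonnegative_solution Omega T lambda alpha chi u0 v0 m0 eps u v m ->
  0 < Kd -> 0 <= Ku ->
  (forall x, closure Omega x -> [/\ `|u0 x| <= Kd, `|v0 x| <= Kd & `|m0 x| <= Kd]) ->
  (forall t1, t1 <= T -> (forall x t, closure Omega x -> 0 <= t <= t1 -> m x t <= Ku + Kd + 2) ->
    forall x t, closure Omega x -> 0 <= t <= t1 -> u x t <= Ku) ->
  forall x t, closure Omega x -> 0 <= t <= T -> m x t <= Ku + Kd + 2.
Proof.
move=> hOmega T0 l0 al0 hchi data s Kd0 Ku0 hK claimA.
have [oO _ _ bO _] := hOmega.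
have cO := bounded_closure_compact bO.
pose V := 'rV[R]_N.
have [psi [n [H [B [c df]]]]] := defining_function_exists hOmega.
have [ga [G [K2 [M [gC M0 gcont hg gbd]]]]] := boundary_weight oO df bO ltr01.
have [[cu cv cm ueq veq meq ini uneu mneu] pu pv pm] := s.
pose del := (alpha * (N%:R * M) + 2)^-1.
have aN : 0 <= alpha * (N%:R * M) by rewrite !mulr_ge0 // ltW.
have D0 : 0 < alpha * (N%:R * M) + 2 by arith.
have del0 : 0 < del by rewrite invr_gt0.
have del2 : del * 2 <= 1.
  by rewrite /del mulrC ler_pdivrMr // mul1r lerDr.
have delN : alpha * (del * (N%:R * M)) < 1.
  by rewrite mulrCA /del mulrC ltr_pdivrMr // mul1r ltrDl.
have main : forall x t, closure Omega x -> 0 <= t <= T -> m x t - (Ku + Kd + 1 + del * ga x) < 0.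
  apply: (first_touch cO).
  - apply: wcont_sub; first exact: (classical_wcont cm (lexx T)).
    apply: wcont_add; first exact: wcont_cst.
    apply: wcont_mul; first exact: wcont_cst.
    by apply: wcont_for => p _; apply: (@continuous_comp _ _ _ (fun p : V * R => p.1) ga);
      [exact: cvg_fst|exact: gcont].
  - move=> x cx; have [_ _ ->] := initial_closure T0 data s cx; have [_ _ a3] := hK x cx.
    have [/andP[g1 g2] _ _] := hg x cx; have := le_trans (ler_norm _) a3.
    have : 0 <= del * ga x by rewrite mulr_ge0 ?ltW //; arith.
    arith.
  move=> x t cx tt F0 Fle Fb.
  have gle y : closure Omega y -> del * ga y <= 1.
    move=> cy; have [/andP[g1 g2] _ _] := hg y cy; apply: le_trans del2.
    by rewrite ler_pM2l.
  have mle y r : closure Omega y -> 0 <= r <= t -> m y r <= Ku + Kd + 2.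
    move=> cy /andP[r0 rt]; have := gle y cy.
    move: rt; rewrite le_eqVlt => /orP[/eqP ->|rt]; first by have := Fle y cy; arith.
    by have := Fb y r cy; rewrite r0 rt => /(_ isT); arith.
  have tT : t <= T by case/andP: tt.
  have tt0 : 0 <= t <= t by case/andP: tt => /ltW -> _; rewrite lexx.
  have uK := claimA t tT mle x t cx tt0.
  have [Ox|bx] := closure_open_cases oO cx; last first.
    have [nu ex] := boundary_normal hOmega bx.
    have [_ _ [e2 e20 inw]] := exterior_normalP oO df bx ex.
    have [d d0 hd] := gbd x nu bx ex.
    have d2 : 0 < del / 2 by rewrite divr_gt0.
    have [d' d'0 hd'] := normal_derivative_eps (mneu t tt) bx ex d2.
    pose h := Num.min (Num.min d d') e2 / 2.
    have mn : 0 < Num.min (Num.min d d') e2 by rewrite !lt_min d0 d'0.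
    have [m1 m2 m3] : [/\ Num.min (Num.min d d') e2 <= d, Num.min (Num.min d d') e2 <= d' &
      Num.min (Num.min d d') e2 <= e2] by rewrite !ge_min !lexx !orbT.
    have [h0 hh1 hh2 hh3] := half_lt3 mn m1 m2 m3; rewrite -/h in h0 hh1 hh2 hh3.
    have ch : closure Omega (x - h *: nu) by apply/subset_closure/inw; rewrite h0.
    have b1 := hd h; rewrite h0 hh1 in b1; have {}b1 := b1 isT; rewrite mul1r in b1.
    have b2 := hd' h; rewrite h0 hh2 in b2; have {}b2 := le_trans (ler_norm _) (b2 isT).
    have b3 := Fle _ ch; have b4 : 0 < del * h by rewrite mulr_gt0.
    have b5 : del * ga (x - h *: nu) <= del * (ga x - h) by rewrite ler_pM2l.
    arith.
  have [/andP[g1 g2] gG gK] := hg x cx.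
  have [l_ dm mE] := is_time_derivative_left tt (meq x t Ox tt).
  have dl : 0 <= alpha * laplacian (m ^~ t) x + u x t - m x t.
    apply: (is_derive_left_max dm); exists t => [|r /andP[r0 rt]]; first by case/andP: tt.
    rewrite subrr in r0; case/andP: (tt) => t0 _.
    rewrite mE ?r0 ?(ltW rt) // mE ?t0 ?lexx //.
    by have := Fb x r cx; rewrite (ltW r0) rt => /(_ isT); arith.
  have mC := Ck_on_C2on oO (classical_space_derivable cm tt).
  have FC := C2on_sub_scale del mC (C2onS (@subsetT _ Omega) gC).
  have lap : laplacian (m ^~ t) x <= N%:R * (del * M).
    have <- : \sum_i he (m ^~ t) x (basis_vec i) = laplacian (m ^~ t) x.
      by apply: eq_bigr => i _; exact: he_basis.
    apply: sum_bound => i; set p := basis_vec i.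
    have p1 : enorm p = 1 by exact: enorm_basis.
    have [d d0 hd] := (open_enormP Omega).1 oO x Ox.
    have inO r : `|r| < d -> Omega (r *: p + x) by move=> rd; apply: hd; rewrite addrK enormZ p1 mulr1.
    have z0 : `|0 : R| < d by rewrite normr0.
    have [|_] := second_derivative_test d0 (fun r rd => (C2on_line_at FC (inO r rd)).1)
      (C2on_line_at FC (inO 0 z0)).2.
      move=> r rd; rewrite scale0r add0r.
      have := Fle _ (subset_closure (inO r rd)); move: F0; arith.
    rewrite scale0r add0r => h.
    have b2 : `|K2 x p| <= M by have := gK p; rewrite -enorm_sqr p1 expr1n mulr1.
    have : del * K2 x p <= del * M by rewrite ler_pM2l //; exact: le_trans (ler_norm _) b2.
    arith.
  have : alpha * laplacian (m ^~ t) x <= alpha * (N%:R * (del * M)) by rewrite ler_pM2l.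
  rewrite (mulrCA N%:R) => al; have : 0 <= del * ga x by rewrite mulr_ge0 ?ltW //; arith.
  arith.
move=> x t cx tt; have := main x t cx tt; have [/andP[g1 g2] _ _] := hg x cx.
have : del * ga x <= 1 by apply: le_trans del2; rewrite ler_pM2l.
arith.
Qed.

(** The data give [Kd], then [chi] on [[0, Kd]] gives [X] and [X1], and these give [Ku] and [Km].
    Only then is [m_lipschitz] applied, with a bound that no longer depends on the solution, so the
    gradient bound on chi(v) is uniform as well. *)
Lemma uniform_bounds (R : realType) (N : nat) (Omega : set 'rV[R]_N) (T lambda alpha : R)
  (chi : R -> R) (C0 : R) (u0 v0 m0 : 'rV[R]_N -> R) :
  smooth_bounded_domain Omega -> 0 < T -> 0 < lambda -> 0 < alpha ->
  admissible_sensitivity chi -> admissible_data Omega C0 u0 v0 m0 -> exists eps1 K, [/\ 0 < eps1, 1 <= K & forall eps u v m,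
  0 < eps <= eps1 -> nonnegative_solution Omega T lambda alpha chi u0 v0 m0 eps u v m -> [/\
  forall x t, closure Omega x -> 0 <= t <= T -> u x t <= K /\ m x t <= K,
  forall x t, Omega x -> 0 <= t <= T -> 0 <= v x t <= K,
  forall x t p, Omega x -> 0 < t <= T ->
    `|gr (fun y => chi (v y t)) x p| <= K * enorm p &
  forall x t, Omega x -> 0 <= t <= T -> `|chi^`()%classic (v x t)| <= K]].
Proof.
move=> hOmega T0 l0 al0 hchi data; have [oO _ _ bO _] := hOmega.
have cO := bounded_closure_compact bO.
pose V := 'rV[R]_N.
have [Kd Kd0 [hK hK']] := v_upper hOmega data.
have dchi := chi_derive hchi.
have [X X0 hX] := real_bounded_on Kd (fun z => (dchi z).1).
have [X1 X10 hX1] := real_bounded_on Kd (fun z => (dchi z).2).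
have eX := expR_gt0 X.
have eX1 : 1 <= expR X by rewrite -expR0 ler_expR ltW.
pose Kr := (Kd + 2) * expR X.
pose Ku := (Kr + 2) * expR X.
pose Km := Ku + Kd + 2.
pose Cm := lambda * X1 * Km * Kd.
have Kr2 : 2 <= Kr by rewrite /Kr; clear - Kd0 eX1; nra.
have Ku2 : 2 <= Ku by rewrite /Ku; clear - Kr2 eX1; nra.
have Km2 : 2 <= Km by rewrite /Km; clear - Ku2 Kd0; arith.
have Km0 : 0 <= Km := le_trans (ler0n _ 2) Km2.
have Ku0 : 0 <= Ku := le_trans (ler0n _ 2) Ku2.
have Cm0 : 0 <= Cm by rewrite /Cm !mulr_ge0 // ltW.
pose eps1 := (Cm + 1)^-1.
have eps10 : 0 < eps1 by rewrite invr_gt0 ltr_wpDl.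
have [L L0 hL] := m_lipschitz lambda chi hOmega T0 al0 data Km0.
pose Kg := X1 * (Kd + lambda * Kd * L * T).
have Kg0 : 0 <= Kg by rewrite !mulr_ge0 ?addr_ge0 ?mulr_ge0 // ltW.
have KuKm : Ku <= Km by rewrite /Km; clear - Kd0; arith.
exists eps1, (Km + Kg + X1); split=> //; first by clear - Km2 Kg0 X10; arith.
move=> eps u v m /andP[e0 e1] s.
have [[cu cv cm ueq veq meq ini uneu mneu] pu pv pm] := s.
have eps2 : Cm + 1 <= eps ^- 2.
  have ee : eps ^+ 2 <= (Cm + 1)^-1.
    apply: (le_trans _ e1); rewrite expr2 ler_piMl ?(ltW e0) //.
    by apply: (le_trans e1); rewrite invf_le1 ?ltr_wpDl // lerDr.
  by rewrite -[Cm + 1]invrK lef_pV2 ?posrE ?exprn_gt0 ?invr_gt0 // ltr_wpDl.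
(* u <= Ku as long as m <= Km, and m <= Km as long as u <= Ku, so neither bound
   can be the first to fail. *)
have claimA t1 : t1 <= T -> (forall x t, closure Omega x -> 0 <= t <= t1 -> m x t <= Km) ->
    forall x t, closure Omega x -> 0 <= t <= t1 -> u x t <= Ku.
  exact: (density_upper_bound hOmega T0 l0 al0 hchi data s e0 Kd0 X0 X10 Km0 eps2 hK hK' hX hX1).
have claimB := signal_upper_bound hOmega T0 l0 al0 hchi data s Kd0 Ku0 hK claimA.
have uK x t : closure Omega x -> 0 <= t <= T -> u x t <= Ku := claimA T (lexx T) claimB x t.
have umK x t : closure Omega x -> 0 <= t <= T -> u x t <= Km /\ m x t <= Km.
  by move=> cx tt; split; [exact: le_trans (uK x t cx tt) KuKm|exact: claimB].
have [vb vg'] := v_facts hOmega T0 l0 data Kd0 (ltW L0) hK hK' s (hL _ _ _ _ _ s (lexx T) umK).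
split.
- move=> x t cx tt; have [a b] := umK x t cx tt; clear - a b Kg0 X10; split; arith.
- move=> x t Ox tt; have /andP[-> h] := vb x t Ox tt; rewrite /= /Km; clear - h Ku0 Kg0 X10; arith.
- move=> x t p Ox tt; rewrite (chiv_gr hOmega hchi (let: And4 s1 _ _ _ := s in s1)) // normrM.
  apply: (@le_trans _ _ (X1 * ((Kd + lambda * Kd * L * T) * enorm p))).
    apply: ler_pM => //; last exact: vg'.
    by apply: hX1; apply: vb => //; case/andP: tt => /ltW -> ->.
  by rewrite mulrA -/Kg; apply: ler_wpM2r => //; clear - Km0 X10; arith.
- by move=> x t Ox tt; apply: le_trans (hX1 _ (vb x t Ox tt)) _; clear - Km0 Kg0; arith.
Qed.

(** * Barriers *)

Section Reaction.
Context {R : realType}.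
Implicit Types (V w A : R).

Lemma expR_sub1_le V A : `|V| <= A -> `|expR V - 1| <= expR A * `|V|.
Proof.
move=> VA; have A0 : 0 <= A by exact: le_trans VA.
have V1 : V <= A by exact: le_trans (ler_norm _) VA.
have a := expR_ge1Dx V; have b := expR_ge1Dx (- V).
have e0 := expR_gt0 V; have E : expR V * expR (- V) = 1 by rewrite -expRD subrr expR0.
have c : expR V * (1 - V) <= expR V * expR (- V) by rewrite ler_pM2l.
rewrite E in c.
have e1 : 1 <= expR A by rewrite -expR0 ler_expR.
have e2 : expR V <= expR A by rewrite ler_expR.
have n0 := normr_ge0 V.
have n1 : `|V| <= expR A * `|V| by rewrite ler_peMl.
have n2 : expR V * V <= expR A * `|V|.
  apply: (@le_trans _ _ (expR V * `|V|)); first by rewrite ler_pM2l // ler_norm.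
  by rewrite ler_wpM2r.
have n3 : - V <= `|V| by rewrite -normrN ler_norm.
by rewrite ler_norml; apply/andP; split; lra.
Qed.

(** The linear terms of the cubic cancel and the difference factors as [w (e^V - 1)] times a bounded
    quantity. With [V = O(t)] this is the O(t) w error in the reaction. *)
Lemma bistable_twist V w A Wm : `|V| <= A -> 0 <= w <= Wm ->
  `|expR (- V) * bistable (expR V * w) - bistable w| <=
  (2 * (expR A * Wm) ^+ 2 + 2 * (expR A * Wm)) * `|V| * w.
Proof.
move=> VA /andP[w0 wW]; have hE := expR_sub1_le VA.
have E : expR (- V) * expR V = 1 by rewrite -expRD addrC subrr expR0.
have E0 := expR_gt0 V; have EA : expR V <= expR A by rewrite ler_expR (le_trans (ler_norm _)).
have A1 : 1 <= expR A by rewrite -expR0 ler_expR (le_trans _ VA).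
have -> : expR (- V) * bistable (expR V * w) - bistable w =
    w * ((expR V - 1) * (w * (3 / 2 - (expR V + 1) * w))).
  transitivity (expR (- V) * expR V * w * ((1 - expR V * w) * (expR V * w - 2^-1)) - bistable w).
    by rewrite /bistable; ring.
  by rewrite E mul1r /bistable; field.
have Wm0 := le_trans w0 wW.
have hq : `|w * (3 / 2 - (expR V + 1) * w)| <= 2 * expR A * Wm ^+ 2 + 2 * Wm.
  rewrite normrM ger0_norm //.
  have a1 : `|3 / 2 - (expR V + 1) * w| <= 2 + 2 * expR A * Wm.
    have b1 : 0 <= (expR V + 1) * w by rewrite mulr_ge0 // addr_ge0 // ltW.
    have b2 : (expR V + 1) * w <= 2 * expR A * Wm by apply: ler_pM => //; lra.
    by rewrite ler_norml; apply/andP; split; lra.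
  have : w * `|3 / 2 - (expR V + 1) * w| <= Wm * (2 + 2 * expR A * Wm) by apply: ler_pM.
  by rewrite expr2; lra.
rewrite normrM ger0_norm // mulrC; apply: ler_wpM2r => //.
rewrite normrM; apply: (@le_trans _ _ (expR A * `|V| * (2 * expR A * Wm ^+ 2 + 2 * Wm))).
  by apply: ler_pM.
by rewrite le_eqVlt; apply/orP; left; apply/eqP; ring.
Qed.

Lemma le_sum_norm N (sigma a b s : R) (F G D : 'I_N -> R) : `|sigma| = 1 -> 0 <= s ->
  (forall i, `|D i| <= a) -> (forall i, `|F i| <= b) -> forall H : 'I_N -> R,
  sigma * (\sum_i (H i + D i * G i - s * F i)) <=
  sigma * (\sum_i H i) + a * (\sum_i `|G i|) + N%:R * b * s.
Proof.
move=> s1 s0 hD hF H.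
have sN x : sigma * x <= `|x| by apply: le_trans (ler_norm _) _; rewrite normrM s1 mul1r.
have -> : N%:R * b * s = \sum_(i < N) (b * s) by rewrite sumr_const card_ord -[RHS]mulr_natl mulrA.
rewrite !mulr_sumr -!big_split /=; apply: ler_sum => i _.
have a1 := sN (D i * G i); have a2 := sN (- (s * F i)).
rewrite normrM in a1; rewrite normrN normrM ger0_norm // in a2.
have a3 : `|D i| * `|G i| <= a * `|G i| by exact: ler_wpM2r.
have a4 : s * `|F i| <= b * s by rewrite mulrC; exact: ler_wpM2r.
lra.
Qed.

End Reaction.

(** [v] is nonincreasing, and its rate of decrease is at most [lambda * K * K]; the rest is the mean
    value theorem for [chi], extended to the closure by continuity. *)
Lemma chi_drop (R : realType) (N : nat) (Omega : set 'rV[R]_N) (T lambda alpha : R)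
  (chi : R -> R) (C0 : R) (u0 v0 m0 : 'rV[R]_N -> R) (eps K X1 : R) u v m :
  smooth_bounded_domain Omega -> 0 < T -> 0 < lambda -> 0 < alpha ->
  admissible_sensitivity chi -> admissible_data Omega C0 u0 v0 m0 ->
  nonnegative_solution Omega T lambda alpha chi u0 v0 m0 eps u v m -> 0 <= K -> 0 <= X1 ->
  (forall z, 0 <= z <= K -> `|chi^`()%classic z| <= X1) ->
  (forall x t, Omega x -> 0 <= t <= T -> m x t <= K) ->
  (forall x t, Omega x -> 0 <= t <= T -> 0 <= v x t <= K) ->
  forall x t, closure Omega x -> 0 <= t <= T -> `|chi (v x t) - chi (v0 x)| <= X1 * (lambda * K * K * t).
Proof.
move=> hOmega T0 l0 al0 hchi data s K0 X10 hX mK vK; have [oO _ _ bO _] := hOmega.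
have [[cu cv cm ueq veq meq ini uneu mneu] pu pv pm] := s.
have zT : 0 <= (0 : R) <= T by rewrite lexx ltW.
have main x t : Omega x -> 0 <= t <= T -> `|chi (v x t) - chi (v x 0)| <= X1 * (lambda * K * K * t).
  move=> Ox tt; have cx := subset_closure Ox.
  have sec := wcont_section (classical_wcont cv (lexx T)) cx.
  have dv r : 0 < r <= T -> left_derive (v x) r (- lambda * m x r * v x r).
    by move=> rr; exact: is_time_derivative_left rr (veq x r Ox rr).
  have r0T r : 0 < r <= T -> 0 <= r <= T by move=> /andP[/ltW -> ->].
  have up : v x t <= v x 0 + 0 * t.
    apply: (left_growth sec (lexx _)) tt => r rr _; exists (- lambda * m x r * v x r); first exact: dv.
    have [m1 v1] := (pm x r Ox (r0T r rr), pv x r Ox (r0T r rr)).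
    by rewrite -mulrA mulNr oppr_le0 !mulr_ge0 // ltW.
  have dn : - v x t <= - v x 0 + lambda * K * K * t.
    apply: (left_growth (wcont_opp sec) (lexx _)) tt => r rr _.
    have [z dz zE] := dv r rr.
    exists (lambda * m x r * v x r).
      exists (fun s => - z s); last by move=> s' ss'; rewrite zE.
      by apply: (is_derive_eq (is_derive_oppf dz)); ring.
    have m1 := pm x r Ox (r0T r rr); have m2 := mK x r Ox (r0T r rr).
    have /andP[v1 v2] := vK x r Ox (r0T r rr).
    by apply: ler_pM => //; [rewrite mulr_ge0 // ltW|rewrite ler_pM2l].
  rewrite mul0r addr0 in up.
  have /andP[a1 a2] := vK x t Ox tt; have /andP[b1 b2] := vK x 0 Ox zT.
  have t0 : 0 <= t by case/andP: tt.
  move: up; rewrite le_eqVlt => /orP[/eqP ->|lt].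
    by rewrite subrr normr0 !mulr_ge0 // ltW.
  have [z /andP[z1 z2] zE] := mean_value lt (fun z _ => (chi_derive hchi z).1).
  have zK : 0 <= z <= K by rewrite (le_trans a1 (ltW z1)) (le_trans (ltW z2)).
  rewrite distrC zE normrM (gtr0_norm (_ : 0 < v x 0 - v x t)) ?subr_gt0 //.
  apply: ler_pM => //; [by rewrite subr_ge0 ltW|exact: hX|by move: dn; clear; lra].
move=> x t cx tt; have [_ <- _] := initial_closure T0 data s cx.
have c1 t' : 0 <= t' <= T -> wcont (closure Omega) (fun x => chi (v x t')).
  move=> tt'; apply: (wcont_real (time_slice_wcont cv tt')) => p _.
  exact: is_derive_continuous (chi_derive hchi _).1.
rewrite ler_norml; apply/andP; split.
- rewrite lerNl opprB; apply: (closure_le (f := fun x => chi (v x 0) - chi (v x t))) cx.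
    by apply: wcont_sub; exact: c1.
  by move=> y Oy; have := main y t Oy tt; rewrite distrC; exact: le_trans (ler_norm _).
- apply: (closure_le (f := fun x => chi (v x t) - chi (v x 0))) cx.
    by apply: wcont_sub; exact: c1.
  by move=> y Oy; exact: le_trans (ler_norm _) (main y t Oy tt).
Qed.

(** The whole system is compressed into one constant [C] chosen before [eps]: a barrier only has to
    satisfy a scalar differential inequality. [sigma = 1] gives supersolutions and [sigma = -1]
    subsolutions. The inequality is asked only for [0 <= W <= C] because [tilde] takes values there
    and equals [W] at contact; the final [C * t] is the price of returning from [tilde] to [u]. *)
Lemma barrier_principle (R : realType) (N : nat) (Omega : set 'rV[R]_N) (T lambda alpha : R)
  (chi : R -> R) (C0 : R) (u0 v0 m0 : 'rV[R]_N -> R) :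
  smooth_bounded_domain Omega -> 0 < T -> 0 < lambda -> 0 < alpha ->
  admissible_sensitivity chi -> admissible_data Omega C0 u0 v0 m0 ->
  exists eps1 C, [/\ 0 < eps1, 1 <= C &
  forall eps u v m, 0 < eps <= eps1 ->
    nonnegative_solution Omega T lambda alpha chi u0 v0 m0 eps u v m ->
  forall (sigma t1 : R) (W Wt : 'rV[R]_N -> R -> R) (GW HW : R -> 'rV[R]_N -> 'rV[R]_N -> R),
  `|sigma| = 1 -> t1 <= T -> t1 <= 1 ->
  wcont (closure Omega `*` [set t | 0 <= t <= t1]) (fun p : 'rV[R]_N * R => W p.1 p.2) ->
  (forall t, 0 < t <= t1 -> C2on Omega (W ^~ t) (GW t) (HW t)) ->
  (forall x t, Omega x -> 0 < t <= t1 -> is_derive t 1 (W x) (Wt x t)) ->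
  (forall x, closure Omega x -> sigma * (u0 x - W x 0) < 0) ->
  (forall x nu t, boundary Omega x -> exterior_normal Omega x nu -> 0 < t <= t1 ->
    exists c d, [/\ 0 < c, 0 < d & forall h, 0 < h < d ->
      sigma * W (x - h *: nu) t <= sigma * W x t - c * h]) ->
  (forall x t, Omega x -> 0 < t <= t1 -> 0 <= W x t <= C ->
    sigma * (\sum_i HW t x (basis_vec i)) + C * (\sum_i `|GW t x (basis_vec i)|) + C * W x t
      + eps ^- 2 * (sigma * bistable (W x t) + C * t * W x t) < sigma * Wt x t) ->
  forall x t, Omega x -> 0 <= t <= t1 -> sigma * (u x t - W x t) <= C * t].
Proof.
move=> hOmega T0 l0 al0 hchi data; have [oO _ _ bO _] := hOmega.
have [eps1 [K [e10 K1 hU]]] := uniform_bounds hOmega T0 l0 al0 hchi data.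
have [Kd Kd0 [hK hK']] := v_upper hOmega data.
have dchi := chi_derive hchi.
have d3 (z : R) : is_derive z 1 (chi^`(2)%classic) (chi^`(3)%classic z).
  have := hchi.1 2%N z; rewrite [chi^`(3)%classic]derive1nS derive1E; exact: derivableP.
have [X1 X10 hX1] := real_bounded_on K (fun z => (dchi z).2).
have [X2 X20 hX2] := real_bounded_on K d3.
have K0 : 0 <= K := le_trans ler01 K1.
pose A := X1 * (lambda * K * K); have A0 : 0 <= A by rewrite !mulr_ge0 // ltW.
pose Wm := K * expR A; have Wm0 : 0 <= Wm by rewrite mulr_ge0 ?expR_ge0.
pose Gb := X1 * Kd; have Gb0 : 0 <= Gb by rewrite mulr_ge0 // ltW.
pose Hb := X2 * Kd ^+ 2 + X1 * Kd; have Hb0 : 0 <= Hb by rewrite addr_ge0 ?mulr_ge0 ?sqr_ge0 // ltW.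
pose a := K + 2 * Gb; pose b := Hb + (K + Gb) * Gb; pose q := lambda * (X1 * (K * K)).
pose r := (2 * (expR A * Wm) ^+ 2 + 2 * (expR A * Wm)) * A.
have a0 : 0 <= a by apply: addr_ge0 => //; apply: mulr_ge0.
have b0 : 0 <= b by apply: addr_ge0 => //; apply: mulr_ge0 => //; apply: addr_ge0.
have q0 : 0 <= q.
  by apply: mulr_ge0 (ltW l0) _; apply: mulr_ge0 (ltW X10) _; exact: mulr_ge0.
have EW0 : 0 <= expR A * Wm by apply: mulr_ge0 => //; exact: expR_ge0.
have rr0 : 0 <= 2 * (expR A * Wm) ^+ 2 + 2 * (expR A * Wm).
  by apply: addr_ge0; apply: mulr_ge0 => //; exact: sqr_ge0.
have r0 : 0 <= r by exact: mulr_ge0.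
have Nb0 : 0 <= N%:R * b by exact: mulr_ge0.
pose C := 1 + Wm + a + (N%:R * b + q) + r + K * (expR A * A).
have KA0 : 0 <= K * (expR A * A) by apply: mulr_ge0 => //; apply: mulr_ge0 => //; exact: expR_ge0.
have [C1 CW Ca Cb Cr] : [/\ 1 <= C, Wm <= C, a <= C, N%:R * b + q <= C &
    r <= C /\ K * (expR A * A) <= C].
  by clear - Wm0 a0 Nb0 q0 r0 KA0; rewrite /C; split; [| | | |split]; lra.
clearbody C.
exists eps1, C; split=> // eps u v m ee s sigma t1 W Wt GW HW s1 t1T t11 Wc WC Wd Wini Wbd Wint.
have e0 : 0 < eps by case/andP: ee.
have [umK vK gK _] := hU eps u v m ee s.
have [s' pu pv pm] := s.
have [cu cv cm ueq veq meq ini uneu mneu] := s'.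
have tT0 t : 0 <= t <= t1 -> 0 <= t <= T by move=> /andP[-> /le_trans ->].
have tT t : 0 < t <= t1 -> 0 < t <= T by move=> /andP[-> /le_trans ->].
have tt01 t : 0 < t <= t1 -> 0 <= t <= t1 by move=> /andP[/ltW -> ->].
have vd x t : closure Omega x -> 0 <= t <= T -> `|chi (v x t) - chi (v0 x)| <= A * t.
  rewrite /A -mulrA.
  apply: (chi_drop hOmega T0 l0 al0 hchi data s K0 (ltW X10) hX1) => //.
  by move=> y t' Oy tt; have [_ h] := umK y t' (subset_closure Oy) tt.
have zT : 0 <= (0 : R) <= T by rewrite lexx ltW.
have v0K x : Omega x -> 0 <= v0 x <= K.
  by move=> Ox; have [_ <- _] := initial_closure T0 data s (subset_closure Ox); exact: vK.
have [_ v0C _] := data_C2 data; have [v0C2 /wcontP v0c _] := v0C.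
pose g x := chi (v0 x).
have gC : C2on Omega g _ _ := C2on_comp (Ck_on_C2on oO v0C2) (fun x _ => dchi (v0 x)).
have gc : wcont (closure Omega) g.
  by apply: (wcont_real v0c) => p _; exact: is_derive_continuous (dchi _).1.
have gN x nu : boundary Omega x -> exterior_normal Omega x nu -> flat g x nu.
  by move=> bx ex; exact: flat_comp (dchi _).1 (zero_normal_flat (data_v0_neumann data) bx ex).
have vN x nu t : boundary Omega x -> exterior_normal Omega x nu -> 0 < t <= t1 -> flat (v ^~ t) x nu.
  by move=> bx ex tt; exact: (v_flat hOmega T0 l0 al0 data s bx ex (tT t tt)).
have Vt x t : closure Omega x -> 0 <= t <= t1 -> [/\ `|chi (v x t) - g x| <= A * t,
    `|g x - chi (v x t)| <= A * t & `|g x - chi (v x t)| <= A].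
  move=> cx tt; have h := vd x t cx (tT0 t tt); split=> //; rewrite distrC //.
  apply: (le_trans h); rewrite ler_piMr //; case/andP: tt => _ /le_trans; exact.
have tb x t : closure Omega x -> 0 <= t <= t1 -> 0 <= tilde chi u v g x t <= Wm.
  move=> cx tt; have [u0' _ _] := nonneg_closure s cx (tT0 t tt); have [uK _] := umK x t cx (tT0 t tt).
  have [_ _ h] := Vt x t cx tt; rewrite /tilde mulr_ge0 ?expR_ge0 //=; apply: ler_pM => //.
  by rewrite ler_expR (le_trans (ler_norm _)).
have main : forall x t, closure Omega x -> 0 <= t <= t1 -> sigma * (tilde chi u v g x t - W x t) < 0.
  apply: (comparison hOmega hchi s' gC gc gN t1T vN (GW := GW) (HW := HW) (Wt := Wt)) => //.
  - by rewrite -normr_eq0 s1 oner_neq0.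
  - move=> x cx; rewrite /tilde; have [-> -> _] := initial_closure T0 data s cx.
    by rewrite subrr expR0 mulr1; exact: Wini.
  move=> x t Ox tt tW; have cx := subset_closure Ox; have tt0 := tt01 t tt.
  have wb := tb x t cx tt0; rewrite tW in wb; have /andP[w0 wW] := wb.
  apply: le_lt_trans (Wint x t Ox tt _); last by rewrite w0 (le_trans wW).
  have [V1 V2 V3] := Vt x t cx tt0.
  have /andP[vx0 vxK] := vK x t Ox (tT0 t tt0); have [_ mx] := umK x t cx (tT0 t tt0).
  have mx0 : 0 <= m x t by have [] := nonneg_closure s cx (tT0 t tt0).
  rewrite /tilde_rhs !mulrDr.
  set w := W x t in w0 wW wb *; set V := chi (v x t) - g x.
  have -> : g x - chi (v x t) = - V by rewrite opprB.
  rewrite -/V in V1.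
  have VA : `|V| <= A by rewrite -normrN opprB.
  set S1 := \sum_i (_ + _ - _).
  have sN (y : R) : sigma * y <= `|y| by apply: le_trans (ler_norm _) _; rewrite normrM s1 mul1r.
  have b1 : sigma * S1 <= sigma * (\sum_i HW t x (basis_vec i)) + a * (\sum_i `|GW t x (basis_vec i)|)
      + N%:R * b * w.
    have e1 i := @enorm_basis R N i.
    have bG i : `|chi^`()%classic (v0 x) * gr v0 x (basis_vec i)| <= Gb.
      have [h _] := hK' x (basis_vec i) Ox; rewrite e1 mulr1 in h.
      by rewrite normrM; apply: ler_pM => //; exact: hX1 (v0K x Ox).
    have bD i : `|drift chi v x t i| <= K.
      by have := gK x t (basis_vec i) Ox (tT t tt); rewrite e1 mulr1.
    have bH i : `|chi^`(2)%classic (v0 x) * gr v0 x (basis_vec i) ^+ 2 +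
        chi^`()%classic (v0 x) * he v0 x (basis_vec i)| <= Hb.
      have [h1 h2] := hK' x (basis_vec i) Ox; rewrite -enorm_sqr e1 expr1n !mulr1 in h1 h2.
      apply: le_trans (ler_normD _ _) _; apply: lerD; rewrite normrM.
        apply: ler_pM => //; first exact: hX2 (v0K x Ox).
        by rewrite normrX ler_pXn2r // nnegrE // ltW.
      by apply: ler_pM => //; exact: hX1 (v0K x Ox).
    apply: (@le_sum_norm R N sigma a b w _ _ (fun i => drift chi v x t i - 2 * (chi^`()%classic (v0 x) *
      gr v0 x (basis_vec i)))) => // i.
      apply: le_trans (ler_normB _ _) _; apply: lerD => //.
      by rewrite normrM gtr0_norm // ler_pM2l.
    apply: le_trans (ler_normD _ _) _; apply: lerD => //.
    rewrite normrM; apply: ler_pM => //.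
    by apply: le_trans (ler_normB _ _) _; exact: lerD.
  set Q := w * (lambda * _).
  have b2 : sigma * Q <= q * w.
    apply: le_trans (sN _) _; rewrite normrM (ger0_norm w0) mulrC; apply: ler_wpM2r => //.
    rewrite normrM (gtr0_norm l0) ler_pM2l // normrM; apply: ler_pM => //; first by apply: hX1; rewrite vx0.
    by rewrite ger0_norm ?mulr_ge0 //; apply: ler_pM.
  have b3 : sigma * (eps ^- 2 * (expR (- V) * bistable (expR V * w))) <=
      eps ^- 2 * (sigma * bistable w) + eps ^- 2 * (C * t * w).
    rewrite -mulrDr mulrCA; apply: ler_wpM2l; first by rewrite invr_ge0 exprn_ge0 // ltW.
    rewrite -lerBlDl -mulrBr; apply: le_trans (sN _) _.
    apply: le_trans (bistable_twist VA wb) _; apply: ler_wpM2r => //.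
    apply: (@le_trans _ _ (r * t)); last by apply: ler_wpM2r; [case/andP: tt0|case: Cr].
    rewrite /r -mulrA; apply: ler_wpM2l => //.
  have b4 : a * (\sum_i `|GW t x (basis_vec i)|) <= C * (\sum_i `|GW t x (basis_vec i)|).
    by apply: ler_wpM2r => //; apply: sumr_ge0.
  have b5 : N%:R * b * w + q * w <= C * w by rewrite -mulrDl ler_wpM2r.
  clear - b1 b2 b3 b4 b5.
  lra.
move=> x t Ox tt; have cx := subset_closure Ox; have [V1 V2 V3] := Vt x t cx tt.
have h1 := main x t cx tt; have [_ _ h2] := Vt x t cx tt.
have /andP[u1 u2] : 0 <= u x t <= K.
  by have [-> _ _] := nonneg_closure s cx (tT0 t tt); have [->] := umK x t cx (tT0 t tt).
have : sigma * (u x t - tilde chi u v g x t) <= C * t.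
  apply: le_trans (ler_norm _) _; rewrite normrM s1 mul1r.
  have -> : u x t - tilde chi u v g x t = - (u x t * (expR (g x - chi (v x t)) - 1)) by rewrite /tilde; ring.
  rewrite normrN normrM ger0_norm //.
  apply: (@le_trans _ _ (K * (expR A * (A * t)))).
    apply: ler_pM => //; apply: le_trans (expR_sub1_le V3) _.
    by apply: ler_wpM2l => //; exact: expR_ge0.
  rewrite (_ : _ * (_ * _) = K * (expR A * A) * t); last by ring.
  apply: ler_wpM2r; [by case/andP: tt|by case: Cr].
have -> : sigma * (u x t - W x t) = sigma * (u x t - tilde chi u v g x t) + sigma * (tilde chi u v g x t - W x t).
  by ring.
move: h1; clear; lra.
Qed.

(** * The transition profile and its gain *)

Section Profile.
Context {R : realType}.
Implicit Types (a z p : R).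

Lemma is_derive_glue (f1 f2 f1' f2' : R -> R) :
  (forall z : R, z <= 0 -> is_derive z 1 f1 (f1' z)) ->
  (forall z : R, 0 <= z -> is_derive z 1 f2 (f2' z)) -> f1 0 = f2 0 -> f1' 0 = f2' 0 ->
  forall z : R, is_derive z 1 (fun y => if y < 0 then f1 y else f2 y)
    (if z < 0 then f1' z else f2' z).
Proof.
move=> d1 d2 f0 f0' z; apply/is_derive_epsP => e e0.
have [zn|zp] := ltP z 0.
  have /is_derive_epsP/(_ e e0)[d dd hd] := d1 z (ltW zn).
  exists (Num.min d (- z)) => [|h hN0]; first by rewrite lt_min dd oppr_gt0.
  rewrite lt_min => /andP[h1 h2]; have := ler_norm h.
  rewrite [_%:A]mulr1 => h3; rewrite ifT; last by move: h2 h3; clear; lra.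
  by have := hd h hN0 h1; rewrite [_%:A]mulr1.
move: zp; rewrite le_eqVlt => /orP[/eqP z0|zp]; last first.
  have /is_derive_epsP/(_ e e0)[d dd hd] := d2 z (ltW zp).
  exists (Num.min d z) => [|h hN0]; first by rewrite lt_min dd.
  rewrite lt_min => /andP[h1 h2]; have := ler_norm (- h); rewrite normrN.
  rewrite [_%:A]mulr1 => h3; rewrite ifF; last by apply/negbTE; rewrite -leNgt; move: h2 h3; clear; lra.
  by have := hd h hN0 h1; rewrite [_%:A]mulr1.
subst z.
have /is_derive_epsP/(_ e e0)[d dd hd] := d1 0 (lexx 0).
have /is_derive_epsP/(_ e e0)[d' dd' hd'] := d2 0 (lexx 0).
exists (Num.min d d') => [|h hN0]; first by rewrite lt_min dd.
rewrite lt_min => /andP[h1 h2]; have := hd h hN0 h1; have := hd' h hN0 h2.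
by rewrite !addr0 f0 f0'; case: ifP.
Qed.

(* For a profile Psi with Psi' z / 4 >= Psi (1/4 - Psi^2), the function
   1/2 + Psi (e^(t / (4 eps^2)) z) is a supersolution of w' = eps^-2 f(w).
   This choice is C^2 at 0 and tends to - 1/a at -oo. *)
Definition profile a z : R := if z < 0 then (1 - a * z)^-1 * z else z + a * z ^+ 2.
Definition profile1 a z : R := if z < 0 then (1 - a * z)^-1 ^+ 2 else 1 + 2 * a * z.
Definition profile2 a z : R := if z < 0 then 2 * a * (1 - a * z)^-1 ^+ 3 else 2 * a.

Variable a : R.
Hypothesis a2 : 2 < a.

Let a0 : 0 < a. Proof. exact: lt_trans a2. Qed.

Let den z : z <= 0 -> 1 <= 1 - a * z.
Proof. by move=> z0; rewrite lerDl oppr_ge0 mulr_ge0_le0 // ltW. Qed.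

Let den_derive z : z <= 0 -> is_derive z (1 : R) (fun y => (1 - a * y)^-1) (a * (1 - a * z)^-1 ^+ 2).
Proof.
move=> z0; have n0 : 1 - a * z != 0 by rewrite gt_eqF // (lt_le_trans _ (den z0)).
have h : is_derive z (1 : R) (fun y => 1 - a * y) (- a).
  have h := is_derive_affine 1 (- a) z.
  by rewrite (_ : (fun y => 1 - a * y) = (fun r => 1 + - a * r)) //; apply/funext => y; rewrite mulNr.
have h2 := is_deriveV (f := fun y => 1 - a * y) n0 h.
by apply: (is_derive_eq h2); rewrite /GRing.scale /= mulrNN mulrC exprVn.
Qed.

Lemma profile_derive z : is_derive z 1 (profile a) (profile1 a z).
Proof.
apply: (is_derive_glue (f1 := fun z => (1 - a * z)^-1 * z) (f2 := fun z => z + a * z ^+ 2)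
  (f1' := fun z => (1 - a * z)^-1 ^+ 2) (f2' := fun z => 1 + 2 * a * z)).
- move=> {}z z0; apply: (is_derive_eq (is_derive_mulf (den_derive z0) (is_derive_id z 1))).
  have n0 : 1 - a * z != 0 by rewrite gt_eqF // (lt_le_trans _ (den z0)).
  by field.
- move=> {}z _.
  have sq : is_derive z (1 : R) (fun y => y ^+ 2) (1 * z + z * 1).
    exact: is_derive_mulf (is_derive_id z 1) (is_derive_id z 1).
  by apply: (is_derive_eq (is_derive_addf (is_derive_id z 1) (is_derive_scalef a sq))); ring.
- by rewrite mulr0 expr0n /= !mulr0 addr0.
- by rewrite !mulr0 subr0 invr1 expr1n addr0.
Qed.

Lemma profile1_derive z : is_derive z 1 (profile1 a) (profile2 a z).
Proof.
apply: (is_derive_glue (f1 := fun z => (1 - a * z)^-1 ^+ 2) (f2 := fun z => 1 + 2 * a * z)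
  (f1' := fun z => 2 * a * (1 - a * z)^-1 ^+ 3) (f2' := fun=> 2 * a)).
- move=> {}z z0.
  have sq := is_derive_mulf (den_derive z0) (den_derive z0).
  by apply: (is_derive_eq sq); ring.
- by move=> {}z _; exact: is_derive_affine.
- by rewrite !mulr0 subr0 invr1 expr1n addr0.
- by rewrite !mulr0 subr0 invr1 expr1n mulr1.
Qed.

Let q_props z : z < 0 -> 0 < (1 - a * z)^-1 /\ (1 - a * z)^-1 * (1 - a * z) = 1.
Proof.
move=> z0; have d := den (ltW z0); have d0 : 0 < 1 - a * z by exact: lt_le_trans d.
by split; [rewrite invr_gt0|rewrite mulVf // gt_eqF].
Qed.

Lemma profile1_gt0 z : 0 < profile1 a z.
Proof.
rewrite /profile1; case: (ltP z 0) => z0; first by have [h _] := q_props z0; exact: exprn_gt0.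
by rewrite ltr_wpDr // !mulr_ge0 // ltW.
Qed.

Lemma profile2_bounds z : 0 <= profile2 a z <= 2 * a * profile1 a z.
Proof.
have b0 : 0 < 2 * a by rewrite mulr_gt0.
rewrite /profile1 /profile2; case: (ltP z 0) => z0.
  have d := den (ltW z0); have [h _] := q_props z0.
  apply/andP; split; first by apply: mulr_ge0; [exact: ltW|apply: exprn_ge0; exact: ltW].
  rewrite ler_pM2l // exprS; apply: ler_piMl; first exact: sqr_ge0.
  by rewrite invf_le1 // (lt_le_trans _ d).
rewrite ltW //= -[X in X <= _]mulr1 ler_pM2l // lerDl !mulr_ge0 // ltW //.
Qed.

Lemma profile_ge z : z <= profile a z.
Proof.
rewrite /profile; case: (ltP z 0) => z0; last by rewrite lerDl mulr_ge0 ?sqr_ge0 // ltW.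
have d := den (ltW z0).
rewrite -[X in X <= _]mul1r ler_wnM2r ?(ltW z0) //.
by rewrite invf_le1 // (lt_le_trans _ d).
Qed.

Lemma profile_homo z y : z <= y -> profile a z <= profile a y.
Proof.
rewrite le_eqVlt => /orP[/eqP ->|zy]; first exact: lexx.
have [c _] := mean_value zy (fun c _ => profile_derive c).
move=> h; rewrite -subr_ge0 h mulr_ge0 ?subr_ge0 ?ltW //; exact: profile1_gt0.
Qed.

Lemma profile_upper Y z : 0 < Y -> z <= - Y -> profile a z <= - a^-1 + (a ^+ 2 * Y)^-1.
Proof.
move=> Y0 zY; have z0 : z < 0 by rewrite (le_lt_trans zY) // oppr_lt0.
have [h1 h2] := q_props z0; rewrite /profile z0; set q := (1 - a * z)^-1 in h1 h2 *.
have aY : 0 < a ^+ 2 * Y by rewrite mulr_gt0 ?exprn_gt0.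
have -> : q * z = - a^-1 + q * a^-1.
  have e : q * z = - a^-1 * (q * (1 - a * z)) + q * a^-1 by field; rewrite gt_eqF.
  by rewrite e h2 mulr1.
rewrite lerD2l -(@ler_pM2l _ (a ^+ 2 * Y)) // mulfV ?gt_eqF // -h2.
rewrite (_ : _ * (q * _) = q * (a * Y)); last by field; rewrite gt_eqF.
rewrite ler_pM2l //; have : a * Y <= a * - z by rewrite ler_pM2l // lerNr.
rewrite mulrN; lra.
Qed.

(** On the negative side 1 / (1 - a z) equals 1 + a Psi and its square is the slope, so a small
    value of Psi keeps the slope away from 0. *)
Lemma profile_slope z : `|profile a z| <= (2 * a)^-1 -> 4^-1 <= profile1 a z.
Proof.
rewrite /profile /profile1; case: (ltP z 0) => z0 hz; last first.
  have : 0 <= 2 * a * z by rewrite !mulr_ge0 // ltW.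
  lra.
have [h1 h2] := q_props z0; set q := (1 - a * z)^-1 in h1 h2 hz *.
have e : q = 1 + a * (q * z) by rewrite -h2; ring.
have b : - 2^-1 <= a * (q * z).
  have : - (2 * a)^-1 <= q * z by move: hz; rewrite ler_norml => /andP[].
  rewrite -(@ler_pM2l _ a) // mulrN invfM mulrCA mulfV ?gt_eqF // mulr1; exact.
have q2 : 2^-1 <= q by rewrite e; lra.
by rewrite (_ : 4^-1 = 2^-1 ^+ 2 :> R); [rewrite ler_pXn2r // nnegrE // ltW|field].
Qed.

(** Four times the surplus in the supersolution inequality: 4 (Psi' z / 4 - Psi (1/4 - Psi^2)). *)
Definition profile_gain a z : R := profile1 a z * z - profile a z + 4 * profile a z ^+ 3.

(** For negative [z] the profile solves Psi' z = Psi + a Psi^2, so the gain is Psi^2 (a + 4 Psi). As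
    Psi > - 1/a, it is positive when a^2 > 4: this is where [2 < a] enters. *)
Lemma profile_gainE z : if z < 0 then
    profile_gain a z = profile a z ^+ 2 * (a + 4 * profile a z) /\ - a^-1 < profile a z < 0
  else 4 * profile a z ^+ 3 <= profile_gain a z /\ 0 <= profile a z.
Proof.
rewrite /profile_gain /profile /profile1; case: (ltP z 0) => z0; last first.
  split; last by rewrite addr_ge0 // mulr_ge0 ?sqr_ge0 // ltW.
  rewrite -subr_ge0 (_ : _ - _ = a * z ^+ 2); last by ring.
  by rewrite mulr_ge0 ?sqr_ge0 // ltW.
have [h1 h2] := q_props z0; set q := (1 - a * z)^-1 in h1 h2 *.
have e : q = 1 + a * (q * z) by rewrite -h2; ring.
split.
  rewrite (_ : q ^+ 2 * z - q * z = q * (q * z) - q * z); last by ring.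
  by rewrite {1}e; ring.
rewrite pmulr_rlt0 // z0 andbT -(@ltr_pM2l _ a) // mulrN mulfV ?gt_eqF //.
have := h1; rewrite {1}e; lra.
Qed.

Let aV4 : a^-1 < 4^-1 * a.
Proof.
rewrite -(@ltr_pM2l _ a) // mulfV ?gt_eqF //.
have : 2 * 2 < a * a by rewrite ltr_pM.
by move=> h; rewrite mulrCA; lra.
Qed.

Lemma profile_gain_ge0 z : 0 <= profile_gain a z.
Proof.
have := profile_gainE z; case: ifP => _ [].
  move=> -> /andP[h _]; rewrite mulr_ge0 ?sqr_ge0 //.
  have := aV4; lra.
by move=> h p0; apply: le_trans h; rewrite mulr_ge0 ?exprn_ge0.
Qed.

(** The gain vanishes only where the profile does, quadratically on the negative side; on the
    positive side the cubic part alone bounds it below. *)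
Lemma profile_gain_gt0 p : 0 < p -> exists2 k, 0 < k &
  forall z, p <= `|profile a z| -> k <= profile_gain a z.
Proof.
move=> p0; pose k1 := a - 4 * a^-1; have k10 : 0 < k1 by rewrite /k1; have := aV4; lra.
exists (Num.min (p ^+ 2 * k1) (4 * p ^+ 3)) => [|z].
  by rewrite lt_min !mulr_gt0 ?exprn_gt0.
have := profile_gainE z; case: ifP => _ [].
  move=> -> /andP[h1 h2]; rewrite ltr0_norm // => h3.
  rewrite ge_min; apply/orP; left; apply: ler_pM => //; [exact: sqr_ge0|exact: ltW| |].
    by rewrite -[X in _ <= X]sqrrN ler_pXn2r // nnegrE ?oppr_ge0 ltW.
  by rewrite /k1; lra.
move=> h1 h2; rewrite ger0_norm // => h3; rewrite ge_min; apply/orP; right; apply: le_trans h1.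
by rewrite ler_pM2l // ler_pXn2r // nnegrE // ltW.
Qed.

End Profile.

(** * The generation time and the barriers up to it *)

Section StoppingTime.
Context {R : realType}.
Implicit Types (eps : R).

(** The logarithm is sublinear, so the absolute value of ln eps is at most 1 / eps; this turns every
    O(t) error into O(eps). *)
Lemma generation_time_le eps : 0 < eps <= 1 -> 0 <= 4 * eps ^+ 2 * `|ln eps| <= 4 * eps.
Proof.
move=> /andP[e0 e1]; apply/andP; split; first by apply: mulr_ge0 => //; rewrite mulr_ge0 ?sqr_ge0.
rewrite -mulrA ler_pM2l //.
have l0 : ln eps <= 0 by rewrite -ln1 ler_ln ?posrE.
rewrite ler0_norm // expr2 -mulrA ler_piMr ?(ltW e0) //.
rewrite -(@ler_pM2l _ eps^-1) ?invr_gt0 // mulrA mulVf ?gt_eqF // mul1r mulr1.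
rewrite -lnV ?posrE //; apply: ltW; apply: ln_sublinear; rewrite invr_gt0 //.
Qed.

Lemma generation_time_expR eps : 0 < eps <= 1 ->
  expR (4^-1 * eps ^- 2 * (4 * eps ^+ 2 * `|ln eps|)) = eps^-1.
Proof.
move=> /andP[e0 e1]; have n0 : eps != 0 by rewrite gt_eqF.
have l0 : ln eps <= 0 by rewrite -ln1 ler_ln ?posrE.
rewrite ler0_norm // (_ : _ * _ = - ln eps); last by field.
by rewrite expRN lnK ?posrE.
Qed.

Lemma small_mul (A r e : R) : 0 <= A -> 0 < r -> 0 <= e -> e <= r / (A + 1) -> A * e < r.
Proof.
move=> A0 r0 e0; rewrite ler_pdivlMr ?ltr_wpDl // => h.
have [->|en] := eqVneq e 0; first by rewrite mulr0.
by apply: lt_le_trans h; rewrite mulrC ltr_pM2l ?ltrDl // lt_neqAle eq_sym en.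
Qed.

Lemma bistable_above (w : R) : 1 <= w -> bistable w <= - ((w - 1) / 2).
Proof.
move=> w1; rewrite -subr_ge0 (_ : _ - _ = (w - 1) ^+ 2 * (w + 2^-1)); last by rewrite /bistable; field.
by rewrite mulr_ge0 ?sqr_ge0 //; lra.
Qed.

End StoppingTime.

(** The margin [eta / 2] in the barrier makes the reaction negative by a multiple of [eps^-2 * eta],
    which dominates all bounded terms for small [eps]; the initial excess [D] is a bound on the data
    and decays before the final time. *)
Lemma upper_barrier (R : realType) (N : nat) (Omega : set 'rV[R]_N) (T lambda alpha : R)
  (chi : R -> R) (C0 : R) (u0 v0 m0 : 'rV[R]_N -> R) (eta : R) :
  smooth_bounded_domain Omega -> 0 < T -> 0 < lambda -> 0 < alpha ->
  admissible_sensitivity chi -> admissible_data Omega C0 u0 v0 m0 -> 0 < eta ->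
  exists2 eps0, 0 < eps0 & forall eps u v m, 0 < eps <= eps0 ->
    nonnegative_solution Omega T lambda alpha chi u0 v0 m0 eps u v m ->
    forall x, Omega x -> u x (4 * eps ^+ 2 * `|ln eps|) <= 1 + eta.
Proof.
move=> hOmega T0 l0 al0 hchi data e0; have [oO _ _ bO _] := hOmega.
have [eps1 [C [e10 C1 bar]]] := barrier_principle hOmega T0 l0 al0 hchi data.
have [D D0 [hD _]] := v_upper hOmega data.
have [psi [n [H [B [c df]]]]] := defining_function_exists hOmega.
have [ga [G [K2 [M [gC M0 gcont hg gbd]]]]] := boundary_weight oO df bO ltr01.
have C0' : 0 < C := lt_le_trans ltr01 C1.
pose NM := N%:R * M * (1 + C); have NM0 : 0 <= NM by apply: mulr_ge0; [apply: mulr_ge0 => //; exact: ltW|rewrite ltW // addr_gt0].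
pose del := (NM + 16 / eta + 1)^-1.
have s0 : 0 < 16 / eta by rewrite divr_gt0.
have d0 : 0 < NM + 16 / eta + 1 by clear - NM0 s0; lra.
have del0 : 0 < del by rewrite invr_gt0.
have delN : del * NM <= 1 by rewrite mulrC ler_pdivrMr // mul1r; clear - NM0 s0; lra.
have delE : del * 2 <= eta / 8.
  rewrite mulrC ler_pdivrMr // -subr_ge0 (_ : _ - _ = eta / 8 * (NM + 1)).
    by rewrite mulr_ge0 ?addr_ge0 // divr_ge0 // ltW.
  by field; rewrite gt_eqF.
pose A := 1 + 5 * C ^+ 2 + D + 4 * C.
have A0 : 0 <= A by rewrite /A !addr_ge0 ?mulr_ge0 ?sqr_ge0 ?ltW.
have e80 : 0 < eta / 8 by rewrite divr_gt0.
exists (Num.min (Num.min eps1 4^-1) (Num.min (T / 4) (eta / 8 / (A + 1)))).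
  by rewrite !lt_min e10 invr_gt0 ltr0n !divr_gt0 // ltr_wpDl.
move=> eps u v m /andP[ep0]; rewrite !le_min => /andP[/andP[ee1 ee2] /andP[ee3 ee4]] s x Ox.
have eA := small_mul A0 e80 (ltW ep0) ee4.
have ele1 : eps <= 1 by clear - ee2; lra.
have ele : 0 < eps <= 1 by rewrite ep0.
have /andP[ts0 ts1] := generation_time_le ele.
set ts := 4 * eps ^+ 2 * _ in ts0 ts1 *.
have tsT : ts <= T by clear - ts1 ee3; lra.
have ts11 : ts <= 1 by clear - ts1 ee2; lra.
have ep10 : 0 < eps <= eps1 by rewrite ep0.
(* The rate 1/2 is the slope in [bistable_above], so the decay of the exponential is paid exactly by
   the reaction. At the final time the exponential equals [eps ^+ 2]. *)
pose k := - (2^-1 * eps ^- 2).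
have ie : 0 < eps ^- 2 by rewrite invr_gt0 exprn_gt0.
have e2 : eps ^+ 2 <= eps by rewrite expr2 ler_piMr // ltW.
pose W (x : 'rV[R]_N) t := 1 + eta / 2 + D * expR (k * t) + del * ga x.
have Cee : C * eps <= C by rewrite ler_piMr // ltW.
have CC : 0 <= C ^+ 2 by exact: sqr_ge0.
have CCe : C ^+ 2 * eps <= C ^+ 2 by rewrite ler_piMr.
have CCe0 : 0 <= C ^+ 2 * eps by rewrite mulr_ge0 // ltW.
have Ce0 : 0 <= C * eps by rewrite mulr_ge0 // ltW.
have De0 : 0 <= D * eps by rewrite mulr_ge0 // ltW.
have eA' : eps + 5 * (C ^+ 2 * eps) + D * eps + 4 * (C * eps) < eta / 8.
  by apply: le_lt_trans eA; rewrite /A; clear; lra.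
have := bar eps u v m ep10 s 1 ts W (fun _ t => D * (k * expR (k * t)))
  (fun _ x p => 0 + del * G x p) (fun _ x p => 0 + del * K2 x p) (normr1 _) tsT ts11.
move=> /(_ _ _ _ _ _ _ x ts Ox) main.
have : 1 * (u x ts - W x ts) <= C * ts.
  apply: main; last by rewrite ts0 lexx.
  - apply: wcont_add; last first.
      apply: wcont_mul; first exact: wcont_cst.
      by apply: wcont_for => p _; apply: (@continuous_comp _ _ _ (fun p : 'rV[R]_N * R => p.1) ga);
        [exact: cvg_fst|exact: gcont].
    apply: wcont_add; first exact: wcont_cst.
    apply: wcont_mul; first exact: wcont_cst.
    apply: (wcont_real (phi := expR)); last by move=> p _; exact: continuous_expR.
    by apply: wcont_mul; [exact: wcont_cst|apply: wcont_for => p _; exact: cvg_snd].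
  - move=> t _; apply: C2on_add; last by apply: C2on_scale; exact: C2onS gC.
    exact: C2on_const.
  - move=> y t _ _.
    have h1 := is_derive_comp_real (f := fun r : R => k * r) (is_derive_expR _) (is_derive_scalef k (is_derive_id t 1)).
    have h2 := is_derive_addf (is_derive_addf (@is_derive_const R R^o (1 + eta / 2) t 1) (is_derive_scalef D h1))
      (@is_derive_const R R^o (del * ga y) t 1).
    by apply: (is_derive_eq h2); clear; ring.
  - move=> y cy; rewrite /W mulr0 expR0 mul1r.
    have [a1 _ _] := hD y cy; have [/andP[g1 g2] _ _] := hg y cy.
    have b1 : 0 <= del * ga y by rewrite mulr_ge0 ?ltW // (lt_le_trans ltr01).
    by have b2 := le_trans (ler_norm _) a1; clear - b1 b2 e0; lra.
  - move=> y nu t bx ex tt; have [d d00 hd] := gbd y nu bx ex.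
    exists del, d; split=> // h hh; rewrite !mul1r /W -!addrA !lerD2l -mulrBr ler_pM2l //.
    by have := hd h hh; rewrite mul1r.
  move=> y t Oy tt; rewrite !mul1r => /andP[W0 WC].
  have cy := subset_closure Oy; have [/andP[g1 g2] gG gK] := hg y cy.
  have bG i : `|0 + del * G y (basis_vec i)| <= del * M.
    have := gG (basis_vec i); rewrite enorm_basis mulr1 add0r normrM gtr0_norm // => h.
    by rewrite ler_pM2l.
  have bK i : 0 + del * K2 y (basis_vec i) <= del * M.
    have := gK (basis_vec i); rewrite -enorm_sqr enorm_basis expr1n mulr1 add0r => h.
    by rewrite ler_pM2l // (le_trans (ler_norm _)).
  have S1 := sum_bound bK; have S2 := sum_bound bG.
  have {S2} S2 := ler_wpM2l (ltW C0') S2.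
  have S3 : N%:R * (del * M) + C * (N%:R * (del * M)) <= 1.
    by apply: le_trans delN; rewrite /NM; clear; lra.
  set w := W y t in W0 WC *.
  have y0 : 0 <= D * expR (k * t) by rewrite mulr_ge0 ?expR_ge0 ?ltW.
  have g0 : 0 <= del * ga y by rewrite mulr_ge0 ?ltW // (lt_le_trans ltr01).
  have wE : w = 1 + eta / 2 + D * expR (k * t) + del * ga y by [].
  have w1 : 1 <= w by rewrite wE; clear - y0 g0 e0; lra.
  have fw : bistable w <= - (eta / 4) - D * expR (k * t) / 2.
    by apply: le_trans (bistable_above w1) _; rewrite wE; clear - g0; lra.
  have -> : D * (k * expR (k * t)) = eps ^- 2 * - (D * expR (k * t) / 2) by rewrite /k; clear; ring.
  have Cw : C * w <= C ^+ 2 by rewrite expr2 ler_pM2l.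
  have tt4 : t <= 4 * eps by case/andP: tt => _ h; exact: le_trans ts1.
  have Ct : C * t * w <= 4 * (C ^+ 2 * eps).
    rewrite mulrAC; apply: (@le_trans _ _ (C ^+ 2 * t)).
      by apply: ler_wpM2r => //; case/andP: tt => /ltW.
    by rewrite mulrCA ler_wpM2l // mulrC.
  have E1 : 1 + C ^+ 2 < eps ^- 2 * (eta / 8).
    rewrite -(@ltr_pM2l _ (eps ^+ 2)) ?exprn_gt0 // mulrA mulfV ?mul1r; last by rewrite gt_eqF ?exprn_gt0.
    apply: le_lt_trans eA'.
    have : eps ^+ 2 * (1 + C ^+ 2) <= eps * (1 + C ^+ 2) by rewrite ler_wpM2r // addr_ge0.
    by clear - CCe0 De0 Ce0; lra.
  have E2 : eps ^- 2 * (bistable w + C * t * w) <= eps ^- 2 * (- (eta / 8) - D * expR (k * t) / 2).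
    rewrite ler_pM2l //; clear - fw Ct eA' De0 Ce0 CCe0 ep0; lra.
  rewrite mulrBr mulrN in E2; rewrite mulrN; clear - S1 S2 S3 Cw E1 E2; lra.
rewrite mul1r /W.
have [/andP[g1 g2] _ _] := hg x (subset_closure Ox).
have kE : expR (k * ts) = eps ^+ 2.
  have h := generation_time_expR ele; rewrite -/ts in h.
  rewrite (_ : k * ts = - (4^-1 * eps ^- 2 * ts + 4^-1 * eps ^- 2 * ts)); last by rewrite /k; move: (eps ^- 2) => i; clear; field.
  by rewrite expRN expRD h -expr2 exprVn invrK.
rewrite kE.
have b1 : D * eps ^+ 2 <= D * eps by rewrite ler_pM2l.
have b2 : del * ga x <= del * 2 by rewrite ler_pM2l.
have b3 : C * ts <= C * (4 * eps) by rewrite ler_pM2l.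
clear - b1 b2 b3 delE eA' ep0 CCe0 e0; lra.
Qed.

Section TransitionArithmetic.
Context {R : realType}.

Lemma is_derive_decrease (f : R -> R) (z l : R) : is_derive z 1 f l -> 0 < l ->
  exists2 d, 0 < d & forall h, 0 < h < d -> f (z - h) <= f z - l / 2 * h.
Proof.
move=> /is_derive_epsP df l0; have l2 : 0 < l / 2 by rewrite divr_gt0.
have [d d0 hd] := df _ l2; exists d => // h /andP[h0 hh].
have hN : - h != 0 by rewrite oppr_eq0 gt_eqF.
have := hd (- h) hN; rewrite normrN (gtr0_norm h0) => /(_ hh).
rewrite [_%:A]mulr1 (addrC (- h) z) ltr_norml => /andP[a _].
have : l / 2 * h < (- h)^-1 * (f (z - h) - f z) * h.
  by rewrite ltr_pM2r //; move: a; clear; lra.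
rewrite (_ : (- h)^-1 * _ * h = f z - f (z - h)); first lra.
by field; rewrite gt_eqF.
Qed.

(** Here [e2] stands for eps^2 and [ie] for its inverse. The errors are at most C^2 (1 + ie t). If
    [P1 >= 1/4], the term with [8 * C ^+ 2 + 8] dominates because 1 + ie t <= 2 E^2; otherwise
    [gain >= g0], and [ie * gain / 4] dominates because eps^2 + t is small. *)
Lemma transition_supersolution (C t ie e2 P P1 Z E k0 g0 gain w S1 S2 : R) :
  0 < e2 -> ie * e2 = 1 -> 0 <= t -> 0 < P1 -> 0 <= w <= C -> 0 <= k0 ->
  S1 + S2 <= P1 * E ^+ 2 * k0 ->
  gain = P1 * Z - P + 4 * P ^+ 3 -> 0 <= gain -> 1 + ie * t <= 2 * E ^+ 2 ->
  4^-1 <= P1 \/ g0 <= gain -> C ^+ 2 * e2 + C ^+ 2 * t < g0 / 4 ->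
  S1 + S2 + C * w + ie * (P * (4^-1 - P ^+ 2) + C * t * w) <
  P1 * (4^-1 * ie * Z + (k0 + (8 * C ^+ 2 + 8)) * E ^+ 2).
Proof.
move=> e0 ee t0 P10 /andP[w0 wC] k00 hS gE g1 hE hor hg.
have ie0 : 0 < ie by rewrite -(pmulr_lgt0 _ e0) ee.
have C0 := le_trans w0 wC.
have a1 : C * w <= C ^+ 2 by rewrite expr2 ler_wpM2l.
have a2 : ie * (C * t * w) <= C ^+ 2 * (ie * t).
  rewrite (_ : _ * (_ * w) = ie * t * C * w); last by ring.
  by rewrite (_ : C ^+ 2 * _ = ie * t * C * C); [rewrite ler_wpM2l // !mulr_ge0 // ltW|ring].
have itp : 0 <= ie * t by rewrite mulr_ge0 // ltW.
suff : C ^+ 2 + C ^+ 2 * (ie * t) < ie * gain / 4 + P1 * E ^+ 2 * (8 * C ^+ 2 + 8).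
  have -> : P1 * (4^-1 * ie * Z + (k0 + (8 * C ^+ 2 + 8)) * E ^+ 2) =
    ie * gain / 4 + ie * (P * (4^-1 - P ^+ 2)) + P1 * E ^+ 2 * k0 + P1 * E ^+ 2 * (8 * C ^+ 2 + 8).
    by rewrite gE; field.
  by rewrite mulrDr; move: a1 a2 hS; clear; lra.
have C2 : 0 <= C ^+ 2 by exact: sqr_ge0.
have E2 : 0 <= E ^+ 2 by exact: sqr_ge0.
case: hor => h.
  have b1 : 4^-1 * ((1 + ie * t) / 2) * (8 * C ^+ 2 + 8) <= P1 * E ^+ 2 * (8 * C ^+ 2 + 8).
    apply: ler_wpM2r; first by move: C2; clear; lra.
    apply: ler_pM => //; first by move: itp; clear; lra.
    by move: hE; clear; lra.
  have b2 : 0 <= ie * gain / 4 by rewrite divr_ge0 // mulr_ge0 // ltW.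
  by move: b1 b2 C2 itp; clear; lra.
have b1 : ie * (C ^+ 2 * e2 + C ^+ 2 * t) < ie * (gain / 4).
  by rewrite ltr_pM2l //; move: hg h; clear; lra.
have b2 : 0 <= P1 * E ^+ 2 * (8 * C ^+ 2 + 8).
  by apply: mulr_ge0; [apply: mulr_ge0 => //; exact: ltW|move: C2; clear; lra].
rewrite mulrDr (mulrCA ie) ee mulr1 mulrA (mulrC ie) in b1.
by move: b1 b2; rewrite -(mulrA _ ie); clear; lra.
Qed.

End TransitionArithmetic.

(* The barrier is 1/2 + sigma Psi(Z) with Z = E (zeta + D eps^2 (E - 1)) and
   E = e^(t / (4 eps^2)).  The term D absorbs diffusion and drift where Psi is
   small; where Psi is not small, the gain of the profile does. *)
Lemma transition_barrier (R : realType) (N : nat) (Omega : set 'rV[R]_N) (T lambda alpha : R)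
  (chi : R -> R) (C0 : R) (u0 v0 m0 : 'rV[R]_N -> R) (eta B1 : R) :
  smooth_bounded_domain Omega -> 0 < T -> 0 < lambda -> 0 < alpha ->
  admissible_sensitivity chi -> admissible_data Omega C0 u0 v0 m0 -> 0 < eta < 1 -> 0 <= B1 ->
  exists eps0 Y, [/\ 0 < eps0, 0 < Y & forall eps u v m, 0 < eps <= eps0 ->
    nonnegative_solution Omega T lambda alpha chi u0 v0 m0 eps u v m ->
    forall (sigma : R) zeta G H, `|sigma| = 1 -> C2on Omega zeta G H ->
    wcont (closure Omega) zeta ->
    (forall x i, Omega x -> `|G x (basis_vec i)| <= B1 /\ `|H x (basis_vec i)| <= B1) ->
    (forall x nu, boundary Omega x -> exterior_normal Omega x nu ->
      exists c d, [/\ 0 < c, 0 < d & forall h, 0 < h < d -> zeta (x - h *: nu) <= zeta x - c * h]) ->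
    (forall x, closure Omega x -> sigma * (u0 x - 2^-1) < zeta x) ->
    forall x, Omega x -> zeta x <= - (Y * eps) ->
      sigma * (u x (4 * eps ^+ 2 * `|ln eps|) - 2^-1) <= - 2^-1 + eta].
Proof.
move=> hOmega T0 l0 al0 hchi data /andP[e0 e1] B10; have [oO _ _ bO _] := hOmega.
have [eps1 [C [e10 C1 bar]]] := barrier_principle hOmega T0 l0 al0 hchi data.
have C0' : 0 < C := lt_le_trans ltr01 C1.
(* The profile tends to [- a^-1 = - 1/2 + eta / 4] at -oo. Three further errors remain within [eta]:
   the distance to this limit, the amount [C * ts], and slack. *)
pose a := (2^-1 - eta / 4)^-1.
have aV0 : 0 < 2^-1 - eta / 4 by clear - e1; lra.
have aV : a^-1 = 2^-1 - eta / 4 by rewrite invrK.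
have a2 : 2 < a.
  by rewrite -[ltLHS]invrK ltf_pV2 ?posrE ?invr_gt0 //; clear - e0; lra.
have a0 : 0 < a := lt_trans (ltr0n _ 2) a2.
clearbody a.
have p00 : 0 < (2 * a)^-1 by rewrite invr_gt0 mulr_gt0.
have [g0 g00 hg0] := profile_gain_gt0 a2 p00.
(* Diffusion and drift of the barrier are at most [P1 * E ^+ 2 * k0]. The common factor [P1] is
   available because the second derivative of the profile is at most [2 * a] times the first. *)
pose k0 := N%:R * (2 * a * B1 ^+ 2 + B1) + C * (N%:R * B1).
have k00 : 0 <= k0.
  apply: addr_ge0; last by apply: mulr_ge0; [exact: ltW|exact: mulr_ge0].
  apply: mulr_ge0 => //; apply: addr_ge0 => //; apply: mulr_ge0; last exact: sqr_ge0.
  by rewrite mulr_ge0 // ltW.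
(* The term D eps^2 (E - 1) contributes D E^2 / 4 to the time derivative of [Z]: [k0] pays for
   diffusion and drift, [8 * C ^+ 2 + 8] for the reaction errors where the profile is steep. *)
pose D := 4 * (k0 + (8 * C ^+ 2 + 8)).
have CC : 0 <= C ^+ 2 by exact: sqr_ge0.
have D0 : 0 <= D by rewrite /D; clear - k00 CC; lra.
(* At the final time [E = 1 / eps], so [zeta x <= - (Y * eps)] gives [Z <= - Y + D = - eta^-1], far
   enough out on the profile. *)
pose Y := D + eta^-1.
have Y0 : 0 < Y by rewrite /Y ltr_wpDl // invr_gt0.
pose A := 5 * C ^+ 2 + 4 * C.
have A0 : 0 <= A by rewrite /A; clear - CC C0'; lra.
pose r := Num.min (g0 / 4) (eta / 4).
have r0 : 0 < r by rewrite lt_min !divr_gt0.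
exists (Num.min (Num.min eps1 4^-1) (Num.min (T / 4) (r / (A + 1)))), Y; split=> //.
  by rewrite !lt_min e10 invr_gt0 ltr0n !divr_gt0 // ltr_wpDl.
move=> eps u v m /andP[ep0]; rewrite 3!le_min => /andP[/andP[ee1 ee2] /andP[ee3 ee4]] s.
move=> sigma zeta G H s1 zC zc zB zN zini x Ox zx.
have := small_mul A0 r0 (ltW ep0) ee4; rewrite lt_min => /andP[eA1 eA2].
have ss : sigma * sigma = 1 by rewrite -expr2 -real_normK ?num_real // s1 expr1n.
have ele1 : eps <= 1 by clear - ee2; lra.
have ele : 0 < eps <= 1 by rewrite ep0.
have /andP[ts0 ts1] := generation_time_le ele.
have tsE := generation_time_expR ele.
set ts := 4 * eps ^+ 2 * _ in ts0 ts1 tsE *.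
have tsT : ts <= T by clear - ts1 ee3; lra.
have ts11 : ts <= 1 by clear - ts1 ee2; lra.
have ep10 : 0 < eps <= eps1 by rewrite ep0.
have ep2 : 0 < eps ^+ 2 by exact: exprn_gt0.
have ie : 0 < eps ^- 2 by rewrite invr_gt0.
have iee : eps ^- 2 * eps ^+ 2 = 1 by rewrite mulVf // gt_eqF.
have e2 : eps ^+ 2 <= eps by rewrite expr2 ler_piMr // ltW.
pose k := 4^-1 * eps ^- 2; have k_0 : 0 < k by rewrite mulr_gt0 // invr_gt0.
pose E t := expR (k * t).
have E1 t : 0 <= t -> 1 <= E t by move=> t0; rewrite -expR0 ler_expR mulr_ge0 // ltW.
pose Z (x : 'rV[R]_N) t := E t * (zeta x + D * eps ^+ 2 * (E t - 1)).
pose W x t := 2^-1 + sigma * profile a (Z x t).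
pose Zt x t := k * E t * (zeta x + D * eps ^+ 2 * (E t - 1)) + E t * (D * eps ^+ 2 * (k * E t)).
pose GW t x p := 0 + sigma * (profile1 a (Z x t) * (E t * (G x p + 0))).
pose HW t x p := 0 + sigma * (profile2 a (Z x t) * (E t * (G x p + 0)) ^+ 2 +
   profile1 a (Z x t) * (E t * (H x p + 0))).
have := bar eps u v m ep10 s sigma ts W (fun x t => sigma * (profile1 a (Z x t) * Zt x t)) GW HW s1 tsT ts11.
move=> /(_ _ _ _ _ _ _ x ts Ox) main.
have dprof z := conj (profile_derive a2 z) (profile1_derive a2 z).
have : sigma * (u x ts - W x ts) <= C * ts.
  apply: main; last by rewrite ts0 lexx.
  - apply: wcont_add; first exact: wcont_cst.
    apply: wcont_mul; first exact: wcont_cst.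
    apply: (wcont_real (phi := profile a)); last by move=> p _; exact: is_derive_continuous (dprof _).1.
    have Ec : wcont (closure Omega `*` [set t | 0 <= t <= ts]) (fun p : 'rV[R]_N * R => E p.2).
      apply: (wcont_real (phi := expR)); last by move=> p _; exact: continuous_expR.
      by apply: wcont_mul; [exact: wcont_cst|apply: wcont_for => p _; exact: cvg_snd].
    apply: wcont_mul => //; apply: wcont_add.
      by apply: (wcont_precomp zc (g := fun p : 'rV[R]_N * R => p.1)) => [p|p []//]; exact: cvg_fst.
    by apply: wcont_mul; [exact: wcont_cst|apply: wcont_sub => //; exact: wcont_cst].
  - move=> t _; apply: C2on_add; first exact: C2on_const.
    apply: C2on_scale.
    exact: (C2on_comp (C2on_scale (E t) (C2on_add zC (C2on_const (D * eps ^+ 2 * (E t - 1))))) (fun y _ => dprof _)).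
  - move=> y t _ _.
    have dE : is_derive t 1 E (k * E t).
      have h := is_derive_comp_real (f := fun r : R => k * r) (is_derive_expR _) (is_derive_scalef k (is_derive_id t 1)).
      by apply: (is_derive_eq h); rewrite mulr1 mulrC.
    have dZ : is_derive t 1 (Z y) (Zt y t).
      have h := is_derive_mulf dE (is_derive_addf (@is_derive_const R R^o (zeta y) t 1)
        (is_derive_scalef (D * eps ^+ 2) (is_derive_subf dE (@is_derive_const R R^o 1 t 1)))).
      by apply: (is_derive_eq h); rewrite subr0 add0r.
    have h := is_derive_addf (@is_derive_const R R^o 2^-1 t 1)
       (is_derive_scalef sigma (is_derive_comp_real (dprof _).1 dZ)).
    by apply: (is_derive_eq h); rewrite add0r.
  - move=> y cy; rewrite /W /Z /E mulr0 expR0 subrr mulr0 addr0 mul1r.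
    rewrite opprD addrA mulrDr mulrN mulrA ss mul1r subr_lt0.
    exact: lt_le_trans (zini y cy) (profile_ge a2 _).
  - move=> y nu t bx ex /andP[t0 tt]; have [c [d [c0 d0 hd]]] := zN y nu bx ex.
    have P0 := profile1_gt0 a2 (Z y t).
    have [d' d'0 hd'] := is_derive_decrease (profile_derive a2 (Z y t)) P0.
    exists (profile1 a (Z y t) / 2 * c), (Num.min d (d' / c)).
    split; [by rewrite mulr_gt0 // divr_gt0|by rewrite lt_min d0 divr_gt0|].
    move=> h /andP[h0]; rewrite lt_min => /andP[h1 h2].
    rewrite /W !mulrDr !mulrA ss !mul1r -addrA lerD2l -(mulrA _ c h).
    have ch : 0 < c * h by exact: mulr_gt0.
    apply: le_trans (hd' (c * h) _); last first.
      by rewrite ch /= mulrC -ltr_pdivlMr.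
    apply: (profile_homo a2); rewrite /Z.
    have zz := hd h; rewrite h0 h1 in zz; have {}zz := zz isT.
    have : E t * (zeta (y - h *: nu) + D * eps ^+ 2 * (E t - 1)) <=
        E t * (zeta y - c * h + D * eps ^+ 2 * (E t - 1)).
      by rewrite ler_wpM2l ?expR_ge0 // lerD2r.
    have : c * h <= E t * (c * h) by rewrite ler_peMl ?(ltW ch) // E1 // ltW.
    by clear; lra.
  move=> y t Oy /andP[t0 tt] wb.
  have E1t := E1 t (ltW t0); have E0 := lt_le_trans ltr01 E1t.
  have E2E : E t <= E t ^+ 2 by rewrite expr2 ler_peMl // ltW.
  have P10 := profile1_gt0 a2 (Z y t).
  have /andP[P20 P2b] := profile2_bounds a2 (Z y t).
  set P1 := profile1 a (Z y t) in P10 P2b *; set P2 := profile2 a (Z y t) in P20 P2b.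
  have S2 : C * (\sum_i `|GW t y (basis_vec i)|) <= P1 * E t ^+ 2 * (C * (N%:R * B1)).
    rewrite mulrCA ler_pM2l // mulrCA; apply: sum_bound => i.
    have [h _] := zB y i Oy; rewrite /GW add0r addr0 !normrM s1 mul1r (gtr0_norm P10) (gtr0_norm E0).
    rewrite -mulrA ler_pM2l //; apply: ler_pM => //; exact: ltW.
  have S1 : sigma * (\sum_i HW t y (basis_vec i)) <= P1 * E t ^+ 2 * (N%:R * (2 * a * B1 ^+ 2 + B1)).
    rewrite mulr_sumr mulrCA; apply: sum_bound => i.
    have [h1 h2] := zB y i Oy; rewrite /HW add0r !addr0 mulrA ss mul1r mulrDr; apply: lerD.
      apply: (@le_trans _ _ (2 * a * P1 * (E t ^+ 2 * B1 ^+ 2))); last first.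
        by rewrite le_eqVlt; apply/orP; left; apply/eqP; clear; ring.
      apply: ler_pM => //; first exact: sqr_ge0.
      rewrite exprMn; apply: ler_wpM2l; first exact: sqr_ge0.
      by rewrite -real_normK ?num_real // ler_pXn2r ?nnegrE.
    rewrite -/P1 -mulrA ler_pM2l //; apply: (@le_trans _ _ (E t * B1)); last by rewrite ler_wpM2r.
    by rewrite ler_pM2l // (le_trans (ler_norm _)).
  have fE : sigma * bistable (W y t) = profile a (Z y t) * (4^-1 - profile a (Z y t) ^+ 2).
    rewrite /W /bistable; move: (profile a _) => P.
    transitivity (sigma * sigma * P * (4^-1 - sigma * sigma * P ^+ 2)); first by clear; field.
    by rewrite ss !mul1r.
  have ZtE : Zt y t = 4^-1 * eps ^- 2 * Z y t + (k0 + (8 * C ^+ 2 + 8)) * E t ^+ 2.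
    transitivity (k * Z y t + E t * (D * eps ^+ 2 * (k * E t))); first by rewrite /Zt /Z (mulrA k).
    rewrite /k /D; congr (_ + _).
    transitivity (eps ^- 2 * eps ^+ 2 * ((k0 + (8 * C ^+ 2 + 8)) * E t ^+ 2)); last by rewrite iee mul1r.
    by move: (eps ^- 2) => i; clear; field.
  rewrite fE mulrA ss mul1r ZtE.
  apply: (transition_supersolution (e2 := eps ^+ 2) (g0 := g0) (gain := profile_gain a (Z y t))) => //.
  - exact: ltW.
  - by rewrite /k0 mulrDr; exact: lerD.
  - exact: profile_gain_ge0.
  - have := expR_ge1Dx (k * t + k * t); rewrite expRD -/(E t) -expr2 /k.
    have : 0 <= eps ^- 2 * t by rewrite mulr_ge0 // ltW.
    by clear; lra.
  - have [h|h] := leP `|profile a (Z y t)| (2 * a)^-1; [left|right].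
      exact: (profile_slope a2).
    by apply: hg0; exact: ltW.
  have b1 : C ^+ 2 * t <= C ^+ 2 * (4 * eps) by rewrite ler_wpM2l // (le_trans tt).
  have b2 : C ^+ 2 * eps ^+ 2 <= C ^+ 2 * eps by rewrite ler_wpM2l.
  have b3 : 0 <= C * eps by rewrite mulr_ge0 // ltW.
  by move: eA1; rewrite /A; clear - b1 b2 b3; lra.
have EE : E ts = eps^-1 by exact: tsE.
have zle : Z x ts <= - eta^-1.
  rewrite /Z EE.
  have h : eps^-1 * zeta x <= - Y.
    rewrite -[leRHS]mul1r -(mulVf (lt0r_neq0 ep0)) -mulrA ler_pM2l ?invr_gt0 //.
    by rewrite mulrN mulrC.
  have -> : eps^-1 * (zeta x + D * eps ^+ 2 * (eps^-1 - 1)) = eps^-1 * zeta x + D * (1 - eps).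
    by field; rewrite gt_eqF.
  have : D * (1 - eps) <= D by rewrite ler_piMr // gerBl ltW.
  by move: h; rewrite /Y; clear; lra.
have iv0 : 0 < eta^-1 by rewrite invr_gt0.
have pu := profile_upper a2 iv0 zle; rewrite aV in pu.
have pe : (a ^+ 2 * eta^-1)^-1 <= eta / 4.
  rewrite invfM invrK mulrC ler_pM2l // lef_pV2 ?posrE ?exprn_gt0 //.
  have : 2 ^+ 2 <= a ^+ 2 by rewrite ler_pXn2r ?nnegrE // ltW.
  by clear; rewrite expr2; lra.
rewrite /W opprD addrA mulrDr mulrN mulrA ss mul1r => h.
have b3 : C * ts <= C * (4 * eps) by rewrite ler_pM2l.
have b4 : 0 <= C ^+ 2 * eps by rewrite mulr_ge0 // ltW.
by move: eA2; rewrite /A; clear - h b3 b4 pu pe e0; lra.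
Qed.

(** * Initial data of the barriers *)

Lemma compact_separated (R : realType) (N : nat) (K1 K2 : set 'rV[R]_N) :
  compact K1 -> compact K2 -> (forall x, K1 x -> ~ K2 x) ->
  exists2 d, 0 < d & forall x z, K1 x -> K2 z -> d <= enorm (z - x).
Proof.
move=> c1 c2 disj; pose f (p : 'rV[R]_N * 'rV[R]_N) := (enorm (p.2 - p.1))^-1.
have pos x z : K1 x -> K2 z -> 0 < enorm (z - x).
  by move=> k1 k2; rewrite enorm_gt0 subr_eq0; apply: contra_notN (disj x k1) => /eqP <-.
have [|M M0 hM] := @wcont_bounded R _ (K1 `*` K2) f (compact_setX c1 c2).
  apply: (wcont_real (phi := GRing.inv)).
    apply: wcont_for => p _; apply: (@continuous_comp _ _ _ (fun p : 'rV[R]_N * 'rV[R]_N => p.2 - p.1) enorm).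
      by apply: cvgB; [exact: cvg_snd|exact: cvg_fst].
    exact: enorm_continuous.
  by move=> [x z] [/= k1 k2]; apply: inv_continuous; rewrite gt_eqF // pos.
exists M^-1 => [|x z k1 k2]; first by rewrite invr_gt0.
have := hM (x, z) (conj k1 k2); rewrite /f /= gtr0_norm ?invr_gt0 ?pos // => h.
by rewrite -[leRHS]invrK lef_pV2 ?posrE ?invr_gt0 // pos.
Qed.

(** The segment from [x] to [y] may leave the domain, so [quasiconvex_lipschitz] replaces it twice:
    for the partial derivatives, then for [f] minus its linear part. The first use concerns points
    at distance up to three times that of [y], hence the radius [c / (72 * B)] and the factor 75 = 5
    * 5 * 3. *)
Lemma domain_taylor (R : realType) (N : nat) (Omega : set 'rV[R]_N) psi n H (B c : R) f :
  open Omega -> bounded_set Omega -> defining Omega psi n H B c -> Ck_closure 2 Omega f ->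
  exists2 C, 0 < C & forall x y, Omega x -> Omega y -> enorm (y - x) <= c / (72 * B) ->
    `|f y - f x - gr f x (y - x)| <= C * dot (y - x) (y - x).
Proof.
move=> oO bO df fC; have [fC2 _ _] := fC; have [M M0 [_ hM]] := Ck_closure_bound bO fC.
have B0 : 0 < B := lt_le_trans ltr01 (df_B df); have c0 := df_c df.
exists (75 * (N%:R * M) + 1) => [|x y Ox Oy xy].
  by rewrite ltr_wpDl // !mulr_ge0 // ltW.
set D := enorm (y - x) in xy *; have D0 : 0 <= D by exact: enorm_ge0.
have rE : c / (24 * B) = 3 * (c / (72 * B)) by field; rewrite gt_eqF.
have r0 : 0 <= c / (72 * B) by rewrite divr_ge0 ?mulr_ge0 // ltW.
have dpart k z : Omega z -> forall p, is_derive z p (partial k f) (gr (partial k f) z p).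
  move=> Oz p; apply: (is_derive_gr p oO Oz) => [i w Ow|i]; first exact: (fC2 [:: k] isT).2.
  exact: (fC2 [:: i; k] isT).1.
have pL k z : Omega z -> enorm (z - x) <= 3 * D -> `|partial k f z - partial k f x| <= 15 * M * D.
  move=> Oz zx; apply: (@le_trans _ _ (5 * M * enorm (z - x))).
    apply: (quasiconvex_lipschitz oO df (f := partial k f) (G := gr (partial k f))) => //.
    - by apply: (le_trans zx); rewrite rE ler_pM2l.
    - exact: ltW.
    - by move=> w Ow _ p; have [_ _] := hM w p Ow; exact.
  rewrite (_ : 15 * M * D = 5 * M * (3 * D)); last by clear; ring.
  by rewrite ler_pM2l // mulr_gt0.
have fd z : Omega z -> forall p, is_derive z p (fun w => f w - dot (w - x) (gradient f x))
    (gr f z p - gr f x p).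
  move=> Oz p; have h1 := (Ck_on_C2on oO fC2 Oz p).1.
  have h2 := (@C2on_dot R N setT (gradient f x) z I p).1.
  have -> : (fun w => f w - dot (w - x) (gradient f x)) =
      (fun w => f w - (dot w (gradient f x) + - dot x (gradient f x))).
    by apply/funext => w; rewrite !dotE.
  have h3 := is_derive_subf h1 (is_derive_addf h2 (is_derive_const (- dot x (gradient f x)) z p)).
  by apply: (is_derive_eq h3); rewrite addr0 [gr f x p]gr_dot [dot p _]dotC.
have xyr : enorm (y - x) <= c / (24 * B).
  by rewrite rE; apply: (le_trans xy); rewrite ler_peMl // -[X in X <= _]/(1%:R) ler_nat.
have L0 : 0 <= N%:R * (15 * M * D) by rewrite !mulr_ge0 // ltW.
have h : `|f y - dot (y - x) (gradient f x) - (f x - dot (x - x) (gradient f x))| <=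
    5 * (N%:R * (15 * M * D)) * D.
  apply: (quasiconvex_lipschitz oO df (f := fun w => f w - dot (w - x) (gradient f x))
    (G := fun z p => gr f z p - gr f x p)) => // z Oz zx p.
  rewrite /gr -sumrB; apply: le_trans (ler_norm_sum _ _ _) _.
  apply: (@le_trans _ _ (\sum_(k < N) (15 * M * D) * enorm p)).
    apply: ler_sum => k _; rewrite -mulrBr normrM mulrC; apply: ler_pM => //; first exact: pL.
    exact: coord_le_enorm.
  by rewrite sumr_const card_ord -[X in X <= _]mulr_natl mulrA.
rewrite subrr dot0l subr0 in h.
rewrite gr_dot dotC addrAC; apply: le_trans h _.
rewrite -enorm_sqr -/D.
rewrite (_ : (75 * (N%:R * M) + 1) * D ^+ 2 = 5 * (N%:R * (15 * M * D)) * D + D * D).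
  by rewrite lerDl mulr_ge0.
by clear; ring.
Qed.

(** Beyond distance [r] the squared distance is bounded below, so a larger multiple of it dominates
    every bounded or linear term. [K] is fixed before [f], [x] and the coefficients, which makes the
    later barriers uniform in [x]. *)
Lemma quadratic_globalize (R : realType) (N : nat) (Omega : set 'rV[R]_N) psi n H (B c r K0 Kb bm betam : R) :
  bounded_set Omega -> open Omega -> defining Omega psi n H B c -> 0 < r -> 0 <= K0 -> 0 <= Kb -> 0 <= bm -> 0 <= betam ->
  exists2 K, 0 < K & forall f x s b beta, Omega x -> 0 <= beta <= betam -> enorm b <= bm ->
    (forall y, Omega y -> f y <= Kb) -> - Kb <= s ->
    (forall y, Omega y -> enorm (y - x) <= r ->
      f y <= s + dot b (y - x) + beta * (psi y - psi x) + K0 * dot (y - x) (y - x)) ->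
    forall y, Omega y -> f y <= s + dot b (y - x) + beta * (psi y - psi x) + K * dot (y - x) (y - x).
Proof.
move=> bO oO df r0 K00 Kb0 bm0 betam0; have pd := df_pre df.
have B0 : 0 < B := lt_le_trans ltr01 (df_B df).
have [Mn M1 hMn] := gradient_bounded df bO; have M0 := lt_le_trans ltr01 M1.
pose K := K0 + (2 * Kb / r ^+ 2 + (bm + betam * Mn) / r + betam * B).
have K1 : 0 <= 2 * Kb / r ^+ 2 + (bm + betam * Mn) / r + betam * B.
  apply: addr_ge0; last by rewrite mulr_ge0 // ltW.
  apply: addr_ge0; apply: divr_ge0; rewrite ?exprn_ge0 ?(ltW r0) ?mulr_ge0 //.
  by apply: addr_ge0 => //; rewrite mulr_ge0 // ltW.
exists (K + 1) => [|f x s b beta Ox /andP[be0 be1] hb hf hs loc y Oy].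
  by rewrite ltr_wpDl // /K addr_ge0.
have dd0 := dot_ge0 (y - x).
have [yx|yx] := leP (enorm (y - x)) r.
  apply: le_trans (loc y Oy yx) _; rewrite lerD2l; apply: ler_wpM2r => //.
  by rewrite /K; clear - K1; lra.
have h1 := cauchy_schwarz b (y - x); rewrite ler_norml in h1; case/andP: h1 => h1 _.
have h2 := predefining_taylor x y pd; rewrite ler_norml in h2; case/andP: h2 => h2 _.
have h3 := cauchy_schwarz (n x) (y - x); rewrite ler_norml in h3; case/andP: h3 => h3 _.
have nx := hMn x (subset_closure Ox).
set D := enorm (y - x) in yx h1 h3 *.
have D0 : 0 < D := lt_trans r0 yx.
have DE : dot (y - x) (y - x) = D ^+ 2 by rewrite enorm_sqr.
rewrite DE in h2 *.
set P := psi y - psi x in h2 *.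
have h4 : - (betam * (Mn * D + B * D ^+ 2)) <= beta * P.
  have P1 : - (Mn * D + B * D ^+ 2) <= P.
    have : enorm (n x) * D <= Mn * D by rewrite ler_pM2r.
    by clear - h2 h3; lra.
  have q0 : 0 <= Mn * D + B * D ^+ 2 by rewrite addr_ge0 // mulr_ge0 // ?exprn_ge0 // ltW.
  apply: (@le_trans _ _ (beta * - (Mn * D + B * D ^+ 2))); last by rewrite ler_wpM2l.
  by rewrite mulrN lerN2 ler_wpM2r.
have h5 : enorm b * D <= bm * D by rewrite ler_pM2r.
have i1 : 1 <= D / r by rewrite ler_pdivlMr // mul1r ltW.
have i2 : D <= D ^+ 2 / r by rewrite expr2 -mulrA ler_peMr // ltW.
have i3 : 1 <= D ^+ 2 / r ^+ 2.
  by rewrite -expr_div_n exprn_ege1.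
have j1 : 2 * Kb <= 2 * Kb / r ^+ 2 * D ^+ 2.
  by rewrite mulrAC -mulrA ler_peMr // mulr_ge0.
have j2 : (bm + betam * Mn) * D <= (bm + betam * Mn) / r * D ^+ 2.
  rewrite (_ : _ / r * _ = (bm + betam * Mn) * (D ^+ 2 / r)); last by rewrite mulrAC mulrA.
  by rewrite ler_wpM2l // addr_ge0 // mulr_ge0 // ltW.
have d2 : 0 <= D ^+ 2 by exact: sqr_ge0.
have j3 : 0 <= K0 * D ^+ 2 by rewrite mulr_ge0.
have := hf y Oy; rewrite /K !mulrDl mul1r; clear - j1 j2 j3 d2 h1 h4 h5 hs; lra.
Qed.

(* A variant of |g'|^2 <= 2 C g for nonnegative g: the point
   x - th q - C' th^2 |q|^2 (n x) lies in Omega because psi is negative there,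
   and g >= 0 at this point bounds q. *)
Lemma boundary_gradient (R : realType) (N : nat) (Omega : set 'rV[R]_N) psi n H (B c C1 P c' r : R) :
  bounded_set Omega -> defining Omega psi n H B c -> 0 < C1 -> 0 < P -> 0 < c' -> 0 < r ->
  exists2 L, 0 < L & forall g x p, Omega x -> enorm p <= P -> c' <= enorm (n x) ->
    (forall y, Omega y -> enorm (y - x) <= r ->
       0 <= g y <= g x + dot p (y - x) + C1 * dot (y - x) (y - x)) ->
    exists beta q, [/\ 0 <= beta <= P / c', q = p + beta *: n x & enorm q ^+ 2 <= L * g x].
Proof.
move=> bO df C10 P0 c'0 r0; have pd := df_pre df; have B1 := df_B df.
have B0 : 0 < B := lt_le_trans ltr01 B1.
have [Mn M1 hMn] := gradient_bounded df bO; have M0 := lt_le_trans ltr01 M1.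
(* With this choice the normal part of the displacement lowers [psi] by at least
   [5 * B * (th * e) ^+ 2], more than the Taylor error [4 * B * (th * e) ^+ 2]. *)
pose C' := 5 * B / c' ^+ 2.
have c2 : 0 < c' ^+ 2 by exact: exprn_gt0.
have C'0 : 0 < C' by rewrite divr_gt0 // mulr_gt0.
have C'c : C' * c' ^+ 2 = 5 * B by rewrite divfK // gt_eqF.
clearbody C'.
pose S := 2 * (C' * P * Mn) + 8 * C1 + 2 * P / r + 1.
have s1 : 0 < C' * P * Mn by rewrite !mulr_gt0.
have s2 : 0 < 2 * P / r by rewrite divr_gt0 // mulr_gt0.
have S0 : 0 < S by rewrite /S; clear - s1 s2 C10; lra.
pose th := S^-1; have th0 : 0 < th by rewrite invr_gt0.
have thS : th * S = 1 by rewrite mulVf // gt_eqF.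
clearbody th.
have t1 : 0 < th * (C' * P * Mn) by exact: mulr_gt0.
have t2 : 0 < th * (2 * P / r) by exact: mulr_gt0.
have t3 : 0 < th * C1 by exact: mulr_gt0.
have thS' : 2 * (th * (C' * P * Mn)) + 8 * (th * C1) + th * (2 * P / r) + th = 1.
  by rewrite -[RHS]thS /S; clear; ring.
clear thS.
exists (2 / th) => [|g x p Ox pP nx loc]; first by rewrite divr_gt0.
set nn := n x in nx *.
have nn0 : 0 < enorm nn := lt_le_trans c'0 nx.
have nnM : enorm nn <= Mn := hMn x (subset_closure Ox).
have n2 : 0 < dot nn nn by rewrite -enorm_sqr exprn_gt0.
(* The least multiplier that makes [dot q nn] nonnegative: [q] is the projection of [p] onto a
   half-space. By complementarity [beta * dot q nn = 0], which gives [dot p q = |q|^2]. *)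
pose beta := Num.max 0 (- dot p nn / dot nn nn).
pose q := p + beta *: nn.
have b0 : 0 <= beta by rewrite le_max lexx.
have pn := cauchy_schwarz p nn; rewrite ler_norml in pn; case/andP: pn => pn1 pn2.
have b1 : beta <= P / c'.
  rewrite ge_max; apply/andP; split; first by rewrite divr_ge0 // ltW.
  rewrite ler_pdivrMr // -enorm_sqr.
  apply: (@le_trans _ _ (P * enorm nn)).
    by apply: (@le_trans _ _ (enorm p * enorm nn)); [clear - pn1; lra|rewrite ler_pM2r].
  rewrite expr2 mulrA ler_pM2r // mulrAC -mulrA ler_peMr ?(ltW P0) //.
  by rewrite ler_pdivlMr // mul1r.
have qn : dot q nn = dot p nn + beta * dot nn nn by rewrite /q dotDl dotZl.
have [qn0 bqn] : 0 <= dot q nn /\ beta * dot q nn = 0.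
  rewrite qn /beta; have [h|h] := leP (- dot p nn / dot nn nn) 0.
    rewrite !mul0r addr0; split=> //.
    by move: h; rewrite ler_pdivrMr // mul0r oppr_le0.
  by rewrite divfK ?gt_eqF // subrr mulr0.
have qq : dot p q = enorm q ^+ 2.
  rewrite enorm_sqr {2}/q [in RHS]dotDl dotZl (dotC nn) bqn addr0.
  by rewrite dotC.
have qP : enorm q <= P.
  apply: le_trans pP; have := dot_le p q; rewrite qq expr2.
  by have [->|q0] := eqVneq (enorm q) 0; [rewrite enorm_ge0|rewrite ler_pM2r // lt_def q0 enorm_ge0].
exists beta, q; split=> //; first by rewrite b0.
have := loc x Ox; rewrite subrr enorm0 => /(_ (ltW r0)) /andP[gx0 _].
have [q0|q0] := eqVneq (enorm q) 0.
  by rewrite q0 expr0n /= mulr_ge0 // divr_ge0 // ltW.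
have {}q0 : 0 < enorm q by rewrite lt_def q0 enorm_ge0.
set e := enorm q in qq qP q0 *.
pose y := x - (th *: q + (C' * (th * e) ^+ 2) *: nn).
have wE : y - x = - (th *: q + (C' * (th * e) ^+ 2) *: nn) by rewrite /y addrDK.
have the : 0 < th * e by exact: mulr_gt0.
have k1 : C' * (th * e) * enorm nn <= 1.
  apply: (@le_trans _ _ (th * (C' * P * Mn))); last by clear - thS' t1 t2 t3 th0; lra.
  rewrite (_ : _ * _ * _ = th * (C' * e * enorm nn)); last by clear; ring.
  rewrite ler_pM2l //; apply: ler_pM => //; first by rewrite mulr_ge0 // ltW.
  by rewrite ler_pM2l.
have wn : enorm (y - x) <= 2 * (th * e).
  rewrite wE enormN; apply: le_trans (enormD _ _) _; rewrite !enormZ -/e.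
  have cc0 : 0 <= C' * (th * e) ^+ 2 by apply: mulr_ge0 (ltW C'0) _; exact: sqr_ge0.
  rewrite (gtr0_norm th0) (ger0_norm cc0).
  rewrite (_ : C' * (th * e) ^+ 2 * enorm nn = th * e * (C' * (th * e) * enorm nn)); last by clear; ring.
  by rewrite mulr_natl mulr2n lerD2l ler_piMr // ltW.
have w2 : dot (y - x) (y - x) <= 4 * (th * e) ^+ 2.
  rewrite -enorm_sqr (_ : 4 * _ = (2 * (th * e)) ^+ 2); last by clear; ring.
  have : 0 <= 2 * (th * e) by rewrite mulr_ge0 // ltW.
  by move=> h; rewrite ler_pXn2r ?nnegrE.
have nw : dot nn (y - x) <= - (C' * (th * e) ^+ 2 * c' ^+ 2).
  rewrite wE dotNr dotDr !dotZr (dotC nn q) lerN2.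
  have : 0 <= th * dot q nn by rewrite mulr_ge0 // ltW.
  have : C' * (th * e) ^+ 2 * c' ^+ 2 <= C' * (th * e) ^+ 2 * dot nn nn.
    rewrite ler_pM2l ?mulr_gt0 ?exprn_gt0 // -enorm_sqr ler_pXn2r ?nnegrE //; first exact: ltW.
  by clear; lra.
have Oy : Omega y.
  apply: (pd_neg pd); have := predefining_taylor x y pd; rewrite ler_norml => /andP[_ tay].
  have px := pd_le0 pd Ox.
  have bw : B * dot (y - x) (y - x) <= B * (4 * (th * e) ^+ 2) by rewrite ler_pM2l.
  have pos : 0 < B * (th * e) ^+ 2 by rewrite mulr_gt0 // exprn_gt0.
  rewrite mulrAC C'c in nw; clear - tay px bw pos nw; lra.
have yr : enorm (y - x) <= r.
  apply: (le_trans wn); rewrite -(@ler_pM2r _ r^-1) ?invr_gt0 // divff ?gt_eqF //.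
  apply: (@le_trans _ _ (th * (2 * P / r))); last by clear - thS' t1 t2 t3 th0; lra.
  rewrite (_ : 2 * (th * e) / r = th * (2 * e / r)); last by clear; ring.
  by rewrite ler_pM2l // ler_pM2r ?invr_gt0 // ler_pM2l.
have /andP[gy0 gy1] := loc y Oy yr.
have pw : dot p (y - x) <= - (th * e ^+ 2) + C' * (th * e) ^+ 2 * (P * Mn).
  rewrite wE dotNr dotDr !dotZr qq opprD lerD2l -mulrN.
  apply: ler_wpM2l; first exact: mulr_ge0 (ltW C'0) (sqr_ge0 _).
  have : enorm p * enorm nn <= P * Mn by apply: ler_pM.
  by clear - pn1; lra.
have cw : C1 * dot (y - x) (y - x) <= C1 * (4 * (th * e) ^+ 2) by rewrite ler_pM2l.
have fin : th * e ^+ 2 * (1 - (th * (C' * P * Mn) + 4 * (th * C1))) <= g x.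
  rewrite (_ : _ * _ = th * e ^+ 2 - C' * (th * e) ^+ 2 * (P * Mn) - C1 * (4 * (th * e) ^+ 2)).
    by clear - gy0 gy1 pw cw; lra.
  by clear; ring.
have fin2 : th * e ^+ 2 * 2^-1 <= g x.
  apply: le_trans fin; rewrite ler_pM2l ?mulr_gt0 ?exprn_gt0 //.
  by clear - thS' t1 t2 t3 th0; lra.
rewrite mulrAC ler_pdivlMr // mulrC.
by clear - fin2; lra.
Qed.

(** The squared distance is multiplied by a boundary weight, which gives an outward slope
    proportional to the squared distance. This beats the linear term when [x] is far from the
    boundary; near it only [b = 0] is allowed. The term with [beta] helps, as [psi] decreases inward
    from the boundary. *)
Lemma test_function (R : realType) (N : nat) (Omega : set 'rV[R]_N) psi n H (B c K0 bm betam r : R) :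
  bounded_set Omega -> open Omega -> defining Omega psi n H B c -> 0 < K0 -> 0 <= bm -> 0 <= betam -> 0 < r ->
  exists2 B1, 0 <= B1 & forall x s b beta, Omega x -> 0 <= beta <= betam -> enorm b <= bm ->
    b = 0 \/ (forall z, boundary Omega z -> r <= enorm (z - x)) ->
    exists zeta G K, [/\ C2on Omega zeta G K, wcont (closure Omega) zeta,
      forall y i, Omega y -> `|G y (basis_vec i)| <= B1 /\ `|K y (basis_vec i)| <= B1,
      forall y nu, boundary Omega y -> exterior_normal Omega y nu ->
        exists c d, [/\ 0 < c, 0 < d & forall h, 0 < h < d -> zeta (y - h *: nu) <= zeta y - c * h] &
      (forall y, closure Omega y ->
        s + dot b (y - x) + beta * (psi y - psi x) + K0 * dot (y - x) (y - x) <= zeta y) /\ zeta x = s].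
Proof.
move=> bO oO df K00 bm0 betam0 r0; have pd := df_pre df; have B1 := df_B df; have c0 := df_c df.
have B0 : 0 < B := lt_le_trans ltr01 B1.
have [Mn M1 hMn] := gradient_bounded df bO; have M0 := lt_le_trans ltr01 M1.
(* The squared distance to [x] may shrink outward at relative rate at most [2 * (B / c)], and the
   weight is at most 2; a weight of this slope compensates and leaves a gain of one. *)
have A0 : 0 < 4 * (B / c) + 1 by rewrite ltr_wpDl // mulr_ge0 // divr_ge0 // ltW.
have [ga [G [K2 [M [gC M_0 gcont hg gbd]]]]] := boundary_weight oO df bO A0.
have [RO hRO] := (bounded_enormP Omega).1 bO.
pose Rd := 2 * `|RO|; have Rd0 : 0 <= Rd by rewrite mulr_ge0.
have diam x y : Omega x -> Omega y -> enorm (y - x) <= Rd.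
  move=> Ox Oy; apply: le_trans (enormD _ _) _; rewrite enormN.
  have := hRO x Ox; have := hRO y Oy; have := ler_norm RO; rewrite /Rd; clear; lra.
(* At distance at least [r] from [x], the slope [K] times the squared distance exceeds the length of
   [b]. *)
pose K := K0 + (bm + 2) / r ^+ 2.
have r2 : 0 < r ^+ 2 by exact: exprn_gt0.
have Kr : bm + 2 <= K * r ^+ 2.
  by rewrite /K mulrDl divfK ?gt_eqF // lerDr mulr_ge0 // ltW.
have KK : K0 <= K by rewrite /K lerDl divr_ge0 ?(ltW r2) // addr_ge0.
have K_0 : 0 < K := lt_le_trans K00 KK.
clearbody K.
pose GB := bm + betam * Mn + K * (2 * Rd * 2 + Rd ^+ 2 * M).
pose HB := betam * B + K * (4 + 4 * Rd * M + Rd ^+ 2 * M).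
have GB0 : 0 <= GB.
  by rewrite !addr_ge0 // ?mulr_ge0 ?addr_ge0 ?mulr_ge0 ?exprn_ge0 // ltW.
have HB0 : 0 <= HB.
  by rewrite !addr_ge0 // ?mulr_ge0 ?addr_ge0 ?mulr_ge0 ?exprn_ge0 // ltW.
exists (GB + HB) => [|x s b beta Ox /andP[be0 be1] hb hcase]; first exact: addr_ge0.
pose zeta y := s + dot (y - x) b + beta * (psi y - psi x) + K * (dot (y - x) (y - x) * ga y).
have lC : C2on setT (fun y => dot (y - x) b) (fun _ p => dot p b) (fun _ _ => 0).
  move=> y _ p; have [h1 h2] := @C2on_dot R N setT b y I p; split=> //.
  have -> : (fun y => dot (y - x) b) = (fun y => dot y b + - dot x b).
    by apply/funext => z; rewrite dotDl dotNl.
  by apply: (is_derive_eq (is_derive_addf h1 (is_derive_const (- dot x b) y p))); rewrite addr0.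
have zC : C2on setT zeta _ _ := C2on_add (C2on_add (C2on_add (C2on_const s) lC)
  (C2on_scale beta (C2on_add (pd_C2 pd) (C2on_const (- psi x)))))
  (C2on_scale K (C2on_mul (@C2on_sqdist R N setT x) gC)).
exists zeta; do 2 eexists; split.
- exact: C2onS zC.
- have dc (f : 'rV[R]_N -> R) : (forall y, {for y, continuous f}) -> wcont (closure Omega) f.
    by move=> h; apply: wcont_for => y _; exact: h.
  have ec : wcont (closure Omega) (fun y => dot (y - x) (y - x)).
    have -> : (fun y => dot (y - x) (y - x)) = (fun y => enorm (y - x) * enorm (y - x)).
      by apply/funext => y; rewrite -enorm_sqr expr2.
    have e1 : wcont (closure Omega) (fun y : 'rV[R]_N => enorm (y - x)).
      apply: dc => y; apply: (@continuous_comp _ _ _ (fun y : 'rV[R]_N => y - x) enorm).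
        exact: (cvgB (@cvg_id _ _) (cvg_cst x)).
      exact: enorm_continuous.
    exact: wcont_mul.
  apply: wcont_add; last first.
    by apply: wcont_mul; [exact: wcont_cst|apply: wcont_mul => //; exact: dc].
  apply: wcont_add; last first.
    apply: wcont_mul; first exact: wcont_cst.
    apply: wcont_sub; last exact: wcont_cst.
    by apply: dc => y; exact: predefining_continuous (ltW B0) pd.
  apply: wcont_add; first exact: wcont_cst.
  apply: dc; apply: (C2on_continuous lC (B := bm)) => y p; rewrite dotC.
  by apply: le_trans (cauchy_schwarz _ _) _; rewrite ler_wpM2r.
- move=> y i Oy; set p := basis_vec i.
  have e1 : enorm p = 1 by exact: enorm_basis.
  have [/andP[g1 g2] hG hK] := hg y (subset_closure Oy).
  have {hG} hG := hG p; have {hK} hK := hK p.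
  rewrite -enorm_sqr e1 expr1n mulr1 in hK; rewrite e1 mulr1 in hG.
  have D := diam x y Ox Oy; have D0 := enorm_ge0 (y - x).
  have n1 : `|dot (n y) p| <= Mn.
    apply: le_trans (cauchy_schwarz _ _) _; rewrite e1 mulr1; exact: hMn (subset_closure Oy).
  have d1 : `|dot (y - x) p| <= Rd.
    by apply: le_trans (cauchy_schwarz _ _) _; rewrite e1 mulr1.
  have d2 : `|dot (y - x) (y - x)| <= Rd ^+ 2.
    by rewrite -enorm_sqr ger0_norm ?sqr_ge0 // ler_pXn2r ?nnegrE.
  have b1 : `|dot p b| <= bm.
    by apply: le_trans (cauchy_schwarz _ _) _; rewrite e1 mul1r.
  have gN : `|ga y| <= 2 by rewrite ger0_norm // (le_trans ler01).
  have hB : `|H y p| <= B by have := pd_hess pd y p; rewrite -enorm_sqr e1 expr1n mulr1.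
  split.
    apply: (@le_trans _ _ GB); last by rewrite lerDl.
    rewrite add0r addr0; apply: le_trans (ler_normD _ _) _; apply: lerD.
      apply: le_trans (ler_normD _ _) _; apply: lerD => //.
      by rewrite normrM (ger0_norm be0); apply: ler_pM.
    rewrite normrM (gtr0_norm K_0) ler_pM2l //; apply: le_trans (ler_normD _ _) _; apply: lerD.
      rewrite !normrM (gtr0_norm (ltr0n _ 2)); apply: ler_pM => //.
      by rewrite ler_pM2l.
    by rewrite normrM; apply: ler_pM.
  apply: (@le_trans _ _ HB); last by rewrite lerDr.
  rewrite !addr0 add0r; apply: le_trans (ler_normD _ _) _; apply: lerD.
    by rewrite normrM (ger0_norm be0); apply: ler_pM.
  rewrite normrM (gtr0_norm K_0) ler_pM2l //; apply: le_trans (ler_normD _ _) _; apply: lerD; last first.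
    by rewrite normrM; apply: ler_pM.
  apply: le_trans (ler_normD _ _) _; apply: lerD.
    rewrite -enorm_sqr e1 expr1n mulr1 normrM (gtr0_norm (ltr0n _ 2)).
    by apply: (@le_trans _ _ (2 * 2)); [rewrite ler_pM2l|clear; lra].
  rewrite !normrM !(gtr0_norm (ltr0n _ 2)); apply: ler_pM => //.
  rewrite (_ : 4 * Rd = 2 * (2 * Rd)); last by clear; ring.
  by rewrite ler_pM2l // ler_pM2l.
- move=> y nu bx ex.
  have cy : closure Omega y by case: bx.
  have nOy : ~ Omega y by case/(boundary_openP _ oO): bx.
  have [_ nu1 _] := exterior_normalP oO df bx ex.
  have [/andP[g1 g2] _ _] := hg y cy.
  have [e1 e10 he1] := gbd y nu bx ex.
  set D2 := dot (y - x) (y - x).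
  have D20 : 0 < D2.
    rewrite /D2 -enorm_sqr exprn_gt0 // enorm_gt0 subr_eq0.
    by apply/eqP => yx; apply: nOy; rewrite yx.
  have quad : - dot nu (y - x) <= B / c * D2.
    have := exterior_quadratic oO df bx ex (subset_closure Ox).
    by rewrite -opprB dotNr dotNr dotNl opprK.
  set bc := B / c in quad A0 he1 *.
  have bc0 : 0 <= bc by rewrite divr_ge0 // ltW.
  have psiy := predefining_boundary oO (ltW B0) pd bx.
  have BB : 0 < c / (2 * B) by rewrite divr_gt0 // mulr_gt0.
  pose kk := K * D2 - enorm b.
  have kk0 : 0 < kk.
    rewrite /kk subr_gt0; case: hcase => [->|far]; first by rewrite enorm0 mulr_gt0.
    apply: (le_lt_trans hb); have rD : r ^+ 2 <= D2.
      by rewrite /D2 -enorm_sqr ler_pXn2r ?nnegrE ?(ltW r0) //; exact: far.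
    have : K * r ^+ 2 <= K * D2 by rewrite ler_pM2l.
    by clear - Kr; lra.
  have k4 : 0 < kk / (4 * K) by rewrite divr_gt0 // mulr_gt0.
  exists (kk / 2), (Num.min (Num.min e1 (c / (2 * B))) (Num.min (kk / (4 * K)) (4 * bc + 1)^-1)).
  split; [by rewrite divr_gt0|by rewrite !lt_min e10 BB k4 invr_gt0 A0|].
  move=> h /andP[h0]; rewrite !lt_min => /andP[/andP[h1 h2] /andP[h3 h4]].
  have hga := he1 h; rewrite h0 h1 in hga; have {}hga := hga isT.
  have hpsi := @psi_decay _ _ _ _ _ _ _ _ oO df y nu h bx ex; rewrite h0 (ltW h2) in hpsi.
  have {}hpsi := hpsi isT.
  have be2 : beta * (psi (y - h *: nu) - psi x) <= beta * (psi y - psi x).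
    rewrite ler_wpM2l // lerD2r psiy; apply: (le_trans hpsi); rewrite oppr_le0.
    by rewrite !mulr_ge0 // ?invr_ge0 // ltW.
  have lin : dot (y - h *: nu - x) b <= dot (y - x) b + h * enorm b.
    rewrite (_ : y - h *: nu - x = (y - x) - h *: nu); last by rewrite addrAC.
    rewrite dotDl dotNl dotZl lerD2l -mulrN ler_pM2l //.
    have := cauchy_schwarz nu b; rewrite nu1 mul1r ler_norml => /andP[t _].
    by clear - t; lra.
  have sq : dot (y - h *: nu - x) (y - h *: nu - x) = D2 - 2 * h * dot nu (y - x) + h ^+ 2.
    rewrite (_ : y - h *: nu - x = (y - x) - h *: nu); last by rewrite addrAC.
    rewrite /D2; move: (y - x) => w; rewrite !dotE (dotC w nu) -[dot nu nu]enorm_sqr nu1; clear; ring.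
  have Ah : (4 * bc + 1) * h <= 1.
    by move: h4; rewrite -[(_ + 1)^-1]mul1r ltr_pdivlMr // mulrC => /ltW.
  have prod : dot (y - h *: nu - x) (y - h *: nu - x) * ga (y - h *: nu) <=
      D2 * ga y - D2 * h + 2 * h ^+ 2.
    apply: (@le_trans _ _ ((D2 * (1 + 2 * h * bc) + h ^+ 2) * (ga y - (4 * bc + 1) * h))).
      apply: (@le_trans _ _ (dot (y - h *: nu - x) (y - h *: nu - x) * (ga y - (4 * bc + 1) * h))).
        by rewrite ler_wpM2l // dot_ge0.
      apply: ler_wpM2r; first by clear - Ah g1; lra.
      have : h * - dot nu (y - x) <= h * (bc * D2) by rewrite ler_pM2l.
      by rewrite sq; clear; lra.
    rewrite -subr_ge0 (_ : _ - _ = 2 * bc * (D2 * h) * (2 - ga y) + (2 - ga y) * h ^+ 2 +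
      h * (4 * bc + 1) * (D2 * (2 * h * bc) + h ^+ 2)); last by clear; ring.
    have g0 : 0 <= 2 - ga y by rewrite subr_ge0.
    have z1 : 0 <= D2 * h by rewrite mulr_ge0 // ltW.
    have z2 : 0 <= h ^+ 2 by exact: sqr_ge0.
    have z3 : 0 <= D2 * (2 * h * bc) by exact: mulr_ge0 (ltW D20) (mulr_ge0 (mulr_ge0 (ler0n _ 2) (ltW h0)) bc0).
    apply: addr_ge0; last by apply: mulr_ge0; [rewrite mulr_ge0 // ltW|exact: addr_ge0].
    by apply: addr_ge0; apply: mulr_ge0 => //; apply: mulr_ge0 => //; exact: mulr_ge0.
  have Kprod : K * (dot (y - h *: nu - x) (y - h *: nu - x) * ga (y - h *: nu)) <=
      K * (D2 * ga y - D2 * h + 2 * h ^+ 2) by rewrite ler_pM2l.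
  have hk : 4 * K * h <= kk.
    by move: h3; rewrite ltr_pdivlMr ?mulr_gt0 // mulrC => /ltW.
  have hk2 : 4 * K * h * h <= kk * h by rewrite ler_pM2r.
  rewrite /zeta -/D2; move: be2 lin Kprod hk2; rewrite /kk.
  move: (dot (y - h *: nu - x) b) (dot (y - h *: nu - x) _ * _) (beta * (psi (_ - _ *: _) - _)) => q1 q2 q3.
  by clear; lra.
- split=> [y cy|]; last by rewrite /zeta !subrr !dot0l mul0r !mulr0 !addr0.
  have [/andP[g1 g2] _ _] := hg y cy.
  rewrite /zeta (dotC b) lerD2l; apply: ler_pM => //; [exact: ltW|exact: dot_ge0|].
  by rewrite ler_peMr // dot_ge0.
Qed.

(* Near the boundary 1/2 - u0 is nonnegative, so the part of its gradient that
   would give zeta the wrong sign of the normal derivative is at most of order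
   sqrt(1/2 - u0 x); it costs half of the value at x. *)
Lemma barrier_datum (R : realType) (N : nat) (Omega : set 'rV[R]_N) (C0 : R) (u0 v0 m0 : 'rV[R]_N -> R) :
  smooth_bounded_domain Omega -> admissible_data Omega C0 u0 v0 m0 ->
  exists2 B1, 0 <= B1 & forall sigma x, sigma = 1 \/ sigma = -1 /\ 2^-1 < u0 x ->
    Omega x -> sigma * (u0 x - 2^-1) <= 0 ->
    exists zeta G K, [/\ C2on Omega zeta G K, wcont (closure Omega) zeta,
      forall y i, Omega y -> `|G y (basis_vec i)| <= B1 /\ `|K y (basis_vec i)| <= B1,
      forall y nu, boundary Omega y -> exterior_normal Omega y nu ->
        exists c d, [/\ 0 < c, 0 < d & forall h, 0 < h < d -> zeta (y - h *: nu) <= zeta y - c * h] &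
      (forall y, closure Omega y -> sigma * (u0 y - 2^-1) <= zeta y) /\
      zeta x <= sigma * (u0 x - 2^-1) / 2].
Proof.
move=> hOmega data; have [oO _ _ bO _] := hOmega.
have [psi [n [H [B [c df]]]]] := defining_function_exists hOmega.
have pd := df_pre df; have c0 := df_c df.
have B0 : 0 < B := lt_le_trans ltr01 (df_B df).
have [uC _ _] := data_C2 data; have [_ /wcontP uc _] := uC.
have [Kd Kd0 [hK hK']] := Ck_closure_bound bO uC.
have [C Cp tay] := domain_taylor oO bO df uC.
have [d0 d00 sep] : exists2 d, 0 < d & forall x z, closure (Omega0 Omega u0) x ->
    boundary Omega z -> d <= enorm (z - x).
  apply: (compact_separated (data_Omega0_compact data) (compact_boundary bO)) => x cx bx.
  by case: ((boundary_openP x oO).1 bx) => _; apply; exact: (data_Omega0_sub data).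
(* [d0 / 2] keeps the neighbourhood of a point close to the boundary away from [Omega0];
   [c / (12 * B)] keeps the gradient of [psi] there above [c / 2]. *)
pose r0 := Num.min (d0 / 2) (c / (12 * B)).
pose r := Num.min r0 (c / (72 * B)).
have cB0 k : 0 < c / (k.+1%:R * B) by rewrite divr_gt0 // mulr_gt0.
have r00 : 0 < r0 by rewrite lt_min divr_gt0 //= (cB0 11%N).
have rp : 0 < r by rewrite lt_min r00 (cB0 71%N).
have [rr0 rr1] : r <= r0 /\ r <= c / (72 * B) by split; rewrite ge_min lexx ?orbT.
have [r0d r0c] : r0 <= d0 / 2 /\ r0 <= c / (12 * B) by split; rewrite ge_min lexx ?orbT.
clearbody r r0.
pose P := Kd + 1; have P0 : 0 < P by rewrite addr_gt0.
have gradP x : Omega x -> enorm (gradient u0 x) <= P.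
  move=> Ox; apply: (@le_trans _ _ Kd); last by rewrite lerDl.
  have [h _ _] := hK' x (gradient u0 x) Ox; rewrite gr_dot -enorm_sqr in h.
  have {}h := le_trans (ler_norm _) h; rewrite expr2 in h.
  have [->|q0] := eqVneq (enorm (gradient u0 x)) 0; first exact: ltW.
  by move: h; rewrite ler_pM2r // lt_def q0 enorm_ge0.
have c20 : 0 < c / 2 by rewrite divr_gt0.
have [L L0 hL] := boundary_gradient bO df Cp P0 c20 rp.
pose betam := P / (c / 2); have bm0 : 0 <= betam by rewrite divr_ge0 // ltW.
(* Taylor's formula for [u0], the Young inequality for the dropped gradient [q], and Taylor's
   formula for [psi]. *)
pose K0 := C + L / 2 + betam * B.
have K00 : 0 <= K0.
  apply: addr_ge0 _ (mulr_ge0 bm0 (ltW B0)); apply: addr_ge0; first exact: ltW.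
  by rewrite divr_ge0 // ltW.
have [K1 K10 glob] := quadratic_globalize bO oO df rp K00 (ltW P0) (ltW P0) bm0.
have [B1 B10 test] := test_function bO oO df K10 (ltW P0) bm0 r00.
exists B1 => // sigma x hs Ox fx.
have s1 : `|sigma| = 1 by case: hs => [->|[-> _]]; rewrite ?normrN normr1.
have fP y : Omega y -> `|sigma * (u0 y - 2^-1)| <= P.
  move=> Oy; rewrite normrM s1 mul1r; apply: le_trans (ler_normB _ _) _.
  have := hK y (subset_closure Oy); rewrite [`|2^-1|]gtr0_norm ?invr_gt0 // /P; clear; lra.
have fP1 y : Omega y -> sigma * (u0 y - 2^-1) <= P.
  by move=> Oy; exact: le_trans (ler_norm _) (fP y Oy).
have fP2 : - P <= sigma * (u0 x - 2^-1) by have := fP x Ox; rewrite ler_norml => /andP[].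
(* A quadratic majorant near [x] is enough: [quadratic_globalize] extends it to [Omega], and
   [test_function] corrects its normal derivative without changing the value [s] at [x]. *)
suff [s [b [beta [be hb hcase [sP loc sx]]]]] : exists s b beta, [/\ 0 <= beta <= betam, enorm b <= P,
    b = 0 \/ (forall z, boundary Omega z -> r0 <= enorm (z - x)) &
    [/\ - P <= s, forall y, Omega y -> enorm (y - x) <= r ->
      sigma * (u0 y - 2^-1) <= s + dot b (y - x) + beta * (psi y - psi x) + K0 * dot (y - x) (y - x) &
      s <= sigma * (u0 x - 2^-1) / 2]].
  have [zeta [G [K [zC zc zB zN [zge zx]]]]] := test x s b beta Ox be hb hcase.
  exists zeta, G, K; split=> //; split; last by rewrite zx.
  move=> y cy; rewrite -subr_le0.
  apply: (closure_le (f := fun y => sigma * (u0 y - 2^-1) - zeta y)) cy.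
    apply: wcont_sub => //; apply: wcont_mul; first exact: wcont_cst.
    by apply: wcont_sub => //; exact: wcont_cst.
  move=> w Ow; rewrite subr_le0; apply: le_trans (zge w (subset_closure Ow)).
  exact: (glob (fun y => sigma * (u0 y - 2^-1)) x s b beta Ox be hb fP1 sP loc w Ow).
(* Away from the boundary a linear term is allowed, so the tangent quadratic serves and nothing is
   lost at [x]. *)
have [far|near] := pselect (forall z, boundary Omega z -> r0 <= enorm (z - x)).
  exists (sigma * (u0 x - 2^-1)), (sigma *: gradient u0 x), 0; split.
  - by rewrite lexx.
  - by rewrite enormZ s1 mul1r; exact: gradP.
  - by right.
  split=> // [y Oy yx|]; last by move: fx; clear; lra.
  have := tay x y Ox Oy (le_trans yx rr1); rewrite gr_dot -[X in X <= _]mul1r -s1 -normrM => h.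
  have {}h := le_trans (ler_norm _) h; rewrite dotZl mul0r addr0.
  have : C * dot (y - x) (y - x) <= K0 * dot (y - x) (y - x).
    apply: ler_wpM2r; first exact: dot_ge0.
    rewrite /K0 -addrA lerDl; apply: addr_ge0; first by rewrite divr_ge0 // ltW.
    by apply: mulr_ge0 bm0 (ltW B0).
  by move: h; clear; lra.
have [z [bz zx]] : exists z, boundary Omega z /\ enorm (z - x) < r0.
  move/existsNP: near => [z /not_implyP[bz]]; move/negP; rewrite -ltNge => h.
  by exists z.
have zy y : enorm (y - x) <= r -> ~ closure (Omega0 Omega u0) y.
  move=> yx cy; have := sep y z cy bz; rewrite leNgt => /negP; apply.
  apply: le_lt_trans (enorm_sub_le z x y) _; rewrite (enormB x y).
  by move: zx yx rr0 r0d; clear; lra.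
(* The case [sigma = -1] comes with [2^-1 < u0 x], that is, [x] in [Omega0], whose closure is far
   from the boundary. *)
have sE : sigma = 1.
  case: hs => // -[_ ux]; exfalso; apply: (zy x); first by rewrite subrr enorm0 ltW.
  by apply: subset_closure.
rewrite sE !mul1r in fx fP2 *.
have nx : c / 2 <= enorm (n x).
  have h1 := df_nondeg df bz.
  have h2 := predefining_gradient_lipschitz z x (ltW B0) pd.
  have h3 := enormD (n z - n x) (n x); rewrite subrK in h3.
  have h4 : 6 * B * enorm (z - x) <= 6 * B * (c / (12 * B)).
    by rewrite ler_pM2l ?mulr_gt0 // ltW // (lt_le_trans zx).
  rewrite (_ : 6 * B * (c / (12 * B)) = c / 2) in h4; last by field; rewrite gt_eqF.
  by move: h1 h2 h3 h4; clear; lra.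
have px : enorm (- gradient u0 x) <= P by rewrite enormN; exact: gradP.
have taylor y : Omega y -> enorm (y - x) <= r ->
    2^-1 - u0 y <= 2^-1 - u0 x + dot (- gradient u0 x) (y - x) + C * dot (y - x) (y - x).
  move=> Oy yx; have := tay x y Ox Oy (le_trans yx rr1); rewrite gr_dot ler_norml => /andP[h _].
  by rewrite dotNl; move: h; clear; lra.
have [y Oy yx|beta [q [be qE qL]]] := hL (fun y => 2^-1 - u0 y) x _ Ox px nx.
  rewrite taylor // andbT subr_ge0 ltW //; apply: (data_outside data Oy); exact: zy.
(* No linear term is allowed here. The multiple of [n x] in the gradient is represented by
   [beta * psi]; the remainder [q] is dropped, and half of the value at [x] pays for it. *)
exists ((u0 x - 2^-1) / 2), 0, beta; split=> //.
- by rewrite enorm0 ltW.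
- by left.
split=> // [|y Oy yx]; first by move: fP2 P0; clear; lra.
have h1 : u0 y - u0 x + dot (- gradient u0 x) (y - x) <= C * dot (y - x) (y - x).
  have := tay x y Ox Oy (le_trans yx rr1); rewrite gr_dot ler_norml => /andP[_].
  by rewrite dotNl.
have h2 := predefining_taylor x y pd; rewrite ler_norml in h2; case/andP: h2 => h2 _.
have /andP[be0 be1] := be; rewrite /= in qL.
set D2 := dot (y - x) (y - x) in h1 h2 *.
have D20 : 0 <= D2 by exact: dot_ge0.
have h3 : beta * dot (n x) (y - x) <= beta * (psi y - psi x) + betam * B * D2.
  have : beta * dot (n x) (y - x) <= beta * (psi y - psi x + B * D2).
    by rewrite ler_wpM2l //; move: h2; clear; lra.
  have : beta * (B * D2) <= betam * (B * D2) by rewrite ler_wpM2r // mulr_ge0 // ltW.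
  by clear; lra.
(* Young inequality with parameter [L], combined with the bound on the square of the length of [q]
   by [L] times [2^-1 - u0 x]. *)
have h4 : - dot q (y - x) <= (2^-1 - u0 x) / 2 + L / 2 * D2.
  have a1 := cauchy_schwarz q (y - x); rewrite ler_norml in a1; case/andP: a1 => a1 _.
  have a2 : D2 = enorm (y - x) ^+ 2 by rewrite enorm_sqr.
  have a3 : 0 <= (enorm q - L * enorm (y - x)) ^+ 2 by exact: sqr_ge0.
  rewrite -(@ler_pM2l _ (2 * L)) ?mulr_gt0 //.
  have a4 : L * - dot q (y - x) <= L * (enorm q * enorm (y - x)) by rewrite ler_pM2l // lerNl.
  rewrite a2; move: a3 a4 qL; move: (dot q _) (enorm q) (enorm (y - x)) => s1' s2' s3'; clear.
  by rewrite !expr2; lra.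
have qd : dot q (y - x) = dot (- gradient u0 x) (y - x) + beta * dot (n x) (y - x).
  by rewrite qE dotDl dotZl.
rewrite dot0l addr0 /K0; move: h1 h3 h4 qd; move: (dot (- _) _) (dot (n x) _) (dot q _) => t1 t2 t3.
move: (psi y - psi x) => t4.
clear; lra.
Qed.

Theorem theorem4p1 (R : realType) (N : nat) (hN : (2 <= N)%N)
    (Omega : set 'rV[R]_N) (hOmega : smooth_bounded_domain Omega)
    (T : R) (hT : 0 < T)
    (lambda alpha : R) (hlambda : 0 < lambda) (halpha : 0 < alpha)
    (chi : R -> R) (hchi : admissible_sensitivity chi)
    (C0 : R) (hC0 : 1 < C0)
    (u0 v0 m0 : 'rV[R]_N -> R) (hdata : admissible_data Omega C0 u0 v0 m0)
    (eta : R) (heta : 0 < eta < 4^-1) :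
  exists eps0 M0 : R, [/\ 0 < eps0, 0 < M0 &
    forall eps : R, 0 < eps <= eps0 ->
    forall u v m : 'rV[R]_N -> R -> R,
      nonnegative_solution Omega T lambda alpha chi u0 v0 m0 eps u v m ->
    let tstar := mu^-1 * eps ^+ 2 * `|ln eps| in
    (forall x, Omega x -> - eta <= u x tstar <= 1 + eta) /\
    (forall x, Omega x -> M0 * eps <= `|u0 x - 2^-1| ->
       (2^-1 + M0 * eps <= u0 x -> 1 - eta <= u x tstar) /\
       (u0 x <= 2^-1 - M0 * eps -> u x tstar <= eta))].
Proof.
have /andP[eta0 eta4] := heta.
have eta1 : 0 < eta < 1 by rewrite eta0 /=; clear - eta4; lra.
have [e1 e10 up] := upper_barrier hOmega hT hlambda halpha hchi hdata eta0.
have [B1 B10 datum] := barrier_datum hOmega hdata.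
have [e2 [Y [e20 Y0 trans]]] := transition_barrier hOmega hT hlambda halpha hchi hdata eta1 B10.
(* [barrier_datum] keeps half of the deviation at [x], and the shift by [eps] below consumes one
   more [eps]; [Y * eps] must remain. *)
exists (Num.min (Num.min e1 e2) (Num.min 1 (T / 4))), (2 * (Y + 1)); split.
- by rewrite !lt_min e10 e20 ltr01 divr_gt0.
- by rewrite mulr_gt0 // addr_gt0.
move=> eps /andP[ep0]; rewrite !le_min => /andP[/andP[ee1 ee2] /andP[ee3 ee4]] u v m s.
rewrite muE invrK; set ts := 4 * eps ^+ 2 * _.
have [ep1 ep2] : 0 < eps <= e1 /\ 0 < eps <= e2 by rewrite ep0.
have key sigma x : sigma = 1 \/ sigma = -1 /\ 2^-1 < u0 x -> Omega x ->
    sigma * (u0 x - 2^-1) <= - (2 * (Y + 1) * eps) -> sigma * (u x ts - 2^-1) <= - 2^-1 + eta.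
  move=> hs Ox far.
  have Ye : 0 < Y * eps by exact: mulr_gt0.
  have s1 : `|sigma| = 1 by case: hs => [->|[-> _]]; rewrite ?normrN normr1.
  have [|zeta [G [K [zC zc zB zN [zge zx]]]]] := datum sigma x hs Ox.
    by clear - far Ye ep0; lra.
  (* The shift by [eps] makes the initial inequality strict, as [transition_barrier] requires. *)
  have := trans eps u v m ep2 s sigma (fun y => zeta y + eps) (fun y p => G y p + 0)
    (fun y p => K y p + 0) s1 (C2on_add zC (C2on_const eps)) (wcont_add zc (@wcont_cst R 'rV[R]_N (closure Omega) eps)).
  move=> /(_ _ _ _ x Ox); apply.
  - by move=> y i Oy; rewrite !addr0; exact: zB.
  - move=> y nu bx ex; have [c [d [c0 d0 h]]] := zN y nu bx ex; exists c, d; split=> // k /h.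
    by rewrite addrAC lerD2r.
  - by move=> y cy; apply: le_lt_trans (zge y cy) _; rewrite ltrDl.
  by clear - zx far ep0; lra.
split=> [x Ox|x Ox _].
  rewrite (up eps u v m ep1 s x Ox) andbT; have [_ pu _ _] := s.
  have /generation_time_le/andP[t0 t1] : 0 < eps <= 1 by rewrite ep0.
  (* The lower bound in (a) is nonnegativity of [u], known on [[0, T]]; the bound [eps <= T / 4]
     places the final time there. *)
  apply: (le_trans _ (pu x ts Ox _)); first by clear - eta0; lra.
  by rewrite t0 (le_trans t1) //; clear - ee4; lra.
have M0 : 0 < 2 * (Y + 1) * eps by rewrite !mulr_gt0 // addr_gt0.
split=> h.
  have := key (-1) x (or_intror (conj (erefl _) _)) Ox.
  have ux : 2^-1 < u0 x by clear - h M0; lra.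
  by move=> /(_ ux) k; have {}k : -1 * (u x ts - 2^-1) <= - 2^-1 + eta;
    [apply: k; clear - h; lra|clear - k; lra].
have := key 1 x (or_introl (erefl _)) Ox.
by move=> k; have {}k : 1 * (u x ts - 2^-1) <= - 2^-1 + eta; [apply: k; clear - h; lra|clear - k; lra].
Qed.
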